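(* Let $d\ge 1$ and let $\omega=(\omega(v))_{v\in\mathbb{Z}^d}$ be a finitely supported vector of non-negative reals with $\sum_{v}\omega(v)=1$, which is centered ($\sum_v \omega(v)v=0$), symmetric ($\omega(-v)=\omega(v)$ for all $v$), and aperiodic, and whose covariance matrix $Q=\sum_{v\in\mathbb{Z}^d}\omega(v)vv^\top$ has full rank. Let $(x_n)_{n\ge 0}$ be the iterates of the Jacobi polynomial iteration on $\mathbb{Z}^d$ initialized at $x_0={\boldsymbol 1}_0$ (defined in the context). Let $$u(t,y)=\frac{\Gamma(d/2+1)}{\pi^{d/2}(\det Q)^{1/2}}\,\frac{1}{t^d}\,{\boldsymbol 1}_{\{\langle y,Q^{-1}y\rangle\le t^2\}},\qquad t>0,\ y\in\mathbb{R}^d.$$ Then for every $t>0$, the signed measures $\sum_{v\in\mathbb{Z}^d}x_{\lfloor t/\varepsilon\rfloor}(v)\,\delta_{\varepsilon v}$ converge weakly (i.e., against bounded continuous test functions) to the measure $u(t,y)\,\mathrm{d}y$ as $\varepsilon\to 0$.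
   Context: ${\boldsymbol 1}_v$ denotes the vector in $\mathbb{R}^{\mathbb{Z}^d}$ with entry $1$ at $v$ and $0$ elsewhere; $\delta_y$ is the Dirac mass at $y\in\mathbb{R}^d$; $\lfloor s\rfloor$ is the integer part. The convolution is $(\omega*x)(v)=\sum_{\eta\in\mathbb{Z}^d}\omega(v-\eta)x(\eta)$. $\omega$ is called aperiodic if the random walk on $\mathbb{Z}^d$ with increments distributed according to $\omega$ is an aperiodic Markov chain. The Jacobi polynomial iteration is: $x_0={\boldsymbol 1}_0$, $x_1=a_0\,\omega*x_0+b_0x_0$, and $x_{n+1}=a_n\,\omega*x_n+b_nx_n-c_nx_{n-1}$ for $n\ge1$, where $a_0=\frac{d+4}{2(2+d)}$, $b_0=\frac{d}{2(2+d)}$, and for $n\ge 1$: $a_n=\frac{(2n+d/2+1)(2n+d/2+2)}{2(n+1+d/2)^2}$, $b_n=\frac{d^2(2n+d/2+1)}{8(n+1+d/2)^2(2n+d/2)}$, $c_n=\frac{n^2(2n+d/2+2)}{(n+1+d/2)^2(2n+d/2)}$. *)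

(* Defs.v *)
From HB Require Import structures.
From mathcomp Require Import all_boot all_order all_algebra.
From mathcomp Require Import all_classical all_reals all_analysis.
Set Implicit Arguments. Unset Strict Implicit. Unset Printing Implicit Defensive.
Import Order.TTheory GRing.Theory Num.Theory.
Import numFieldNormedType.Exports.
Local Open Scope classical_set_scope.
Local Open Scope ring_scope.

Section Defs.
Variable R : realType.
Variable d : nat.

Definition Zvec := 'rV[int]_d.

Definition toR (v : Zvec) : 'rV[R]_d := map_mx (fun z : int => z%:~R) v.

Definition indic (v : Zvec) : Zvec -> R := fun w => if w == v then 1 else 0.

Definition zconv (omega x : Zvec -> R) : Zvec -> R :=
  fun v => \sum_(eta \in [set: Zvec]) omega (v - eta) * x eta.

Definition dR : R := d%:R.
Definition jac_a (n : nat) : R :=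
  if n is 0 then (dR + 4) / (2 * (2 + dR))
  else (2 * n%:R + dR / 2 + 1) * (2 * n%:R + dR / 2 + 2)
       / (2 * (n%:R + 1 + dR / 2) ^+ 2).
Definition jac_b (n : nat) : R :=
  if n is 0 then dR / (2 * (2 + dR))
  else dR ^+ 2 * (2 * n%:R + dR / 2 + 1)
       / (8 * (n%:R + 1 + dR / 2) ^+ 2 * (2 * n%:R + dR / 2)).
Definition jac_c (n : nat) : R :=
  n%:R ^+ 2 * (2 * n%:R + dR / 2 + 2)
   / ((n%:R + 1 + dR / 2) ^+ 2 * (2 * n%:R + dR / 2)).

(* jac_pair omega n = (x_n, x_{n+1}) *)
Fixpoint jac_pair (omega : Zvec -> R) (n : nat) : (Zvec -> R) * (Zvec -> R) :=
  match n with
  | 0 => (indic 0, fun v => jac_a 0 * zconv omega (indic 0) v + jac_b 0 * indic 0 v)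
  | m.+1 => let p := jac_pair omega m in
      (p.2, fun v => jac_a m.+1 * zconv omega p.2 v + jac_b m.+1 * p.2 v
                     - jac_c m.+1 * p.1 v)
  end.

Definition jacobi (omega : Zvec -> R) (n : nat) : Zvec -> R := (jac_pair omega n).1.

Definition step_prob (omega : Zvec -> R) (n : nat) (v w : Zvec) : R :=
  iter n (zconv omega) (indic v) w.

(* rw_aperiodic: every state has period 1, i.e. the gcd of the return times
   {n >= 1 | P^n(v,v) > 0} is 1 *)
Definition rw_aperiodic (omega : Zvec -> R) : Prop :=
  forall (v : Zvec) (k : nat),
    (forall n : nat, (0 < n)%N -> 0 < step_prob omega n v v -> (k %| n)%N) ->
    k = 1%N.

Definition cov_matrix (omega : Zvec -> R) : 'M[R]_d :=
  \sum_(v \in [set: Zvec]) omega v *: ((toR v)^T *m toR v).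

Definition Gamma_fn (s : R) : R :=
  Rintegral lebesgue_measure `]0%R, +oo[%classic
    (fun x : R => x `^ (s - 1) * expR (- x)).

Definition u_lim (Q : 'M[R]_d) (t : R) (y : 'rV[R]_d) : R :=
  Gamma_fn (dR / 2 + 1) / (pi `^ (dR / 2) * Num.sqrt (\det Q)) / t ^+ d
  * (if (y *m invmx Q *m y^T) 0 0 <= t ^+ 2 then 1 else 0).

End Defs.

(* Lebesgue integral over R^n, written as iterated one-dimensional
   Lebesgue integrals (Fubini) *)
Fixpoint integral_Rn (R : realType) (n : nat) : ('rV[R]_n -> R) -> R :=
  match n with
  | 0 => fun f => f 0
  | m.+1 => fun f =>
      Rintegral lebesgue_measure [set: R]
        (fun x : R => integral_Rn (fun y : 'rV[R]_m =>
            f (row_mx (const_mx x : 'rV[R]_1) y)))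
  end.

(* Main.v *)
(* With D = (1 - W)/2, W being the averaging operator of the walk, the iterate
   x_n is P_n(D) applied to the Dirac mass at 0, where P_n is the Jacobi
   polynomial of parameters (d/2, 0) shifted to [0, 1] and normalized by
   P_n(0) = 1. Since D lowers the degree of polynomials by 2, pairing x_n with
   the powers of a linear form gives explicit sums whose scaling limits are the
   moments of the uniform law on the ellipsoid; the latter are computed by a
   Cholesky change of variables and an induction on the dimension.

   Powers of linear forms approximate a continuous function only on bounded
   sets, and x_n is signed, so a uniform bound on the total variation of x_n is
   needed. By Cauchy-Schwarz, as x_n lives in a box of side O(n), it is enough
   that the sum of x_n(v)^2 is O(n^-d). By Parseval on a large discrete torus
   this sum is the average of P_n(z(xi))^2 over the frequencies xi, where
   z(xi) = (1 - omega^(xi))/2. Energy estimates for the Jacobi differential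
   equation give P_n(z)^2 <= C (2 4^d)^-j as soon as n^2 z >= A 16^j, up to an
   additive C n^-d, while the proportion of the frequencies with
   n^2 z(xi) <= A 16^(j+1) is at most (E 4^j / n)^d; the sum over j converges. *)
Require Import Defs.
From HB Require Import structures.
From mathcomp Require Import all_boot all_order all_algebra.
From mathcomp Require Import all_classical all_reals all_analysis.
From mathcomp Require Import measurable_realfun ring lra zify.
Import Order.TTheory GRing.Theory Num.Theory.
Import numFieldNormedType.Exports.
Local Open Scope classical_set_scope.
Local Open Scope ring_scope.
Set Implicit Arguments.
Unset Strict Implicit.
Unset Printing Implicit Defensive.

(** Summing over the levels requires P_n(z)^2 to decay faster than (n^2 z)^(-d/2). The exponent d/2
    + 1/4 leaves the summable factor 2^-j and turns the weight z^(d/2 + 1/4) into the polynomial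
    s^(2d + 1) in s = z^(1/4). Away from z = 0 the energy is controlled by its values at 1/10 and at
    1, and the value at 1 is an explicit product of order n^(-d/2) in absolute value. The order of
    the torus is prime to the determinant of d independent vectors of the support. A frequency is
    then determined by its products with these vectors, and counting frequencies reduces to counting
    residues of a cyclic group. Since [omega] is even, cosines suffice. The only test functions are
    powers of linear forms. Their density on a cube is obtained in two stages: Bernstein
    approximation in the variables exp(y_i - r) gives sums of exponentials of linear forms, and the
    exponential series turns these into powers. *)

Ltac nonzero :=
  repeat (apply/andP; split); apply: lt0r_neq0; lra.

(** * The Jacobi polynomials with parameters d/2 and 0 and their decay *)

(** The coefficients (-n)_j (n + a + 1)_j / (j! (a + 1)_j) of the hypergeometric series 2F1(-n, n +
    a + 1; a + 1; z). *)
Definition jacobi_coef (R : realType) (a : R) (n j : nat) : R :=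
  \prod_(i < j) (- (n%:R - i%:R) * (n%:R + i%:R + a + 1)
                 / ((i%:R + 1) * (i%:R + a + 1))).

Definition jacobi_poly (R : realType) (a : R) (n : nat) : {poly R} :=
  \poly_(j < n.+1) jacobi_coef a n j.

Section JacobiPoly.
Variables (R : realType) (a : R).
Hypothesis a_gt0 : 0 < a.
Implicit Types (n j k : nat).

Let nat_ge0 n : 0 <= n%:R :> R. Proof. exact: ler0n. Qed.

Lemma jacobi_coef0 n : jacobi_coef a n 0 = 1.
Proof. by rewrite /jacobi_coef big_ord0. Qed.

Lemma jacobi_coefS n j : jacobi_coef a n j.+1 = jacobi_coef a n j *
  (- (n%:R - j%:R) * (n%:R + j%:R + a + 1) / ((j%:R + 1) * (j%:R + a + 1))).
Proof. by rewrite /jacobi_coef big_ord_recr. Qed.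

Lemma jacobi_coef_gt n j : (n < j)%N -> jacobi_coef a n j = 0.
Proof.
elim: j => // j IH; rewrite ltnS leq_eqVlt => /orP[/eqP <-|/IH h].
  by rewrite jacobi_coefS subrr oppr0 !mul0r mulr0.
by rewrite jacobi_coefS h mul0r.
Qed.

Lemma coef_jacobi_poly n j : (jacobi_poly a n)`_j = jacobi_coef a n j.
Proof.
by rewrite coef_poly; case: ltnP => // h; rewrite jacobi_coef_gt.
Qed.

(** Degree and index are shifted together because (-n-1)_(k+1) = (-n-1) (-n)_k; changing the degree
    at fixed index would bring in the denominator n + 1 - k, which can vanish. *)
Lemma jacobi_coef_up n k : jacobi_coef a n.+1 k.+1 = - jacobi_coef a n k *
  ((n%:R + 1) * (n%:R + a + 1 + k%:R) * (n%:R + a + 2 + k%:R)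
   / ((n%:R + a + 1) * (k%:R + 1) * (k%:R + a + 1))).
Proof.
have := nat_ge0 n => n0; have := a_gt0 => a0.
elim: k => [|k IH].
  rewrite jacobi_coefS !jacobi_coef0; field.
  by nonzero.
rewrite jacobi_coefS IH jacobi_coefS -!(natr1 k) -(natr1 n).
have := nat_ge0 k => k0; field.
by nonzero.
Qed.

Lemma jacobi_coef_down n k : jacobi_coef a n k.+1 = - jacobi_coef a n.+1 k *
  ((n%:R + 1 - k%:R) * (n%:R - k%:R) * (n%:R + 1 + a)
   / ((n%:R + 1) * (k%:R + 1) * (k%:R + a + 1))).
Proof.
have := nat_ge0 n => n0; have := a_gt0 => a0.
elim: k => [|k IH].
  rewrite jacobi_coefS !jacobi_coef0; field.
  by nonzero.
rewrite jacobi_coefS IH jacobi_coefS -!(natr1 k) -(natr1 n).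
have := nat_ge0 k => k0; field.
by nonzero.
Qed.

(** Read coefficient by coefficient, this hypergeometric equation is the ratio of consecutive
    coefficients given by [jacobi_coefS]. *)
Lemma jacobi_ode n (y := jacobi_poly a n) :
  'X * (1 - 'X) * y^`()^`() + ((a + 1)%:P - (a + 2)%:P * 'X) * y^`()
  + (n%:R * (n%:R + a + 1))%:P * y = 0.
Proof.
apply/polyP => i; rewrite coef0.
have -> : 'X * (1 - 'X) * y^`()^`() + ((a + 1)%:P - (a + 2)%:P * 'X) * y^`()
  = y^`()^`() * 'X - y^`()^`() * 'X * 'X + (a + 1)%:P * y^`()
    - (a + 2)%:P * (y^`() * 'X) by ring.
rewrite !(coefD, coefN, coefCM, coefMX) !coef_deriv !coef_jacobi_poly.
have := a_gt0 => a0; have := nat_ge0 i; case: i => [|[|i]] i0 /=;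
  rewrite !jacobi_coefS ?jacobi_coef0 /=.
- by field; nonzero.
- by field; nonzero.
rewrite -!(mulr_natr (_ * _)) -!natr1 in i0 *.
by have := nat_ge0 i => ?; field; nonzero.
Qed.

End JacobiPoly.

Section JacobiRec.
Variables (R : realType) (d : nat).
Hypothesis d_gt0 : (0 < d)%N.
Variable a : R.
Hypothesis aE : d%:R = 2 * a.
Let a_gt0 : 0 < a.
Proof. by move: d_gt0; rewrite -(ltr0n R) aE pmulr_rgt0. Qed.

Lemma jacobi_poly0 : jacobi_poly a 0 = 1.
Proof.
by apply/polyP => -[|i]; rewrite coef_jacobi_poly coef1 ?jacobi_coef0 ?jacobi_coef_gt.
Qed.

Lemma jacobi_poly1 :
  jacobi_poly a 1 = (jac_a R d 0)%:P * (1 - 2%:P * 'X) + (jac_b R d 0)%:P.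
Proof.
have := a_gt0 => a0; rewrite /jac_a /jac_b /dR.
rewrite aE.
apply/polyP => -[|[|i]]; rewrite coef_jacobi_poly mulrBr mulr1 [_ * (_ * 'X)]mulrA -polyCM
  !(coefD, coefN, coefC, coefMX) /=.
- by rewrite jacobi_coef0; field; nonzero.
- by rewrite jacobi_coefS jacobi_coef0; field; nonzero.
by rewrite jacobi_coef_gt // !subr0 addr0.
Qed.

(** The variable is z = (1 - w)/2, so [1 - 2%:P * 'X] stands for the walk operator w. At index k + 1
    the three degrees all reduce to multiples of [jacobi_coef a n.+1 k], and a rational identity
    remains. *)
Lemma jacobi_polySS n : jacobi_poly a n.+2 =
  ((jac_a R d n.+1)%:P * (1 - 2%:P * 'X) + (jac_b R d n.+1)%:P) * jacobi_poly a n.+1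
  - (jac_c R d n.+1)%:P * jacobi_poly a n.
Proof.
have := a_gt0 => a0; rewrite /jac_a /jac_b /jac_c /dR.
have n0 : 0 <= n%:R :> R by exact: ler0n.
rewrite aE.
rewrite (mulrDl _ _ (jacobi_poly a n.+1)) mulrBr mulr1 mulrBl [_ * (_ * 'X)]mulrA -polyCM.
rewrite -[_ * 'X * _]mulrA (mulrC 'X) !mulrA.
apply/polyP => -[|k]; rewrite !(coefD, coefN, coefCM, coefMX) /= !coef_jacobi_poly.
  rewrite !jacobi_coef0 -?(natr1 n.+1) -!(natr1 n); field.
  by nonzero.
rewrite (jacobi_coef_up a_gt0 n.+1 k) (jacobi_coef_down a_gt0 n k) jacobi_coefS.
have k0 : 0 <= k%:R :> R by exact: ler0n.
rewrite -?(natr1 n.+1) -!(natr1 n); field.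
by nonzero.
Qed.

End JacobiRec.

Lemma poly_nincr (R : realType) (p : {poly R}) (x y : R) : x <= y ->
  (forall c, x <= c <= y -> p^`().[c] <= 0) -> p.[y] <= p.[x].
Proof.
move=> xy p'0.
have [|c cxy pE] := @MVT_segment _ (horner p) (horner p^`()) _ _ xy
    (fun c _ => is_derive_poly p c).
  by apply/continuous_subspaceT => c; exact: continuous_horner.
by rewrite -subr_le0 pE mulr_le0_ge0 ?subr_ge0 // p'0.
Qed.

Lemma deriv_quartic (R : realType) (G : {poly R}) (e : nat) (c : R) :
  ('X^(e.+1) * (G \Po 'X^4))^`().[c] =
  c ^+ e * (e.+1%:R * G.[c ^+ 4] + 4 * c ^+ 4 * G^`().[c ^+ 4]).
Proof.
rewrite derivM deriv_comp !derivXn hornerD !hornerM !horner_comp !hornerMn !hornerXn /=.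
by rewrite (exprS c e) -[c ^+ e *+ _]mulr_natr; ring.
Qed.

(** * Energy estimates from the Jacobi differential equation *)

Section Energy.
Variables (R : realType) (d : nat) (a : R).
Hypothesis d_gt0 : (0 < d)%N.
Hypothesis aE : d%:R = 2 * a.
Variable n : nat.
Hypothesis n_gt0 : (0 < n)%N.

Let a_gt0 : 0 < a.
Proof. by move: d_gt0; rewrite -(ltr0n R) aE pmulr_rgt0. Qed.
Let M : R := n%:R * (n%:R + a + 1).
Let M_gt0 : 0 < M.
Proof. by rewrite mulr_gt0 ?ltr0n // addr_gt0 // addr_gt0 // ltr0n. Qed.
Let y := jacobi_poly a n.
Let k := a + 2^-1.

Let ode : 'X * (1 - 'X) * y^`()^`() =
  - ((a + 1)%:P - (a + 2)%:P * 'X) * y^`() - M%:P * y.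
Proof.
by apply/eqP; rewrite -subr_eq0 -(jacobi_ode a_gt0 n) /M /y; apply/eqP; ring.
Qed.

(* The energy y^2 + z(1-z)y'^2/M decreases, then increases, on [0, 1]. *)
Definition jacobi_energy : {poly R} :=
  y ^+ 2 + (M^-1)%:P * ('X * (1 - 'X) * y^`() ^+ 2).

(** The equation eliminates y''. The weight 1/M makes the cross terms y y' cancel, which leaves y'^2
    times an affine factor changing sign at (2a + 1)/(2a + 2). *)
Lemma deriv_jacobi_energy : jacobi_energy^`() =
  (M^-1)%:P * y^`() ^+ 2 * ((2 * a + 2)%:P * 'X - (2 * a + 1)%:P).
Proof.
have MV : (M^-1)%:P * M%:P = 1 by rewrite -polyCM mulVf // gt_eqF.
rewrite /jacobi_energy !(expr2, derivD, derivM, derivB, derivX, derivC, derivN) /=.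
transitivity (y * y^`() *+ 2 + (M^-1)%:P * ((1 - 2%:P * 'X) * y^`() ^+ 2
   + 2%:P * y^`() * ('X * (1 - 'X) * y^`()^`()))); first by ring.
rewrite ode.
transitivity ((2%:P - 2%:P * ((M^-1)%:P * M%:P)) * (y * y^`())
  + (M^-1)%:P * y^`() ^+ 2 * ((2 * a + 2)%:P * 'X - (2 * a + 1)%:P)); first by ring.
by rewrite MV; ring.
Qed.

Lemma jacobi_energy0 : jacobi_energy.[0] = 1.
Proof.
rewrite /jacobi_energy !(hornerD, hornerN, hornerM, hornerX, hornerC, horner_exp) /y.
by rewrite horner_coef0 coef_jacobi_poly jacobi_coef0; ring.
Qed.

Lemma sqr_le_jacobi_energy (z : R) : 0 <= z <= 1 -> y.[z] ^+ 2 <= jacobi_energy.[z].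
Proof.
move=> /andP[z0 z1]; rewrite /jacobi_energy !(hornerD, hornerN, hornerM, hornerX, hornerC, horner_exp) lerDl.
by rewrite mulr_ge0 ?invr_ge0 ?(ltW M_gt0) // mulr_ge0 ?sqr_ge0 // mulr_ge0 // subr_ge0.
Qed.

Lemma jacobi_energy_dec (z w : R) : 0 <= z -> z <= w -> (2 * a + 2) * w <= 2 * a + 1 ->
  jacobi_energy.[w] <= jacobi_energy.[z].
Proof.
move=> z0 zw w1; apply: poly_nincr => // c /andP[zc cw].
rewrite deriv_jacobi_energy !(hornerD, hornerN, hornerM, hornerX, hornerC, horner_exp) mulr_ge0_le0 //.
  by rewrite mulr_ge0 ?sqr_ge0 // invr_ge0 ltW.
by rewrite subr_le0 (le_trans _ w1) // ler_wpM2l //; have := a_gt0; lra.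
Qed.

Lemma jacobi_energy_inc (z w : R) : z <= w -> w <= 1 -> 2 * a + 1 <= (2 * a + 2) * z ->
  jacobi_energy.[z] <= jacobi_energy.[w].
Proof.
move=> zw w1 z1; rewrite -lerN2 -!hornerN; apply: poly_nincr => // c /andP[zc cw].
rewrite derivN deriv_jacobi_energy !(hornerD, hornerN, hornerM, hornerX, hornerC, horner_exp) oppr_le0 mulr_ge0 //.
  by rewrite mulr_ge0 ?sqr_ge0 // invr_ge0 ltW.
by rewrite subr_ge0 (le_trans z1) // ler_wpM2l //; have := a_gt0; lra.
Qed.

(* z^(a + 1/4) times this modified energy is decreasing away from 0; the
   substitution z = s^4 makes the prefactor a polynomial in s. *)
Let F := jacobi_energy + (k / M)%:P * ((1 - 'X) * (y * y^`())).

(** The choice k = a + 1/2 balances the two squares: y^2 receives a + 1/4 - k, and z y'^2 / M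
    receives a + 1/4 - (2a + 1) + k to first order in z; both equal -1/4. The mixed term is
    dominated once M z is large. *)
Let deriv_F : (a + 4^-1)%:P * F + 'X * F^`() =
  - (4^-1)%:P * y ^+ 2
  + (M^-1)%:P * ('X * (- (4^-1)%:P + (5 / 4)%:P * 'X) * y^`() ^+ 2)
  - (3 / 4 * k / M)%:P * ((1 - 'X) * (y * y^`())).
Proof.
have MV : (M^-1)%:P * M%:P = 1 by rewrite -polyCM mulVf // gt_eqF.
rewrite /F derivD deriv_jacobi_energy /jacobi_energy.
rewrite !(derivM, derivB, derivX, derivC, derivN) /=.
rewrite [X in _ = X]addrC.
transitivity ((a + 4^-1)%:P * (y ^+ 2 + (M^-1)%:P * ('X * (1 - 'X) * y^`() ^+ 2)
   + (k / M)%:P * ((1 - 'X) * (y * y^`())))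
  + 'X * (M^-1)%:P * y^`() ^+ 2 * ((2 * a + 2)%:P * 'X - (2 * a + 1)%:P)
  + (k / M)%:P * ('X * (1 - 'X) * y^`() ^+ 2 - 'X * (y * y^`())
      + y * ('X * (1 - 'X) * y^`()^`()))); first by ring.
rewrite ode polyCM !(polyCM _ M^-1) /k.
have -> : 2^-1 = 2 * 4^-1 :> R by field.
set m := M%:P in MV *; rewrite !(polyCM, polyCD, polyCN).
set q := (4^-1)%:P; have q4 : 4 * q - 1 = 0.
  by rewrite /q -polyC_natr -polyCM mulfV ?pnatr_eq0 // polyC1 subrr.
set mi := (M^-1)%:P in MV *; apply/eqP; rewrite -subr_eq0; apply/eqP.
transitivity ((a%:P + 2 * q) * (1 - mi * m) * y ^+ 2 + (4 * q - 1) *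
  (mi * ('X * (1 - 2 * 'X) * y^`() ^+ 2)
   + mi * (a%:P + 2 * q) * ((1 - 'X) * (y * y^`())))); first by ring.
by rewrite q4 MV subrr !(mulr0, mul0r) addr0.
Qed.

(** Completing the square in y, with either sign t of the mixed term, shows that this term is at
    most half of the energy. *)
Let F_near_energy (z : R) : 0 <= z <= 1 -> k ^+ 2 / M <= z ->
  jacobi_energy.[z] <= 2 * F.[z] <= 3 * jacobi_energy.[z].
Proof.
move=> /andP[z0 z1] kz; rewrite /F /jacobi_energy.
rewrite !(hornerD, hornerN, hornerM, hornerX, hornerC, horner_exp).
set Y := y.[z]; set D := y^`().[z]; rewrite expr2 in kz.
set e := M^-1 in kz *; have e0 : 0 < e by rewrite invr_gt0.
have main (t : R) : t ^+ 2 = 1 ->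
    0 <= Y ^+ 2 + e * (z * (1 - z) * D ^+ 2) + 2 * t * (k * e * ((1 - z) * (Y * D))).
  move=> t1; apply: (@le_trans _ _ ((Y + t * k * e * (1 - z) * D) ^+ 2)).
    exact: sqr_ge0.
  rewrite -subr_ge0 (_ : _ - _ = (1 - z) * (D ^+ 2 * (e * (z - t ^+ 2 * (k * k * e) * (1 - z)))));
    last by ring.
  rewrite t1 mul1r mulr_ge0 ?subr_ge0 // mulr_ge0 ?sqr_ge0 // mulr_ge0 ?(ltW e0) //.
  rewrite subr_ge0 (le_trans _ kz) // ler_piMr ?(mulr_ge0 (sqr_ge0 k)) ?(ltW e0) //.
  by rewrite lerBlDr lerDl.
have sq1 : (-1) ^+ 2 = 1 :> R by rewrite sqrrN expr1n.
have := main 1 (expr1n _ _); have := main (-1) sq1.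
lra.
Qed.

(** The function c^(2d + 1) F(c^4) is nonincreasing on [s1, s], since 4 (a + 1/4) = 2d + 1. The
    factor 3 comes from E <= 2F <= 3E for the energy E, which is at most 1 at s1^4. *)
Lemma jacobi_energy_decay (s1 s : R) : 0 < s1 -> s1 <= s ->
  9 / 2 * k ^+ 2 <= M * s1 ^+ 4 -> s ^+ 4 <= 10^-1 ->
  s ^+ (2 * d).+1 * jacobi_energy.[s ^+ 4] <= 3 * s1 ^+ (2 * d).+1.
Proof.
move=> s10 ss1 ks1 s4.
have pw c : s1 <= c -> s1 ^+ 4 <= c ^+ 4.
  by move=> sc; apply: lerXn2r => //; rewrite nnegrE ?(ltW s10) // (le_trans (ltW s10)).
have kM c : s1 <= c -> 9 / 2 * (k ^+ 2 / M) <= c ^+ 4.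
  move=> /pw sc; rewrite mulrA ler_pdivrMr // (le_trans ks1) // mulrC.
  by rewrite ler_pM2r.
have kM0 : 0 <= k ^+ 2 / M by rewrite mulr_ge0 ?sqr_ge0 // invr_ge0 ltW.
have c1 c : s1 <= c -> c <= s -> c ^+ 4 <= 10^-1.
  move=> sc cs; apply: le_trans s4; apply: lerXn2r => //; rewrite nnegrE.
    exact: le_trans (ltW s10) sc.
  exact: le_trans (ltW s10) ss1.
pose H := 'X^((2 * d).+1) * (F \Po 'X^4).
have HE c : H.[c] = c ^+ (2 * d).+1 * F.[c ^+ 4].
  by rewrite /H hornerM horner_comp !hornerXn.
have H'E c : H^`().[c] = 4 * c ^+ (2 * d) *
    ((a + 4^-1)%:P * F + 'X * F^`()).[c ^+ 4].
  rewrite /H deriv_quartic -natr1 natrM aE [in RHS](hornerD (_ * F)).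
  rewrite [in RHS](hornerM _ F) [in RHS](hornerM _ F^`()) hornerC hornerX.
  by field.
have Hle : H.[s] <= H.[s1].
  apply: poly_nincr => // c /andP[sc cs].
  rewrite H'E deriv_F pmulr_rle0; last by rewrite mulr_gt0 // exprn_gt0 // (lt_le_trans s10).
  set z := c ^+ 4; have z1 : z <= 10^-1 by exact: c1.
  have := kM _ sc; rewrite -/z => kz.
  rewrite !(hornerD, hornerN, hornerM, hornerX, hornerC, horner_exp).
  set Y := y.[z]; set D := y^`().[z].
  set e := M^-1 in kz kM0 *; have e0 : 0 < e by rewrite invr_gt0.
  have z0 : 0 <= z by lra.
  rewrite -oppr_ge0.
  (* The square accounts for all of Y. In the remainder 1/4 - 5z/4 >= 1/8 because z <= 1/10, and z/8
     >= 9/16 k^2/M is exactly z >= 9/2 k^2/M, whence the constant 9/2. *)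
  apply: (@le_trans _ _ ((Y / 2 + 3 / 4 * k * e * (1 - z) * D) ^+ 2)).
    exact: sqr_ge0.
  rewrite -subr_ge0.
  rewrite (_ : _ - _ = D ^+ 2 * (e * (z * (4^-1 - 5 / 4 * z)
     - 9 / 16 * (k ^+ 2 * e) * (1 - z) ^+ 2))); last by field.
  rewrite mulr_ge0 ?sqr_ge0 // mulr_ge0 ?(ltW e0) //.
  have : (1 - z) ^+ 2 <= 1 by rewrite expr_le1 //; lra.
  have : 0 <= (1 - z) ^+ 2 by exact: sqr_ge0.
  set w := (1 - z) ^+ 2; set q := k ^+ 2 * e in kz kM0 *; nra.
have s0 := lt_le_trans s10 ss1.
have Fle c : s1 <= c -> c <= s ->
    jacobi_energy.[c ^+ 4] <= 2 * F.[c ^+ 4] <= 3 * jacobi_energy.[c ^+ 4].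
  move=> sc cs; apply: F_near_energy.
    by rewrite exprn_ge0 ?(le_trans (ltW s10)) //= (le_trans (c1 _ sc cs)) //; lra.
  by have := kM _ sc; set q := k ^+ 2 / M in kM0 *; lra.
have /andP[_ h1] := Fle _ (lexx s1) ss1; have /andP[h2 _] := Fle _ ss1 (lexx s).
have E1 : jacobi_energy.[s1 ^+ 4] <= 1.
  rewrite -jacobi_energy0; apply: jacobi_energy_dec => //; first by rewrite exprn_ge0 ?ltW.
  by have := c1 _ (lexx s1) ss1; have := a_gt0; nra.
apply: (@le_trans _ _ (2 * H.[s])).
  by rewrite HE mulrCA ler_pM2l ?exprn_gt0.
apply: (@le_trans _ _ (2 * H.[s1])); first by rewrite ler_pM2l.
rewrite HE mulrCA mulrC ler_pM2r ?exprn_gt0 //; lra.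
Qed.

End Energy.

(** * Pointwise bounds on the Jacobi polynomials *)

Section Bound.
Variables (R : realType) (d : nat) (a : R).
Hypothesis d_gt0 : (0 < d)%N.
Hypothesis aE : d%:R = 2 * a.

Let a_gt0 : 0 < a.
Proof. by move: d_gt0; rewrite -(ltr0n R) aE pmulr_rgt0. Qed.

(** At z = 1 the factor 1 - 2z equals -1, and the three-term recurrence becomes a rational identity
    between consecutive products. *)
Lemma jacobi_poly_at1 n :
  (jacobi_poly a n).[1] = \prod_(i < n) (- (i%:R + 1) / (i%:R + 1 + a)).
Proof.
have a0 := a_gt0.
suff : (jacobi_poly a n).[1] = \prod_(i < n) (- (i%:R + 1) / (i%:R + 1 + a)) /\
   (jacobi_poly a n.+1).[1] = \prod_(i < n.+1) (- (i%:R + 1) / (i%:R + 1 + a)) by case.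
elim: n => [|n [IH1 IH2]].
  rewrite jacobi_poly0 // hornerC big_ord0; split=> //.
  rewrite (jacobi_poly1 d_gt0 aE) big_ord_recr big_ord0 /= mul1r.
  rewrite !(hornerD, hornerN, hornerM, hornerC, hornerX) /jac_a /jac_b /dR aE.
  by field; nonzero.
split=> //; rewrite (jacobi_polySS d_gt0 aE) !(hornerD, hornerN, hornerM, hornerC, hornerX).
rewrite IH2 IH1 !big_ord_recr /=; set P := \prod_(i < n) _.
rewrite /jac_a /jac_b /jac_c /dR aE.
have n0 : 0 <= n%:R :> R by exact: ler0n.
by rewrite -!(natr1 n); field; nonzero.
Qed.

(** The squared product is at most n! d! / (n + d)!: with d = 2a and u = n + 1, the inductive step
    is u (u + 2a) <= (u + a)^2. *)
Lemma jacobi_poly_at1_bound n :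
  (jacobi_poly a n).[1] ^+ 2 * n%:R ^+ d <= d`!%:R.
Proof.
have a0 := a_gt0.
have main : (jacobi_poly a n).[1] ^+ 2 * (n + d)`!%:R <= (n`! * d`!)%:R.
  rewrite jacobi_poly_at1; elim: n => [|n IH].
    by rewrite big_ord0 expr1n !mul1r add0n fact0 mul1n.
  rewrite big_ord_recr /= addSn !factS !natrM.
  set P := \prod_(i < n) _ in IH *.
  have n0 : 0 <= n%:R :> R by exact: ler0n.
  have -> : (n + d).+1%:R = n%:R + 1 + 2 * a :> R by rewrite -natr1 natrD aE; ring.
  rewrite -(natr1 n); set u := n%:R + 1 in n0 *.
  have u0 : 0 < u by rewrite /u; lra.
  have -> : (P * (- u / (u + a))) ^+ 2 * ((u + 2 * a) * (n + d)`!%:R) =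
     (P ^+ 2 * (n + d)`!%:R) * (u ^+ 2 * (u + 2 * a) / (u + a) ^+ 2).
    by field; nonzero.
  apply: (@le_trans _ _ ((n`! * d`!)%:R * (u ^+ 2 * (u + 2 * a) / (u + a) ^+ 2))).
    rewrite ler_wpM2r // mulr_ge0 ?invr_ge0 ?sqr_ge0 // mulr_ge0 ?sqr_ge0 //; lra.
  rewrite natrM mulrAC ler_wpM2r ?ler0n // mulrC ler_wpM2r ?ler0n //.
  rewrite ler_pdivrMr ?exprn_gt0 //; last lra.
  rewrite [u ^+ 2]expr2 -mulrA ler_pM2l // -subr_ge0.
  have -> : (u + a) ^+ 2 - u * (u + 2 * a) = a ^+ 2 by ring.
  exact: sqr_ge0.
have h : (n ^ d * n`! <= (n + d)`!)%N.
  elim: (d) => [|e IHe]; first by rewrite expn0 mul1n addn0.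
  by rewrite expnS addnS factS -mulnA leq_mul // -addnS leq_addr.
have f0 : 0 < n`!%:R :> R by rewrite ltr0n fact_gt0.
rewrite -(ler_pM2r f0).
rewrite -[leRHS]natrM mulnC; apply: le_trans main.
by rewrite -mulrA ler_wpM2l ?sqr_ge0 // -natrX -natrM ler_nat.
Qed.

Lemma jacobi_poly_bound : exists A C : R, [/\ 0 < A, 0 < C &
  forall (n : nat) (z : R), (0 < n)%N -> 0 <= z <= 1 ->
  [/\ (jacobi_poly a n).[z] ^+ 2 <= C,
      10^-1 <= z -> (jacobi_poly a n).[z] ^+ 2 <= C / n%:R ^+ d &
      forall j : nat, z <= 10^-1 -> A * 16 ^+ j <= n%:R ^+ 2 * z ->
        (jacobi_poly a n).[z] ^+ 2 <= C / (2 * 4 ^+ d) ^+ j]].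
Proof.
have a0 := a_gt0.
pose k := a + 2^-1; pose A := 9 / 2 * k ^+ 2.
have k0 : 0 < k by rewrite /k; lra.
have A0 : 0 < A by rewrite mulr_gt0 ?exprn_gt0.
pose B := Num.sqrt (10 * A).
have A10 : 0 < 10 * A by rewrite mulr_gt0.
have A10' := ltW A10.
have B0 : 0 < B by rewrite sqrtr_gt0.
pose C := 3 + 3 * B ^+ d + d`!%:R.
have Bd0 : 0 < B ^+ d by rewrite exprn_gt0.
have f0 : 0 < d`!%:R :> R by rewrite ltr0n fact_gt0.
have C0 : 0 < C by rewrite /C; lra.
exists A, C; split=> // n z n0 z01; have /andP[z0 z1] := z01.
have nR0 : 0 < n%:R :> R by rewrite ltr0n.
have nd0 : 0 < n%:R ^+ d :> R by rewrite exprn_gt0.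
have nd1 : 1 <= n%:R ^+ d :> R by rewrite exprn_ege1 // ler1n.
pose M := n%:R * (n%:R + a + 1).
have nM : n%:R ^+ 2 <= M by rewrite expr2 ler_pM2l //; lra.
have M0 : 0 < M by apply: lt_le_trans nM; rewrite exprn_gt0.
have yE := sqr_le_jacobi_energy d_gt0 aE n0 z01.
have E1 (w : R) : 0 <= w -> (2 * a + 2) * w <= 2 * a + 1 -> (jacobi_energy a n).[w] <= 1.
  move=> w0 w1; have := jacobi_energy_dec d_gt0 aE n0 (lexx 0) w0 w1.
  by rewrite jacobi_energy0.
have decay (s : R) (j : nat) : 0 <= s -> s ^+ 4 <= 10^-1 ->
    A * 16 ^+ j <= M * s ^+ 4 -> (jacobi_energy a n).[s ^+ 4] <= 3 / (2 * 4 ^+ d) ^+ j.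
  rewrite le_eqVlt => /predU1P[<-|s0] s4 sA.
    move: sA; rewrite expr0n mulr0 leNgt.
    by rewrite mulr_gt0 ?exprn_gt0.
  have p0 : 0 < 2 ^+ j :> R by rewrite exprn_gt0.
  (* The decay is run from s / 2^j, where M times the fourth power is still at least A; the gain
     (2^-j)^(2d + 1) is (2 4^d)^-j. *)
  have h1 : 0 < s / 2 ^+ j by rewrite divr_gt0.
  have h2 : s / 2 ^+ j <= s.
    by rewrite ler_pdivrMr // ler_peMr ?(ltW s0) ?exprn_ege1 ?ler1n.
  have h4 : (2 : R) ^+ 4 = 16 by ring.
  have h3 : 9 / 2 * k ^+ 2 <= M * (s / 2 ^+ j) ^+ 4.
    rewrite expr_div_n -(exprM 2) mulnC exprM h4.
    by rewrite [M * _]mulrA ler_pdivlMr ?exprn_gt0.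
  have := jacobi_energy_decay d_gt0 aE n0 h1 h2 h3 s4.
  rewrite expr_div_n mulrCA ler_pM2l ?exprn_gt0 // => /le_trans; apply.
  rewrite -(exprM 2) mulnC exprM exprS exprM.
  by have -> : (2 : R) ^+ 2 = 4 by ring.
have at1 : (jacobi_energy a n).[1] <= C / n%:R ^+ d.
  rewrite /jacobi_energy !(hornerD, hornerN, hornerM, hornerX, hornerC, horner_exp).
  rewrite subrr mulr0 !mul0r mulr0 addr0 ler_pdivlMr //.
  apply: (le_trans (jacobi_poly_at1_bound n)); rewrite /C; lra.
have at10 : (jacobi_energy a n).[10^-1] <= C / n%:R ^+ d.
  have -> : C / n%:R ^+ d = (C / B ^+ d) * (B / n%:R) ^+ d.
    by rewrite expr_div_n; field; rewrite !gt_eqF.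
  have le1 : 1 <= C / B ^+ d by rewrite ler_pdivlMr //; rewrite /C; lra.
  have Bn0 : 0 < (B / n%:R) by rewrite divr_gt0.
  (* If M <= 10 A then n <= B, and the bound 1 on the energy is already below C / n^d. *)
  have [hM|hM] := ltP (10 * A) M; last first.
    apply: (@le_trans _ _ 1).
      by apply: E1; lra.
    have nB : n%:R <= B.
      rewrite /B -(ger0_norm (ltW nR0)) -sqrtr_sqr ler_sqrt //.
      exact: le_trans nM hM.
    have Bn1 : 1 <= B / n%:R by rewrite ler_pdivlMr // mul1r.
    apply: (le_trans le1); rewrite ler_peMr ?exprn_ege1 //.
    exact: le_trans le1.
  pose s := Num.sqrt (Num.sqrt (10^-1 : R)).
  have s0 : 0 < s by rewrite !sqrtr_gt0.
  have s4 : s ^+ 4 = 10^-1.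
    by rewrite (exprM _ 2 2) !sqr_sqrtr ?sqrtr_ge0 // ltW.
  (* The starting point r s satisfies M (r s)^4 = A. As r <= 1, r^(2d + 1) <= (r^2)^d <= (B /
     n)^d. *)
  pose r := Num.sqrt (Num.sqrt (10 * A / M)).
  have q0 : 0 < 10 * A / M by rewrite divr_gt0 // mulr_gt0.
  have r0 : 0 < r by rewrite !sqrtr_gt0.
  have r2 : r ^+ 2 = Num.sqrt (10 * A / M) by rewrite sqr_sqrtr ?sqrtr_ge0.
  have r4 : r ^+ 4 = 10 * A / M by rewrite (exprM _ 2 2) r2 sqr_sqrtr ?ltW.
  have r1 : r <= 1.
    rewrite -(@ler_pXn2r _ 4) ?nnegrE ?(ltW r0) // expr1n r4 ler_pdivrMr // mul1r.
    exact: ltW.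
  have h1 : 0 < r * s by rewrite mulr_gt0.
  have h2 : r * s <= s by rewrite ler_piMl // ltW.
  have h3 : 9 / 2 * k ^+ 2 <= M * (r * s) ^+ 4.
    rewrite exprMn r4 s4.
    by have -> : M * (10 * A / M * 10^-1) = A by field; rewrite gt_eqF.
  have s4' : s ^+ 4 <= 10^-1 by rewrite s4.
  have := jacobi_energy_decay d_gt0 aE n0 h1 h2 h3 s4'; rewrite s4.
  rewrite exprMn mulrA [leRHS]mulrC ler_pM2l ?exprn_gt0 // => /le_trans; apply.
  rewrite exprS; apply: (@le_trans _ _ (3 * (B / n%:R) ^+ d)).
    rewrite ler_pM2l // exprM r2 -[leRHS]mul1r; apply: ler_pM => //; first exact: ltW.
    rewrite lerXn2r ?nnegrE ?sqrtr_ge0 ?(ltW Bn0) //.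
    rewrite ler_pdivlMr // -[X in _ * X](ger0_norm (ltW nR0)) -sqrtr_sqr.
    rewrite -sqrtrM ?(ltW q0) // ler_sqrt //.
    by rewrite mulrAC ler_pdivrMr // ler_pM2l.
  rewrite ler_pM2r ?exprn_gt0 // ler_pdivlMr // /C; lra.
(* On [1/10, 1] the energy decreases and then increases, so it never exceeds the larger of its two
   end values. *)
have mid : 10^-1 <= z -> (jacobi_poly a n).[z] ^+ 2 <= C / n%:R ^+ d.
  move=> z10; apply: (le_trans yE); have [zl|zg] := lerP ((2 * a + 2) * z) (2 * a + 1).
    by apply: le_trans at10; apply: (jacobi_energy_dec d_gt0 aE n0).
  by apply: le_trans at1; apply: (jacobi_energy_inc d_gt0 aE n0) => //; exact: ltW.
split=> //.
  have [z10|z10] := lerP (10^-1) z.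
    by apply: (le_trans (mid z10)); rewrite ler_pdivrMr // ler_peMr // ltW.
  apply: (le_trans yE); apply: (@le_trans _ _ 1); last by rewrite /C; lra.
  have : a * z <= a * 10^-1 by rewrite ler_pM2l // ltW.
  by move=> ?; apply: E1; lra.
move=> j z10 zA; apply: (le_trans yE).
have z4 : Num.sqrt (Num.sqrt z) ^+ 4 = z by rewrite (exprM _ 2 2) !sqr_sqrtr ?sqrtr_ge0.
have := decay (Num.sqrt (Num.sqrt z)) j; rewrite z4 sqrtr_ge0 => /(_ isT z10) h.
apply: (@le_trans _ _ (3 / (2 * 4 ^+ d) ^+ j)).
  by apply: h; rewrite (le_trans zA) // ler_wpM2r.
by rewrite ler_pM2r ?invr_gt0 ?exprn_gt0 ?mulr_gt0 ?exprn_gt0 // /C; lra.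
Qed.

End Bound.

(** * The Jacobi iteration as a polynomial in the walk operator *)

Definition lattice_box (d K : nat) : seq 'rV[int]_d :=
  [seq \row_i ((f i)%:Z - K%:Z) | f : {ffun 'I_d -> 'I_(2 * K).+1}].

Section LatticeBox.
Variable d : nat.
Implicit Types (K L : nat) (v w : 'rV[int]_d).

Lemma mem_lattice_box K v :
  (v \in lattice_box d K) = [forall i, (`|v 0%R i| <= K)%N].
Proof.
apply/mapP/forallP => [[f _ ->] i|vK].
  by rewrite mxE; move: (nat_of_ord (f i)) (ltn_ord (f i)) => m; lia.
have h i : (`|(v 0%R i + K%:Z)%R| < (2 * K).+1)%N by have := vK i; lia.
exists [ffun i => Ordinal (h i)]; first by rewrite mem_enum.
by apply/rowP => i; rewrite mxE ffunE /=; have := vK i; lia.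
Qed.

Lemma lattice_box_uniq K : uniq (lattice_box d K).
Proof.
rewrite map_inj_uniq ?enum_uniq // => f g /rowP fg.
by apply/ffunP => i; apply: val_inj; have := fg i; rewrite !mxE /=; lia.
Qed.

Lemma size_lattice_box K : size (lattice_box d K) = ((2 * K).+1 ^ d)%N.
Proof. by rewrite size_map -cardE card_ffun !card_ord. Qed.

Lemma lattice_boxD K L v w : v \in lattice_box d K -> w \in lattice_box d L ->
  v + w \in lattice_box d (K + L).
Proof.
rewrite !mem_lattice_box => /forallP vK /forallP wL; apply/forallP => i.
rewrite mxE; move: (vK i) (wL i); move: (v 0 i) (w 0 i) => p q; lia.
Qed.

Lemma lattice_boxN K v : (- v \in lattice_box d K) = (v \in lattice_box d K).
Proof.
by rewrite !mem_lattice_box; apply: eq_forallb => i; rewrite mxE abszN.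
Qed.

Lemma lattice_box0 K : 0 \in lattice_box d K.
Proof. by rewrite mem_lattice_box; apply/forallP => i; rewrite mxE. Qed.

Lemma lattice_box_le K L v : (K <= L)%N ->
  v \in lattice_box d K -> v \in lattice_box d L.
Proof.
rewrite !mem_lattice_box => KL /forallP vK; apply/forallP => i.
exact: leq_trans KL.
Qed.

Lemma fsum_box (V : nmodType) (F : 'rV[int]_d -> V) K :
  (forall v, v \notin lattice_box d K -> F v = 0) ->
  \sum_(v \in [set: 'rV[int]_d]) F v = \sum_(v <- lattice_box d K) F v.
Proof.
move=> F0; rewrite [RHS]fsbig_seq ?lattice_box_uniq //; apply/esym/fsbig_widen => //.
by move=> v [_ /= /negP]; exact: F0.
Qed.

Lemma finite_in_box (A : set 'rV[int]_d) : finite_set A ->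
  exists K, forall v, A v -> v \in lattice_box d K.
Proof.
move=> /finite_seqP[s ->]; elim: s => [|w s [K IH]]; first by exists 0%N.
have w_box : w \in lattice_box d (\max_i `|w 0%R i|)%N.
  by rewrite mem_lattice_box; apply/forallP => i; exact: leq_bigmax.
exists (maxn K (\max_i `|w 0%R i|)%N) => v; rewrite /= inE => /orP[/eqP ->|vs].
  exact: lattice_box_le (leq_maxr _ _) w_box.
exact: lattice_box_le (leq_maxl _ _) (IH _ vs).
Qed.

End LatticeBox.

(** * The iteration transposed to test functions *)

Section Pairing.
Variables (R : realType) (d : nat) (omega : 'rV[int]_d -> R) (K : nat).
Hypothesis omega_supp : forall v, v \notin lattice_box d K -> omega v = 0.
Implicit Types (v w : 'rV[int]_d) (x phi psi : 'rV[int]_d -> R) (p q : {poly R}).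

(** The adjoint of convolution by [omega] with respect to [pairing], hence the argument v + u where
    convolution has v - u. *)
Definition walk_avg phi v := \sum_(u <- lattice_box d K) omega u * phi (v + u).

Definition walk_diff phi v := (phi v - walk_avg phi v) / 2.

Definition pairing x phi := \sum_(v \in [set: 'rV[int]_d]) x v * phi v.

Lemma zconvE x v : zconv omega x v = \sum_(u <- lattice_box d K) omega u * x (v - u).
Proof.
rewrite /zconv (reindex_fsbigT (fun u : 'rV[int]_d => v - u)); last first.
  by exists (fun u => v - u) => u; rewrite opprB addrCA subrr addr0.
rewrite (@fsum_box _ _ _ K); last first.
  by move=> u uK; rewrite opprB addrCA subrr addr0 omega_supp // mul0r.
by apply: eq_bigr => u _; rewrite opprB addrCA subrr addr0.
Qed.

Lemma zconv_supp x L : (forall v, v \notin lattice_box d L -> x v = 0) ->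
  forall v, v \notin lattice_box d (L + K) -> zconv omega x v = 0.
Proof.
move=> xL v vLK; rewrite zconvE big1_seq // => u /andP[_ uK].
rewrite xL ?mulr0 //; apply: contra vLK => vuL.
by rewrite -(subrK u v) lattice_boxD.
Qed.

Lemma pairing_zconv x phi L : (forall v, v \notin lattice_box d L -> x v = 0) ->
  pairing (zconv omega x) phi = pairing x (walk_avg phi).
Proof.
move=> xL; rewrite /pairing (@fsum_box _ _ _ (L + K)); last first.
  by move=> v vLK; rewrite (zconv_supp xL) // mul0r.
rewrite (@fsum_box _ _ _ L); last by move=> v /xL ->; rewrite mul0r.
under eq_bigr do rewrite zconvE big_distrl.
under [RHS]eq_bigr do rewrite /walk_avg big_distrr.
rewrite exchange_big [RHS]exchange_big /=.
rewrite big_seq_cond [RHS]big_seq_cond; apply: eq_bigr => u /andP[uK _].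
rewrite -(@fsum_box _ _ (fun v => omega u * x (v - u) * phi v) (L + K)); last first.
  move=> v vLK; rewrite xL ?mulr0 ?mul0r //; apply: contra vLK => vuL.
  by rewrite -(subrK u v) lattice_boxD.
rewrite -(@fsum_box _ _ (fun v => x v * (omega u * phi (v + u))) L); last first.
  by move=> v /xL ->; rewrite mul0r.
rewrite (reindex_fsbigT (fun v : 'rV[int]_d => v + u)); last first.
  by exists (fun v => v - u) => v; rewrite ?addrK ?subrK.
by apply: eq_fsbigr => v _; rewrite addrK mulrCA mulrA.
Qed.

Lemma jacobi0 : jacobi omega 0 = Defs.indic R 0. Proof. by []. Qed.

Lemma jacobi1 : jacobi omega 1 = fun v =>
  jac_a R d 0 * zconv omega (Defs.indic R 0) v + jac_b R d 0 * Defs.indic R 0 v.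
Proof. by []. Qed.

Lemma jacobiSS n : jacobi omega n.+2 = fun v =>
  jac_a R d n.+1 * zconv omega (jacobi omega n.+1) v
  + jac_b R d n.+1 * jacobi omega n.+1 v - jac_c R d n.+1 * jacobi omega n v.
Proof. by []. Qed.

Lemma nat_ind2 (P : nat -> Prop) : P 0%N -> P 1%N ->
  (forall n, P n -> P n.+1 -> P n.+2) -> forall n, P n.
Proof.
move=> P0 P1 PS n; suff : P n /\ P n.+1 by case.
by elim: n => [//|n [Pn PSn]]; split=> //; exact: PS.
Qed.

Lemma indic_supp L v : v \notin lattice_box d L -> Defs.indic R 0 v = 0.
Proof.
by rewrite /Defs.indic; case: eqP => // -> /negP; rewrite lattice_box0.
Qed.

Lemma jacobi_supp n v : v \notin lattice_box d (n * K) -> jacobi omega n v = 0.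
Proof.
elim/nat_ind2: n v => [|| n IH0 IH1] v vK.
- exact: indic_supp vK.
- rewrite jacobi1 (zconv_supp (@indic_supp 0%N)) 1?(indic_supp vK) ?mulr0 ?addr0 //.
  by move: vK; rewrite mul1n.
have sub L : (L <= n.+2 * K)%N -> v \notin lattice_box d L.
  by move=> LK; apply: contra vK; exact: lattice_box_le.
rewrite jacobiSS (zconv_supp IH1) ?IH0 ?IH1 ?mulr0 ?addr0 ?subr0 //; apply: sub; lia.
Qed.

(** The functional sending phi to (p(D) phi)(0), where D is [walk_diff]. *)
Definition walk_horner (p : {poly R}) phi :=
  \sum_(j < size p) p`_j * iter j walk_diff phi 0.

Lemma walk_horner_widen m p phi : (size p <= m)%N ->
  walk_horner p phi = \sum_(j < m) p`_j * iter j walk_diff phi 0.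
Proof.
move=> pm; rewrite /walk_horner (big_ord_widen m (fun j => p`_j * iter j walk_diff phi 0)) //.
rewrite big_mkcond; apply: eq_bigr => j _; case: ltnP => // pj.
by rewrite nth_default ?mul0r.
Qed.

Lemma walk_hornerD p q phi :
  walk_horner (p + q) phi = walk_horner p phi + walk_horner q phi.
Proof.
have s0 := size_polyD p q; rewrite (walk_horner_widen _ s0).
rewrite (walk_horner_widen _ (leq_maxl (size p) (size q))).
rewrite (walk_horner_widen _ (leq_maxr (size p) (size q))) -big_split.
by apply: eq_bigr => j _; rewrite coefD mulrDl.
Qed.

Lemma walk_hornerZ c p phi : walk_horner (c%:P * p) phi = c * walk_horner p phi.
Proof.
rewrite mul_polyC (walk_horner_widen _ (size_scale_leq c p)) [in RHS]/walk_horner big_distrr.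
by apply: eq_bigr => j _; rewrite /= coefZ mulrA.
Qed.

Lemma walk_hornerMX p phi : walk_horner (p * 'X) phi = walk_horner p (walk_diff phi).
Proof.
have s0 : (size (p * 'X)%R <= (size p).+1)%N.
  by have [->|p0] := eqVneq p 0; rewrite ?mul0r ?size_poly0 // size_mulX.
rewrite (walk_horner_widen _ s0) big_ord_recl coefMX mul0r add0r.
by apply: eq_bigr => j _; rewrite coefMX lift0 iterSr.
Qed.

Lemma pairing_indic phi : pairing (Defs.indic R 0) phi = phi 0.
Proof.
rewrite /pairing -(fsbig_widen [set 0] setT) //; last first.
  by move=> v [_ /= /eqP v0]; rewrite /Defs.indic (negbTE v0) mul0r.
by rewrite fsbig_set1 /Defs.indic eqxx mul1r.
Qed.

Lemma pairing_lin x y (b c : R) phi L :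
  (forall v, v \notin lattice_box d L -> x v = 0) ->
  (forall v, v \notin lattice_box d L -> y v = 0) ->
  pairing (fun v => b * x v + c * y v) phi = b * pairing x phi + c * pairing y phi.
Proof.
move=> xL yL; rewrite /pairing !(@fsum_box _ _ _ L).
- rewrite !big_distrr -big_split; apply: eq_bigr => v _ /=; ring.
- by move=> v /yL ->; rewrite mul0r.
- by move=> v /xL ->; rewrite mul0r.
- by move=> v vL; rewrite xL // yL //; ring.
Qed.

(** The averaging operator is 1 - 2D, so applying it to the test function multiplies the polynomial
    by 1 - 2X. *)
Lemma walk_horner_avg p phi :
  walk_horner p (walk_avg phi) = walk_horner ((1 - 2%:P * 'X) * p) phi.
Proof.
have -> : (1 - 2%:P * 'X) * p = p + (-2)%:P * (p * 'X) by rewrite polyCN; ring.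
rewrite walk_hornerD walk_hornerZ walk_hornerMX.
have itr j phi1 phi2 b : iter j walk_diff (fun v => phi1 v + b * phi2 v) =
    fun v => iter j walk_diff phi1 v + b * iter j walk_diff phi2 v.
  elim: j => //= j ->; apply/funext => v; rewrite /walk_diff /walk_avg.
  under eq_bigr do rewrite mulrDr mulrCA.
  by rewrite big_split /= -big_distrr /=; field.
have -> : walk_avg phi = fun v => phi v + (-2) * walk_diff phi v.
  by apply/funext => v; rewrite /walk_diff; field.
rewrite /walk_horner big_distrr -big_split; apply: eq_bigr => j _.
by rewrite itr /= mulrDr mulrCA.
Qed.

(** [pairing_zconv] moves each convolution onto phi, after which the recurrence of the iterates is
    that of the polynomials. The induction generalizes phi, since the test function changes at every
    step. *)
Lemma pairing_jacobi (a : R) n phi : (0 < d)%N -> d%:R = 2 * a ->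
  pairing (jacobi omega n) phi = walk_horner (jacobi_poly a n) phi.
Proof.
move=> d0 aE.
have h0 psi : pairing (Defs.indic R 0) psi = walk_horner 1 psi.
  by rewrite pairing_indic /walk_horner size_poly1 big_ord1 coef1 mul1r.
elim/nat_ind2: n phi => [|| n IH0 IH1] phi.
- by rewrite jacobi0 jacobi_poly0 // h0.
- rewrite jacobi1 (@pairing_lin _ _ _ _ _ K); last 2 first.
  + by move=> v vK; rewrite (zconv_supp (@indic_supp 0%N)).
  + by move=> v; exact: indic_supp.
  rewrite (pairing_zconv _ (@indic_supp 0%N)) !h0 walk_horner_avg.
  by rewrite (jacobi_poly1 d0 aE) -(mulr1 (jac_b R d 0)%:P) walk_hornerD !walk_hornerZ mulr1.
have supp m : (m <= n.+1)%N ->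
    forall v, v \notin lattice_box d (n.+2 * K) -> jacobi omega m v = 0.
  move=> mn v vK; apply: jacobi_supp; apply: contra vK; apply: lattice_box_le; nia.
rewrite jacobiSS.
transitivity (pairing (fun v => 1 * (jac_a R d n.+1 * zconv omega (jacobi omega n.+1) v
  + jac_b R d n.+1 * jacobi omega n.+1 v) + (- jac_c R d n.+1) * jacobi omega n v) phi).
  by congr pairing; apply/funext => v; ring.
have s1 v : v \notin lattice_box d (n.+2 * K) -> zconv omega (jacobi omega n.+1) v = 0.
  by move=> vK; apply: (zconv_supp (@jacobi_supp n.+1)); rewrite addnC -mulSn.
rewrite (@pairing_lin _ _ _ _ _ (n.+2 * K)); first last.
- exact: supp.
- by move=> v vK; rewrite s1 // supp // !mulr0 addr0.
rewrite (@pairing_lin _ _ _ _ _ (n.+2 * K)) //; last exact: supp.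
rewrite (pairing_zconv _ (@jacobi_supp n.+1)) !IH1 IH0 walk_horner_avg.
rewrite (jacobi_polySS d0 aE) mul1r -!walk_hornerZ -!walk_hornerD; congr walk_horner.
by rewrite polyCN; ring.
Qed.

End Pairing.

(** * Fourier analysis on discrete tori *)

Section CyclicTrigonometry.
Variables (R : realType).

Lemma x_cos_le_sin (x : R) : 0 <= x <= pi / 2 -> x * cos x <= sin x.
Proof.
move=> /andP[x0 x1]; pose f (y : R) := sin y - y * cos y.
have df (y : R) : is_derive y 1 f (y * sin y).
  have -> : y * sin y = cos y - (y *: - sin y + cos y *: 1).
    by rewrite /GRing.scale /=; ring.
  exact: is_deriveB.
have [|c] := @MVT_segment R f _ 0 x x0 (fun y _ => df y).
  apply: derivable_within_continuous => y _; exact: ex_derive.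
rewrite in_itv /= => /andP[c0 cx] fE.
have : 0 <= f x - f 0.
  rewrite fE mulr_ge0 ?subr_ge0 // mulr_ge0 // sin_ge0_pi // c0 /=.
  have := pi_ge0 R; lra.
by rewrite /f sin0 mul0r !subr0 subr_ge0.
Qed.

(** Up to pi/4, cos x >= 1/2 and sin x >= x cos x; beyond, sin x >= 1/2 while x < 2. Both lower
    bounds come from the double angle. *)
Lemma quarter_le_sin (x : R) : 0 <= x <= pi / 2 -> x / 4 <= sin x.
Proof.
move=> xpi; have /andP[x0 x1] := xpi; have p2 := pihalf_lt2 R.
have c2 := cos_mulr2n x; have cs := cos2Dsin2 x.
have s0 : 0 <= sin x by apply: sin_ge0_pi; have := pi_ge0 R; lra.
have c0 : 0 <= cos x by apply: cos_ge0_pihalf; have := pi_ge0 R; lra.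
have [h|h] := lerP (x *+ 2) (pi / 2).
  have : 0 <= cos (x *+ 2) by apply: cos_ge0_pihalf; have := pi_ge0 R; lra.
  have := x_cos_le_sin xpi; rewrite c2 => h1 h2.
  have : 1 / 2 <= cos x by nra.
  nra.
have : 0 <= cos (pi - x *+ 2) by apply: cos_ge0_pihalf; have := pi_ge0 R; lra.
rewrite cosB cospi sinpi mul0r addr0 c2 => h2.
have : 1 / 2 <= sin x by nra.
lra.
Qed.

Variable q : nat.
Let N := q.+2.
Definition cosZ (k : 'Z_q.+2) : R := cos (2 * pi * (k : nat)%:R / q.+2%:R).
Definition sinZ (k : 'Z_q.+2) : R := sin (2 * pi * (k : nat)%:R / q.+2%:R).

Let angle_mod (m : nat) : 2 * pi * m%:R / N%:R =
  2 * pi * (m %% N)%:R / N%:R + (pi *+ 2) *+ (m %/ N) :> R.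
Proof.
rewrite {1}(divn_eq m N) natrD natrM -(mulr_natr _ (_ %/ _)).
have : N%:R != 0 :> R by rewrite pnatr_eq0.
move: (N%:R : R) => n n0; field.
exact: n0.
Qed.

Lemma cosZD (x y : 'Z_q.+2) : cosZ (x + y) = cosZ x * cosZ y - sinZ x * sinZ y.
Proof.
rewrite /cosZ /sinZ -cosD -mulrDl -mulrDr -natrD [in RHS]angle_mod.
by rewrite (periodicn (@cosD2pi R) _).
Qed.

Lemma sinZD (x y : 'Z_q.+2) : sinZ (x + y) = sinZ x * cosZ y + cosZ x * sinZ y.
Proof.
rewrite /cosZ /sinZ -sinD -mulrDl -mulrDr -natrD [in RHS]angle_mod.
by rewrite (periodicn (@sinD2pi R) _).
Qed.

Lemma cosZ0 : cosZ 0 = 1. Proof. by rewrite /cosZ mulr0 mul0r cos0. Qed.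

Lemma sinZ0 : sinZ 0 = 0. Proof. by rewrite /sinZ mulr0 mul0r sin0. Qed.

Lemma cosZsinZ1 x : cosZ x ^+ 2 + sinZ x ^+ 2 = 1.
Proof. exact: cos2Dsin2. Qed.

(** The addition formulas at x - x = 0 and the relation cos^2 + sin^2 = 1 determine both values at
    -x, with no recourse to the representative of -x. *)
Lemma cosZN x : cosZ (- x) = cosZ x.
Proof.
have h1 : cosZ (x - x) = 1 by rewrite subrr cosZ0.
have h2 : sinZ (x - x) = 0 by rewrite subrr sinZ0.
rewrite cosZD in h1; rewrite sinZD in h2; have := cosZsinZ1 x.
move: (cosZ x) (sinZ x) (cosZ (- x)) (sinZ (- x)) h1 h2 => c s c' s' h1 h2 cs.
rewrite -[c']mul1r -cs -[RHS]mulr1 -h1 -[RHS]addr0 -(mulr0 s) -h2; ring.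
Qed.

Lemma sinZN x : sinZ (- x) = - sinZ x.
Proof.
have h1 : cosZ (x - x) = 1 by rewrite subrr cosZ0.
have h2 : sinZ (x - x) = 0 by rewrite subrr sinZ0.
rewrite cosZD in h1; rewrite sinZD in h2; have := cosZsinZ1 x.
move: (cosZ x) (sinZ x) (cosZ (- x)) (sinZ (- x)) h1 h2 => c s c' s' h1 h2 cs.
rewrite -[s']mul1r -cs -[RHS]mulr1 -h1 -[RHS]addr0 -(mulr0 c) -h2; ring.
Qed.

(** [minn k (N - k)] is the distance from k to 0 on the cycle. With t this distance over N, 1 -
    cos(2 pi t) = 2 sin(pi t)^2 >= (pi t)^2 / 8, and pi >= 2. *)
Lemma cosZ_lower (k : 'Z_q.+2) :
  ((minn k (N - k))%:R / N%:R) ^+ 2 / 2 <= 1 - cosZ k.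
Proof.
have N0 : 0 < N%:R :> R by rewrite ltr0n.
have main (m : nat) : (2 * m <= N)%N ->
    (m%:R / N%:R) ^+ 2 / 2 <= 1 - cos (2 * pi * m%:R / N%:R) :> R.
  move=> mN; pose t : R := m%:R / N%:R.
  have t0 : 0 <= t by rewrite divr_ge0.
  have t1 : t <= 1 / 2.
    rewrite ler_pdivrMr // mul1r mulrC ler_pdivlMr // mulrC -natrM ler_nat //.
  have -> : 2 * pi * m%:R / N%:R = (pi * t) *+ 2 :> R.
    by rewrite /t -mulr_natr; ring.
  have p2 := pi_ge2 R.
  have h : 0 <= pi * t <= pi / 2 by apply/andP; split; nra.
  have := quarter_le_sin h; rewrite cos_mulr2n -/t; have := cos2Dsin2 (pi * t).
  set c := cos _; set s := sin _ => cs sx.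
  have : 0 <= pi * t / 4 by have /andP[] := h; lra.
  have : 2 * t <= pi * t by nra.
  nra.
have [kN|kN] := leqP (2 * k) N.
  have -> : minn k (N - k) = k by apply/minn_idPl; lia.
  exact: main.
have -> : minn k (N - k) = (N - k)%N by apply/minn_idPr; lia.
have kN' : (k <= N)%N by rewrite ltnW // ltn_ord.
apply: le_trans (main _ _) _; first lia.
rewrite /cosZ natrB // [leLHS](_ : _ = 1 - cos (2 * pi * k%:R / N%:R)) //.
congr (_ - _); rewrite -[RHS]cosN -[RHS](@cosD2pi R); congr cos.
by move: N0; rewrite -/N; move: (N%:R : R) => n n0; field; rewrite gt_eqF.
Qed.

Lemma cosZ_eq1 k : cosZ k = 1 -> k = 0.
Proof.
move=> k1; have := cosZ_lower k; rewrite k1 subrr.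
have N0 : 0 < N%:R :> R by rewrite ltr0n.
rewrite pmulr_lle0 ?invr_gt0 // => h.
have /eqP := le_anti (introT andP (conj h (sqr_ge0 _))).
rewrite sqrf_eq0 mulf_eq0 invr_eq0 pnatr_eq0 pnatr_eq0 orbF => /eqP m0.
have kN : (k < N)%N := ltn_ord k; apply: val_inj => /=; move: m0 kN; rewrite /N; move: (nat_of_ord k) => j; lia.
Qed.

(** By [cosZ_lower] the residues counted lie within p of 0 on the cycle: at most p + 1 on one side,
    0 included, and p on the other. *)
Lemma card_cosZ_ge (s : R) : 0 <= s ->
  #|[set k : 'Z_q.+2 | (1 - cosZ k <= s)%R]%SET|%:R <= 2 * (N%:R * Num.sqrt (2 * s)) + 1.
Proof.
move=> s0; set m := N%:R * Num.sqrt (2 * s).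
have N0 : 0 < N%:R :> R by rewrite ltr0n.
have m0 : 0 <= m by rewrite mulr_ge0 ?sqrtr_ge0.
pose p := Num.truncn m.
have sub : [set k : 'Z_q.+2 | (1 - cosZ k <= s)%R]%SET \subset
    ([set (inZp j : 'Z_q.+2) | j : 'I_p.+1] :|: [set (inZp (N - j.+1) : 'Z_q.+2) | j : 'I_p])%SET.
  apply/fintype.subsetP => k; rewrite finset.inE => ks.
  have := le_trans (cosZ_lower k) ks; rewrite ler_pdivrMr // => h.
  have : (minn k (N - k))%:R <= m.
    rewrite /m mulrC -ler_pdivrMr // -(ger0_norm (divr_ge0 (ler0n _ _) (ltW N0))).
    rewrite -sqrtr_sqr ler_sqrt ?mulr_ge0 // [leRHS]mulrC //.
  rewrite -truncn_ge_nat // geq_min -/p => /orP[kp|kp]; rewrite finset.inE.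
    apply/orP; left; apply/imsetP; exists (inord k); rewrite ?inE // inordK //.
    by rewrite valZpK.
  apply/orP; right.
  have kN : (k < N)%N := ltn_ord k; have jp : ((N - k).-1 < p)%N by move: kN; rewrite /N; lia.
  apply/imsetP; exists (Ordinal jp); rewrite ?inE //=.
  have -> : (N - (N - k).-1.+1 = k)%N by move: kN; rewrite /N; lia.
  by rewrite valZpK.
have : (#|[set k : 'Z_q.+2 | (1 - cosZ k <= s)%R]%SET| <= p.+1 + p)%N.
  apply: leq_trans (subset_leq_card sub) _; apply: leq_trans (leq_card_setU _ _) _.
  apply: leq_add; rewrite (leq_trans (leq_imset_card _ _)) ?card_ord //.
rewrite -(ler_nat R) => /le_trans; apply; rewrite natrD -natr1.
have : p%:R <= m by rewrite truncn_le.
lra.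
Qed.

End CyclicTrigonometry.

(** * Waves on the discrete torus and Parseval's identity *)

Section Torus.
Variables (R : realType) (d q : nat).
Let T := 'rV['Z_q.+2]_d.

Definition dotZ (xi : T) (v : 'rV[int]_d) : 'Z_q.+2 := \sum_i xi 0 i * (v 0 i)%:~R.

Definition wave (xi : T) (v : 'rV[int]_d) : R := cosZ R (dotZ xi v).

Lemma dotZD xi v w : dotZ xi (v + w) = dotZ xi v + dotZ xi w.
Proof.
by rewrite -big_split; apply: eq_bigr => i _; rewrite mxE rmorphD mulrDr.
Qed.

Lemma dotZN xi v : dotZ xi (- v) = - dotZ xi v.
Proof.
by rewrite /dotZ -sumrN; apply: eq_bigr => i _; rewrite mxE rmorphN mulrN.
Qed.

Lemma dotZDl xi eta v : dotZ (xi + eta) v = dotZ xi v + dotZ eta v.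
Proof. by rewrite -big_split; apply: eq_bigr => i _; rewrite mxE mulrDl. Qed.

Lemma dotZNl xi v : dotZ (- xi) v = - dotZ xi v.
Proof. by rewrite /dotZ -sumrN; apply: eq_bigr => i _; rewrite mxE mulNr. Qed.

Lemma dotZ_delta i v : dotZ (delta_mx 0 i) v = (v 0 i)%:~R.
Proof.
rewrite /dotZ (bigD1 i) //= mxE !eqxx mul1r big1 ?addr0 // => j ji.
by rewrite mxE (negbTE ji) andbF mul0r.
Qed.

Lemma wave0 xi : wave xi 0 = 1.
Proof.
rewrite /wave /dotZ big1 ?cosZ0 // => i _.
by rewrite mxE mulr0.
Qed.

Lemma wave_mul xi v w : wave xi v * wave xi w = (wave xi (v + w) + wave xi (v - w)) / 2.
Proof. by rewrite /wave !dotZD !dotZN !cosZD sinZN cosZN; field. Qed.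

Lemma wave_bound xi v : `|wave xi v| <= 1. Proof. exact: cos_max. Qed.

(** Translating the frequency by the i-th basis vector multiplies the sum by cosZ r, the sine part
    vanishing by parity; and cosZ r = 1 only for r = 0. *)
Lemma sum_wave0 (v : 'rV[int]_d) i : (v 0 i)%:~R != 0 :> 'Z_q.+2 ->
  \sum_(xi : T) wave xi v = 0.
Proof.
move=> vi; pose r : 'Z_q.+2 := (v 0 i)%:~R; set A := \sum_xi _.
have B0 : \sum_(xi : T) sinZ R (dotZ xi v) = 0.
  set B := \sum_xi _; have : B = - B.
    rewrite {1}/B (reindex_inj (inv_inj (@opprK T))) -sumrN.
    by apply: eq_bigr => xi _; rewrite dotZNl sinZN.
  lra.
have : A = A * cosZ R r.
  rewrite {1}/A (reindex_inj (addIr (delta_mx 0 i : T))) /=.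
  transitivity (A * cosZ R r
      - (\sum_(xi : T) sinZ R (dotZ xi v)) * sinZ R r); last first.
    by rewrite B0 mul0r subr0.
  rewrite !big_distrl -sumrB; apply: eq_bigr => xi _.
  by rewrite /wave dotZDl dotZ_delta cosZD.
move/eqP; rewrite -subr_eq0 -{1}[A]mulr1 -mulrBr mulf_eq0 => /orP[/eqP //|].
by rewrite subr_eq0 eq_sym => /eqP /cosZ_eq1 v0; rewrite -/r v0 eqxx in vi.
Qed.

Lemma intZ_eq0 (m : int) : (`|m| < q.+2)%N -> m%:~R = 0 :> 'Z_q.+2 -> m = 0.
Proof.
have nat0 n : (n < q.+2)%N -> n%:R = 0 :> 'Z_q.+2 -> n = 0%N.
  move=> nq; rewrite Zp_nat => /(congr1 val) /=.
  by rewrite modn_small.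
case: m => n /=; first by move=> nq; rewrite -pmulrn => /nat0 ->.
move=> nq; rewrite NegzE rmorphN /= -pmulrn => /eqP.
by rewrite oppr_eq0 => /eqP /nat0 => /(_ nq).
Qed.

(** The bound on L excludes aliasing: a nonzero vector of the box stays nonzero modulo the order of
    the torus. *)
Lemma sum_wave (v : 'rV[int]_d) L : (L < q.+2)%N -> v \in lattice_box d L ->
  \sum_(xi : T) wave xi v = if v == 0 then #|{: T}|%:R else 0.
Proof.
move=> Lq vL; case: eqP => [->|/eqP v0].
  under eq_bigr do rewrite wave0.
  by rewrite sumr_const.
have [i vi] : exists i, v 0 i != 0.
  apply/existsP; rewrite -negb_forall; apply: contra v0 => /forallP h.
  by apply/eqP/rowP => i; rewrite mxE; apply/eqP.
apply: (@sum_wave0 _ i); apply: contra vi => /eqP /intZ_eq0 -> //.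
by move: vL; rewrite mem_lattice_box => /forallP /(_ i) /leq_ltn_trans ->.
Qed.

(** A product of two cosines is half the sum of the waves at v + w and v - w. The pairs w = v and w
    = -v thus contribute one half each, and evenness of x makes both contributions x(v)^2. The
    vectors v + w and v - w live in the box of size L + L. *)
Lemma wave_parseval (x : 'rV[int]_d -> R) L : (L + L < q.+2)%N ->
  (forall v, x (- v) = x v) ->
  \sum_(xi : T) (\sum_(v <- lattice_box d L) x v * wave xi v) ^+ 2 =
  #|{: T}|%:R * \sum_(v <- lattice_box d L) x v ^+ 2.
Proof.
move=> Lq x_even.
under eq_bigr do rewrite expr2 big_distrl /=.
rewrite exchange_big big_distrr /= big_seq_cond [RHS]big_seq_cond.
apply: eq_bigr => v /andP[vL _].
under eq_bigr do rewrite big_distrr /=.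
rewrite exchange_big /=.
transitivity (\sum_(w <- lattice_box d L)
    x v * x w * (#|{: T}|%:R / 2) * ((w == - v)%:R + (w == v)%:R)).
  rewrite big_seq_cond [RHS]big_seq_cond; apply: eq_bigr => w /andP[wL _].
  transitivity (x v * x w * (\sum_(xi : T) (wave xi (v + w) + wave xi (v - w)) / 2)).
    by rewrite big_distrr; apply: eq_bigr => xi _; rewrite /= -wave_mul; ring.
  rewrite -mulr_suml big_split /= !(@sum_wave _ (L + L)) ?lattice_boxD ?lattice_boxN //.
  rewrite (addrC v w) addr_eq0 subr_eq0 (eq_sym v w).
  by case: (w == v); case: (w == - v); rewrite /=; field.
have delta u : u \in lattice_box d L -> x u = x v ->
    \sum_(w <- lattice_box d L) x v * x w * (#|{: T}|%:R / 2) * (w == u)%:R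
    = #|{: T}|%:R / 2 * x v ^+ 2.
  move=> uL xu; rewrite (bigD1_seq u) ?lattice_box_uniq //= eqxx xu.
  rewrite big1 ?addr0; last by move=> w /negbTE ->; rewrite mulr0.
  by rewrite mulr1; ring.
under eq_bigr do rewrite mulrDr.
rewrite big_split /= !delta ?lattice_boxN //; by field.
Qed.

End Torus.

(** * Waves as eigenfunctions of the walk *)

Section WalkSpectrum.
Variables (R : realType) (d : nat) (omega : 'rV[int]_d -> R) (K : nat).
Hypothesis omega_supp : forall v, v \notin lattice_box d K -> omega v = 0.
Hypothesis omega_ge0 : forall v, 0 <= omega v.
Hypothesis omega_sum : \sum_(v <- lattice_box d K) omega v = 1.
Hypothesis omega_sym : forall v, omega (- v) = omega v.

Lemma sum_lattice_boxN (F : 'rV[int]_d -> R) L :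
  \sum_(v <- lattice_box d L) F (- v) = \sum_(v <- lattice_box d L) F v.
Proof.
rewrite -(big_map -%R predT F); apply: perm_big; apply: uniq_perm.
- by rewrite map_inj_uniq ?lattice_box_uniq //; exact: oppr_inj.
- exact: lattice_box_uniq.
- move=> v; rewrite -[v]opprK mem_map; last exact: oppr_inj.
  by rewrite !lattice_boxN.
Qed.

Lemma jacobi_even n v : jacobi omega n (- v) = jacobi omega n v.
Proof.
have even_conv x : (forall v, x (- v) = x v) ->
    forall v, zconv omega x (- v) = zconv omega x v.
  move=> x_even w; rewrite !(zconvE omega_supp) -sum_lattice_boxN.
  by apply: eq_bigr => u _; rewrite omega_sym opprK -x_even opprD !opprK.
have i0 w : Defs.indic R 0 (- w) = Defs.indic R 0 w by rewrite /Defs.indic oppr_eq0.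
elim/nat_ind2: n v => [|| n IH0 IH1] v.
- exact: i0.
- by rewrite !jacobi1 even_conv // i0.
- by rewrite !jacobiSS even_conv // IH0 IH1.
Qed.

Section Frequency.
Variables (q : nat) (xi : 'rV['Z_q.+2]_d).

Definition walk_freq : R := (1 - \sum_(u <- lattice_box d K) omega u * wave R xi u) / 2.

(** By symmetry of [omega], averaging over v + u or over v - u gives the same value, and their
    half-sum factors by [wave_mul]. *)
Lemma walk_diff_wave : walk_diff omega K (wave R xi) = fun v => walk_freq * wave R xi v.
Proof.
apply/funext => v; rewrite /walk_diff /walk_freq /walk_avg.
have -> : \sum_(u <- lattice_box d K) omega u * wave R xi (v + u) =
    (\sum_(u <- lattice_box d K) omega u * wave R xi u) * wave R xi v.
  have h : \sum_(u <- lattice_box d K) omega u * wave R xi (v + u) =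
     \sum_(u <- lattice_box d K) omega u * wave R xi (v - u).
    by rewrite -sum_lattice_boxN; apply: eq_bigr => u _; rewrite omega_sym.
  transitivity (\sum_(u <- lattice_box d K)
      (omega u * wave R xi (v + u) + omega u * wave R xi (v - u)) / 2).
    rewrite -mulr_suml big_split /= -h; by field.
  rewrite big_distrl; apply: eq_bigr => u _ /=.
  by rewrite -mulrA (mulrC (wave R xi u)) wave_mul; field.
by field.
Qed.

Lemma pairing_jacobi_wave (a : R) n : (0 < d)%N -> d%:R = 2 * a ->
  pairing (jacobi omega n) (wave R xi) = (jacobi_poly a n).[walk_freq].
Proof.
move=> d0 aE; rewrite (pairing_jacobi omega_supp _ _ d0 aE) horner_coef.
apply: eq_bigr => j _; congr (_ * _).
suff -> : iter j (walk_diff omega K) (wave R xi) = fun v => walk_freq ^+ j * wave R xi v.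
  by rewrite wave0 mulr1.
elim: (nat_of_ord j) => [|i IH] /=.
  by apply/funext => v; rewrite mul1r.
rewrite IH; apply/funext => v; rewrite exprS mulrAC -/(walk_freq).
transitivity (walk_freq ^+ i * walk_diff omega K (wave R xi) v).
  rewrite /walk_diff /walk_avg mulrA mulrBr big_distrr /=; congr (_ / _).
  by congr (_ - _); apply: eq_bigr => u _; rewrite mulrCA.
by rewrite walk_diff_wave; ring.
Qed.

Lemma walk_freqE :
  walk_freq = (\sum_(u <- lattice_box d K) omega u * (1 - wave R xi u)) / 2.
Proof.
rewrite /walk_freq -{1}omega_sum -sumrB.
by under [in RHS]eq_bigr do rewrite mulrBr mulr1.
Qed.

Lemma walk_freq_itv : 0 <= walk_freq <= 1.
Proof.
rewrite walk_freqE; apply/andP; split.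
  rewrite mulr_ge0 // sumr_ge0 // => u _; rewrite mulr_ge0 // subr_ge0.
  by have := wave_bound R xi u; rewrite ler_norml => /andP[].
rewrite ler_pdivrMr // mul1r.
apply: (@le_trans _ _ (\sum_(u <- lattice_box d K) omega u * 2)).
  apply: ler_sum => u _; rewrite ler_wpM2l // lerBlDr.
  by have := wave_bound R xi u; rewrite ler_norml => /andP[]; lra.
by rewrite -mulr_suml omega_sum mul1r.
Qed.

(** One term of a sum of nonnegative terms; used for d independent vectors u of the support, it
    localizes the frequencies with small eigenvalue. *)
Lemma walk_freq_lower u : omega u * (1 - wave R xi u) <= 2 * walk_freq.
Proof.
have ge0 w : 0 <= omega w * (1 - wave R xi w).
  rewrite mulr_ge0 // subr_ge0.
  by have := wave_bound R xi w; rewrite ler_norml => /andP[].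
rewrite walk_freqE [2 * _]mulrC divfK ?pnatr_eq0 //.
have [uK|uK] := boolP (u \in lattice_box d K).
  by rewrite (bigD1_seq u) ?lattice_box_uniq //= lerDl sumr_ge0.
by rewrite omega_supp // mul0r sumr_ge0.
Qed.

End Frequency.
End WalkSpectrum.

(** * Uniform bound on the total variation *)

(** Cauchy-Schwarz, read off the nonnegativity of the sum of the squares (m |x_i| - S)^2. *)
Lemma sqr_sum_norm_le (R : realType) (I : Type) (s : seq I) (x : I -> R) :
  (\sum_(i <- s) `|x i|) ^+ 2 <= (size s)%:R * \sum_(i <- s) x i ^+ 2.
Proof.
set S := \sum_(i <- s) `|x i|; case: s @S => [|i0 s'] S.
  by rewrite /S !big_nil expr0n mulr0.
set s := i0 :: s' in S *; have m0 : 0 < (size s)%:R :> R by rewrite ltr0n.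
set m : R := (size s)%:R in m0 *.
have : 0 <= \sum_(i <- s) (m * `|x i| - S) ^+ 2 by apply: sumr_ge0 => i _; exact: sqr_ge0.
have -> : \sum_(i <- s) (m * `|x i| - S) ^+ 2 = m * (m * (\sum_(i <- s) x i ^+ 2) - S ^+ 2).
  transitivity (\sum_(i <- s) (m ^+ 2 * x i ^+ 2 - 2 * m * S * `|x i| + S ^+ 2)).
    apply: eq_bigr => i _; rewrite -(real_normK (num_real (x i))); ring.
  rewrite big_split sumrB -!mulr_sumr /= -/S big_const_seq count_predT iter_addr_0.
  by rewrite -mulr_natr -/m; ring.
by rewrite pmulr_rge0 // subr_ge0.
Qed.

Section TotalVariation.
Variables (R : realType) (d : nat) (omega : 'rV[int]_d -> R) (K : nat).
Hypothesis d_gt0 : (0 < d)%N.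
Hypothesis omega_supp : forall v, v \notin lattice_box d K -> omega v = 0.
Hypothesis omega_ge0 : forall v, 0 <= omega v.
Hypothesis omega_sum : \sum_(v <- lattice_box d K) omega v = 1.
Hypothesis omega_sym : forall v, omega (- v) = omega v.
Variables (V : 'M[int]_d) (c : R).
Hypothesis V_det : \det V != 0.
Hypothesis c_gt0 : 0 < c.
Hypothesis V_omega : forall i, c <= omega (row i V).

Section Level.
Variable q : nat.
Hypothesis V_unit : (\det V)%:~R \is a (@GRing.unit 'Z_q.+2).

(** V is invertible modulo the order of the torus because its determinant is a unit there. *)
Lemma dotZ_rows_inj (xi eta : 'rV['Z_q.+2]_d) :
  (forall i, dotZ xi (row i V) = dotZ eta (row i V)) -> xi = eta.
Proof.
move=> h; pose B := (map_mx (intr : int -> 'Z_q.+2) V)^T.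
have B_unit : B \in unitmx by rewrite unitmxE det_tr det_map_mx.
suff : xi *m B = eta *m B by move=> /(congr1 (mulmx^~ (invmx B))); rewrite !mulmxK.
apply/rowP => i; rewrite !mxE; have := h i; rewrite /dotZ.
by under eq_bigr do rewrite mxE; under [RHS]eq_bigr do rewrite mxE;
   under [X in _ -> X = _]eq_bigr do rewrite !mxE;
   under [X in _ -> _ = X]eq_bigr do rewrite !mxE.
Qed.

(** Each row v of V satisfies c (1 - wave) <= omega(v) (1 - wave) <= 2 z(xi) <= c s, so the products
    with the rows embed the level set into the d-th power of a set of residues. *)
Lemma card_level (s : R) : 0 <= s ->
  #|[set xi : 'rV['Z_q.+2]_d | (2 * walk_freq omega K xi <= c * s)%R]%SET|%:R
    <= (2 * (q.+2%:R * Num.sqrt (2 * s)) + 1) ^+ d.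
Proof.
move=> s0; set S := [set xi | _]%SET.
pose P := [set k : 'Z_q.+2 | (1 - cosZ R k <= s)%R]%SET.
pose f (xi : 'rV['Z_q.+2]_d) := [ffun i => dotZ xi (row i V)].
have f_inj : injective f.
  by move=> xi eta /ffunP fE; apply: dotZ_rows_inj => i; have := fE i; rewrite !ffunE.
have : (#|S| <= #|P| ^ d)%N.
  rewrite -(card_imset _ f_inj) -[X in (_ <= _ ^ X)%N]card_ord -card_ffun_on.
  apply: subset_leq_card; apply/fintype.subsetP => _ /imsetP[xi + ->].
  rewrite !finset.inE => xiS; apply/ffun_onP => i; rewrite finset.inE ffunE.
  rewrite -(ler_pM2l c_gt0); apply: le_trans xiS.
  apply: le_trans (walk_freq_lower omega_supp omega_ge0 omega_sum xi (row i V)).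
  by rewrite ler_wpM2r // subr_ge0 cos_le1.
rewrite -(ler_nat R) => /le_trans; apply; rewrite natrX.
by rewrite lerXn2r ?nnegrE ?ler0n //; last exact: card_cosZ_ge.
Qed.

End Level.

Lemma jacobi_l2_bound : exists2 C : R, 0 <= C & forall n, (0 < n)%N ->
  \sum_(v <- lattice_box d (n * K)) jacobi omega n v ^+ 2 <= C / n%:R ^+ d.
Proof.
pose a : R := d%:R / 2; have aE : d%:R = 2 * a by rewrite /a mulrC divfK ?pnatr_eq0.
have [A [C [A0 C0 bound]]] := jacobi_poly_bound d_gt0 aE.
(* In [card_level] the level A 16^(j+1) gives 2 N sqrt(2s) = 16 sqrt(A/c) 4^j N / n; the extra 1 of
   that bound is absorbed in 4^j N / n >= 1. *)
pose E : R := 16 * Num.sqrt (A / c) + 1.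
have E0 : 0 < E by rewrite ltr_wpDl // mulr_ge0 ?sqrtr_ge0.
exists (C + 2 * C * E ^+ d).
  by rewrite addr_ge0 ?mulr_ge0 ?exprn_ge0 ?ltW.
move=> n n0.
have nR0 : 0 < n%:R :> R by rewrite ltr0n.
have nd0 : 0 < n%:R ^+ d :> R by rewrite exprn_gt0.
pose m := (2 * (n * K) + n + 1)%N; pose D := `|\det V|%N.
have D0 : (0 < D)%N by rewrite absz_gt0.
(* The order N = D m + 1 gives D m = -1 modulo N, so det V, which is D up to sign, is invertible.
   The value of m makes N exceed n and twice the side n K of the support. *)
pose q := (D * m).-1; have qE : q.+2 = (D * m).+1 by rewrite /q prednK // muln_gt0 D0 /m; lia.
have mq : (m < q.+2)%N by rewrite qE ltnS leq_pmull.
have V_unit : (\det V)%:~R \is a (@GRing.unit 'Z_q.+2).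
  have hD : D%:R * m%:R = -1 :> 'Z_q.+2.
    apply/eqP; rewrite -subr_eq0 opprK -natrM natr1 -qE.
    by rewrite -[X in X%:R]/(Zp_trunc q.+2).+2 char_Zp.
  have D_unit : D%:R \is a (@GRing.unit 'Z_q.+2).
    by apply/unitrPr; exists (- m%:R); rewrite mulrN hD opprK.
  by rewrite [\det V]intEsign rmorphM rmorph_sign /= -/D unitrMl ?unitrX ?unitrN1 // -pmulrn.
pose N : R := q.+2%:R.
have N0 : 0 < N by rewrite ltr0n.
have nN : n%:R <= N by rewrite ler_nat; apply: leq_trans (ltnW mq); rewrite /m; lia.
have LN : (n * K + n * K < q.+2)%N by apply: leq_ltn_trans mq; rewrite /m; lia.
have cardT : #|{: 'rV['Z_q.+2]_d}|%:R = N ^+ d :> R.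
  by rewrite card_mx card_ord mul1n -natrX.
pose theta : R := 2 * 4 ^+ d.
have theta0 : 0 < theta by rewrite mulr_gt0 ?exprn_gt0.
pose lev (xi : 'rV['Z_q.+2]_d) (j : nat) :=
  n%:R ^+ 2 * walk_freq omega K xi <= A * 16 ^+ j.+1.
(* As eigenvalues are at most 1, every frequency lies below level J, and finitely many levels
   suffice. *)
have [J hJ] : exists J : nat, n%:R ^+ 2 <= A * 16 ^+ J.
  exists (Num.truncn (n%:R ^+ 2 / A)).+1; rewrite mulrC -ler_pdivrMr //.
  apply: (le_trans (ltW (truncnS_gt _))); rewrite -(natrX _ 16) ler_nat ltnW //.
  exact: ltn_expl.
(* For z < 1/10 the least level j containing xi suffices: if j > 0, minimality gives n^2 z >= A
   16^j, the hypothesis of the decay; if j = 0, the uniform bound C is enough. The other terms are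
   nonnegative. *)
have pointwise xi : (jacobi_poly a n).[walk_freq omega K xi] ^+ 2 <=
    C / n%:R ^+ d + \sum_(j < J.+1) C / theta ^+ j * (lev xi j)%:R.
  set z := walk_freq omega K xi.
  have z01 : 0 <= z <= 1 by exact: walk_freq_itv.
  have /andP[z0 z1] := z01.
  have [b1 b2 b3] := bound n z n0 z01.
  have tge0 (j : 'I_J.+1) : 0 <= C / theta ^+ j * (lev xi j)%:R.
    by rewrite mulr_ge0 // divr_ge0 ?exprn_ge0 ?ltW.
  have [z10|z10] := lerP (10^-1) z.
    by rewrite (le_trans (b2 z10)) // lerDl sumr_ge0.
  suff [j hj hy] : exists2 j : 'I_J.+1, lev xi j &
      (jacobi_poly a n).[z] ^+ 2 <= C / theta ^+ j.
    rewrite (bigD1 j) //= hj mulr1 addrCA (le_trans hy) // lerDl.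
    by rewrite addr_ge0 ?sumr_ge0 // divr_ge0 // ltW.
  have [small|big] := lerP (n%:R ^+ 2 * z) (A * 16 ^+ 1).
    by exists ord0; rewrite ?expr0 ?divr1.
  have ex : exists j, n%:R ^+ 2 * z <= A * 16 ^+ j.+1.
    exists J; apply: (@le_trans _ _ (n%:R ^+ 2)).
      by rewrite ler_piMr ?exprn_ge0.
    apply: (le_trans hJ); rewrite ler_pM2l // ler_weXn2l ?ler1n //.
  case: (ex_minnP ex) => j jlev jmin.
  have jJ : (j < J.+1)%N.
    rewrite ltnS; apply: jmin; apply: (@le_trans _ _ (n%:R ^+ 2)).
      by rewrite ler_piMr ?exprn_ge0.
    by apply: (le_trans hJ); rewrite ler_pM2l // ler_weXn2l ?ler1n.
  exists (Ordinal jJ) => //=; apply: b3; first exact: ltW.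
  case: j jlev jmin jJ => [|j] jlev jmin jJ.
    by move: big; rewrite ltNge jlev.
  rewrite leNgt; apply/negP => /ltW /jmin; by rewrite ltnn.
have count (j : nat) : \sum_(xi : 'rV['Z_q.+2]_d) (lev xi j)%:R <= (N * 4 ^+ j * E / n%:R) ^+ d.
  pose s : R := 2 * (A * 16 ^+ j.+1) / (c * n%:R ^+ 2).
  have c0 := ltW c_gt0.
  have s0 : 0 <= s by rewrite divr_ge0 ?mulr_ge0 ?exprn_ge0 // ltW.
  have -> : \sum_(xi : 'rV['Z_q.+2]_d) (lev xi j)%:R =
      #|[set xi : 'rV['Z_q.+2]_d | (2 * walk_freq omega K xi <= c * s)%R]%SET|%:R :> R.
    rewrite -natr_sum; congr _%:R; rewrite -sum1_card [RHS]big_mkcond.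
    apply: eq_bigr => xi _; rewrite finset.inE /lev.
    have -> : c * s = 2 * (A * 16 ^+ j.+1) / n%:R ^+ 2.
      by rewrite /s; field; rewrite !gt_eqF.
    have -> : (2 * walk_freq omega K xi <= 2 * (A * 16 ^+ j.+1) / n%:R ^+ 2) =
        (n%:R ^+ 2 * walk_freq omega K xi <= A * 16 ^+ j.+1).
      by rewrite ler_pdivlMr ?exprn_gt0 // -mulrA ler_pM2l // mulrC.
    by case: (_ <= _).
  apply: le_trans (card_level V_unit s0) _; rewrite -/N.
  have sE : Num.sqrt (2 * s) = 8 * 4 ^+ j * Num.sqrt (A / c) / n%:R.
    have -> : 2 * s = (8 * 4 ^+ j / n%:R) ^+ 2 * (A / c).
      rewrite expr_div_n exprMn -exprM mulnC exprM (_ : 4 ^+ 2 = 16 :> R); last by ring.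
      by rewrite /s exprS; field; rewrite !gt_eqF.
    rewrite sqrtrM ?sqr_ge0 // sqrtr_sqr ger0_norm ?divr_ge0 ?mulr_ge0 ?exprn_ge0 //.
    by ring.
  have p4 : 1 <= 4 ^+ j :> R by rewrite exprn_ege1 // ler1n.
  have sq0 : 0 <= Num.sqrt (A / c) by exact: sqrtr_ge0.
  apply: lerXn2r; rewrite ?nnegrE.
  - by rewrite addr_ge0 // !mulr_ge0 ?sqrtr_ge0 // ltW.
  - by rewrite !mulr_ge0 ?invr_ge0 ?exprn_ge0 ?(ltW E0) ?(ltW N0).
  rewrite sE.
  have -> : N * 4 ^+ j * E / n%:R =
     2 * (N * (8 * 4 ^+ j * Num.sqrt (A / c) / n%:R)) + 4 ^+ j * (N / n%:R).
    by rewrite /E; ring.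
  rewrite lerD2l; apply: (le_trans p4); rewrite ler_peMr ?exprn_ge0 //.
  by rewrite ler_pdivlMr // mul1r.
have Nd0 : 0 < N ^+ d by rewrite exprn_gt0.
rewrite -(ler_pM2l Nd0) -{1}cardT -(wave_parseval LN); last first.
  by move=> v; rewrite (jacobi_even omega_supp omega_sym).
have step1 : \sum_(xi : 'rV['Z_q.+2]_d) (\sum_(v <- lattice_box d (n * K))
     jacobi omega n v * wave R xi v) ^+ 2 <=
  \sum_(xi : 'rV['Z_q.+2]_d)
    (C / n%:R ^+ d + \sum_(j < J.+1) C / theta ^+ j * (lev xi j)%:R).
  apply: ler_sum => xi _; apply: le_trans (pointwise xi).
  rewrite -(pairing_jacobi_wave omega_supp omega_sym xi n d_gt0 aE) /pairing.
  rewrite (@fsum_box _ _ _ (n * K)) // => v /(jacobi_supp omega_supp) ->.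
  by rewrite mul0r.
apply: (le_trans step1); rewrite big_split /= sumr_const -[X in X + _]mulr_natr cardT.
rewrite exchange_big /=.
have step2 (j : nat) : \sum_(xi : 'rV['Z_q.+2]_d) C / theta ^+ j * (lev xi j)%:R <=
    C * (N ^+ d * E ^+ d / n%:R ^+ d) * 2^-1 ^+ j.
  rewrite -mulr_sumr.
  apply: (@le_trans _ _ (C / theta ^+ j * (N * 4 ^+ j * E / n%:R) ^+ d)).
    by rewrite ler_wpM2l ?count // divr_ge0 ?exprn_ge0 ?ltW.
  have p4 : (4 : R) ^+ j ^+ d != 0 by rewrite !expf_neq0 // pnatr_eq0.
  rewrite le_eqVlt; apply/orP; left; apply/eqP.
  rewrite !(exprMn, expr_div_n, exprVn) /theta ?exprMn -(exprM _ d j) (mulnC d j) exprM.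
  have p2 : (2 : R) ^+ j != 0 by rewrite expf_neq0 // pnatr_eq0.
  by field; rewrite p2 p4 gt_eqF.
apply: (@le_trans _ _ (C / n%:R ^+ d * N ^+ d +
    \sum_(j < J.+1) C * (N ^+ d * E ^+ d / n%:R ^+ d) * 2^-1 ^+ j)).
  by rewrite lerD2l; apply: ler_sum => j _; exact: step2.
rewrite -mulr_sumr.
have geo : \sum_(j < J.+1) (2^-1 : R) ^+ j <= 2.
  have -> : \sum_(j < J.+1) (2^-1 : R) ^+ j = 2 - 2 * 2^-1 ^+ J.+1.
    elim: (J.+1) => [|i IH]; first by rewrite big_ord0 expr0; ring.
    by rewrite big_ord_recr /= IH exprS; field.
  by rewrite lerBlDr lerDl mulr_ge0 ?exprn_ge0.
have -> : N ^+ d * ((C + 2 * C * E ^+ d) / n%:R ^+ d) =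
   C / n%:R ^+ d * N ^+ d + C * (N ^+ d * E ^+ d / n%:R ^+ d) * 2 by ring.
rewrite lerD2l ler_wpM2l // mulr_ge0 ?ltW // divr_gt0 ?mulr_gt0 ?exprn_gt0 //.
Qed.

Lemma jacobi_total_variation : exists C : R, forall n,
  \sum_(v <- lattice_box d (n * K)) `|jacobi omega n v| <= C.
Proof.
have [C C0 l2] := jacobi_l2_bound.
(* For positive n the box has at most B n^d points, with B = (2K + 1)^d, which cancels the factor
   n^-d and bounds the squared variation by B C. The sum 1 + B + C exceeds sqrt(B C) and also covers
   n = 0. *)
exists (1 + (2 * K%:R + 1) ^+ d + C) => n; case: n => [|n].
  rewrite mul0n; apply: (@le_trans _ _ 1).
    rewrite (bigD1_seq 0) ?lattice_box_uniq ?lattice_box0 //= jacobi0 /Defs.indic eqxx normr1.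
    rewrite big1 ?addr0 // => v /negbTE v0.
    by rewrite v0 normr0.
  by rewrite -addrA lerDl addr_ge0 // exprn_ge0 // addr_ge0 // mulr_ge0.
set S := \sum_(v <- _) _.
have n0 : 0 < n.+1%:R :> R by rewrite ltr0n.
have B0 : 0 <= (2 * K%:R + 1) ^+ d :> R by rewrite exprn_ge0 // addr_ge0 // mulr_ge0.
have S0 : 0 <= S by rewrite sumr_ge0.
have S2 : S ^+ 2 <= (2 * K%:R + 1) ^+ d * C.
  apply: (le_trans (sqr_sum_norm_le _ _)); rewrite size_lattice_box.
  apply: (@le_trans _ _ ((2 * K%:R + 1) ^+ d * n.+1%:R ^+ d * (C / n.+1%:R ^+ d))).
    rewrite ler_pM ?l2 ?sumr_ge0 // => [v _|]; first exact: sqr_ge0.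
    rewrite natrX -exprMn lerXn2r ?nnegrE ?mulr_ge0 ?addr_ge0 ?mulr_ge0 //.
    rewrite mulrDl mul1r -mulrA -natrM -natr1 natrM (mulnC n.+1) lerD2l ler1n //.
  by rewrite mulrA le_eqVlt; apply/orP; left; apply/eqP; field; rewrite expf_neq0 // gt_eqF.
set B := (2 * K%:R + 1) ^+ d in B0 S2 *.
nra.
Qed.

End TotalVariation.

(** * Moments of the Jacobi iterates *)

(* The moment of order m of a linear form h under the uniform law on the unit
   ball of dimension 2a, divided by m!, where s is the squared norm of h. *)
Definition ball_moment (R : realType) (a s : R) (m : nat) : R :=
  if odd m then 0 else
  \prod_(i < m./2) (s / 4 / ((i%:R + 1) * (i%:R + a + 1))).

Section Moments.
Variables (R : realType) (d : nat) (omega : 'rV[int]_d -> R) (K : nat).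
Hypothesis d_gt0 : (0 < d)%N.
Hypothesis omega_supp : forall v, v \notin lattice_box d K -> omega v = 0.
Hypothesis omega_sum : \sum_(v <- lattice_box d K) omega v = 1.
Hypothesis omega_sym : forall v, omega (- v) = omega v.
Variable l : 'rV[int]_d -> R.
Hypothesis lD : forall v w, l (v + w) = l v + l w.

Local Notation D := (walk_diff omega K).

Let l0 : l 0 = 0.
Proof. by apply: (addrI (l 0)); rewrite -lD !addr0. Qed.

Let lN v : l (- v) = - l v.
Proof. by apply/eqP; rewrite -addr_eq0 -lD addNr l0. Qed.

(** Divided powers: the binomial formula becomes the convolution [fD], and D acts on them through
    the coefficients [mu]. *)
Let f (m : nat) (v : 'rV[int]_d) : R := l v ^+ m / m`!%:R.

Let mu (i : nat) : R := - (\sum_(u <- lattice_box d K) omega u * f i u) / 2.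

Let fact_neq0 (m : nat) : m`!%:R != 0 :> R.
Proof. by rewrite pnatr_eq0 -lt0n fact_gt0. Qed.

Let fD m v u : f m (v + u) = \sum_(i < m.+1) f (m - i) v * f i u.
Proof.
rewrite /f lD exprDn big_distrl; apply: eq_bigr => i _ /=.
have im : (i <= m)%N by rewrite -ltnS.
have := congr1 (fun k => k%:R : R) (bin_fact im); rewrite !natrM => <-.
have i0 := fact_neq0 i; have mi0 := fact_neq0 (m - i).
have b0 : 'C(m, i)%:R != 0 :> R by rewrite pnatr_eq0 -lt0n bin_gt0.
by rewrite -mulr_natr; field; rewrite i0 mi0 b0.
Qed.

Let D_f m v : D (f m) v = \sum_(i < m) mu i.+1 * f (m - i.+1) v.
Proof.
rewrite /walk_diff /walk_avg.
under eq_bigr do rewrite fD big_distrr /=.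
rewrite exchange_big /= big_ord_recl /= subn0.
have -> : \sum_(u <- lattice_box d K) omega u * (f m v * f 0 u) = f m v.
  rewrite -[RHS]mulr1 -omega_sum big_distrr /=; apply: eq_bigr => u _.
  by rewrite /f expr0 fact0 divr1 mulr1 mulrC.
rewrite opprD addrA subrr add0r mulNr -mulrN mulr_suml.
apply: eq_bigr => i _; rewrite -[bump 0 i]/i.+1 /mu.
have -> : \sum_(u <- lattice_box d K) omega u * (f (m - i.+1) v * f i.+1 u) =
    (\sum_(u <- lattice_box d K) omega u * f i.+1 u) * f (m - i.+1) v.
  by rewrite mulr_suml; apply: eq_bigr => u _; ring.
by ring.
Qed.

Let D_sum j m (b : nat -> R) (phi : nat -> 'rV[int]_d -> R) v :
  iter j D (fun v => \sum_(i < m) b i * phi i v) v = \sum_(i < m) b i * iter j D (phi i) v.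
Proof.
elim: j v => // j IH v; rewrite iterS.
have -> : iter j D (fun v => \sum_(i < m) b i * phi i v) =
   fun v => \sum_(i < m) b i * iter j D (phi i) v by apply/funext.
rewrite /walk_diff /walk_avg -/D.
under [X in _ - X]eq_bigr do rewrite big_distrr /=.
rewrite exchange_big -sumrB big_distrl; apply: eq_bigr => i _ /=.
rewrite mulrA mulrBr; congr ((_ - _) / _).
by rewrite big_distrr; apply: eq_bigr => u _; rewrite /= mulrCA.
Qed.

Let B j m := iter j D (f m) 0.

Let B0 m : B 0 m = (m == 0%N)%:R.
Proof. by rewrite /B /= /f l0 expr0n; case: m => [|m]; rewrite ?divr1 ?mul0r. Qed.

Let BS j m : B j.+1 m = \sum_(i < m) mu i.+1 * B j (m - i.+1).
Proof.
rewrite /B iterSr.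
have -> : D (f m) = fun v => \sum_(i < m) mu i.+1 * f (m - i.+1) v.
  by apply/funext => v; exact: D_f.
exact: (D_sum j m (fun i => mu i.+1) (fun i => f (m - i.+1))).
Qed.

Let mu_odd i : odd i -> mu i = 0.
Proof.
move=> oi; rewrite /mu; set S := \sum_(u <- _) _.
have : S = - S.
  rewrite {1}/S -sum_lattice_boxN -sumrN; apply: eq_bigr => u _.
  by rewrite /f lN omega_sym exprNn -signr_odd oi expr1; ring.
move=> SN; have -> : S = 0 by lra.
by rewrite oppr0 mul0r.
Qed.

Let B_low j m : (m < 2 * j)%N -> B j m = 0.
Proof.
elim: j m => [|j IH] m mj; first by rewrite muln0 in mj.
rewrite BS big1 // => i _; case: i => -[|i] im /=.
  by rewrite mu_odd // mul0r.
by rewrite IH ?mulr0 //; lia.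
Qed.

(** Reaching degree 0 from degree 2j in j steps forces each D to lower the degree by exactly 2, so
    only [mu 2] occurs. *)
Let B_top j : B j (2 * j) = mu 2 ^+ j.
Proof.
elim: j => [|j IH]; first by rewrite B0.
have lt1 : (1 < 2 * j.+1)%N by lia.
have j2 : (2 * j.+1 - 2 = 2 * j)%N by lia.
rewrite BS (bigD1 (Ordinal lt1)) //= j2 IH exprS big1 ?addr0 // => i i1.
have [i0|i0] := eqVneq (nat_of_ord i) 0%N; first by rewrite i0 mu_odd // mul0r.
have i1' : nat_of_ord i != 1%N by apply: contra i1 => /eqP h; apply/eqP/val_inj.
rewrite B_low ?mulr0 //; move: (nat_of_ord i) i0 i1' (ltn_ord i) => -[|[|k]] // _ _; lia.
Qed.

(** By [B_low] the terms beyond m/2 vanish, so the number of terms depends on m only and n can tend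
    to infinity. *)
Lemma pairing_jacobi_pow (a : R) n m : d%:R = 2 * a ->
  pairing (jacobi omega n) (fun v => l v ^+ m) =
  m`!%:R * \sum_(j < (m./2).+1) jacobi_coef a n j * B j m.
Proof.
move=> aE; rewrite (pairing_jacobi omega_supp _ _ d_gt0 aE).
have -> : (fun v => l v ^+ m) = fun v => \sum_(i < 1) m`!%:R * f m v.
  by apply/funext => v; rewrite big_ord1 /f mulrC divfK.
set N := maxn (size (jacobi_poly a n)) (m./2).+1.
rewrite (@walk_horner_widen _ _ _ _ N) ?leq_maxl //.
under eq_bigr do rewrite (D_sum _ 1 (fun=> m`!%:R) (fun=> f m)) big_ord1 coef_jacobi_poly.
rewrite (big_ord_widen N (fun j => jacobi_coef a n j * B j m)) ?leq_maxr //.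
rewrite big_distrr /= [RHS]big_mkcond /=; apply: eq_bigr => j _.
case: ltnP => [_|mj]; first by rewrite /B mulrCA.
rewrite -/(B j m) B_low ?mulr0 //; have := odd_double_half m.
by case: (odd m) => /=; lia.
Qed.

Lemma cvg_scaled_truncn (t : R) : 0 < t ->
  (fun e : R => e * (Num.truncn (t / e))%:R) @ 0^'+ --> t.
Proof.
move=> t0; apply: (@squeeze_cvgr _ _ _ _ (fun e => t - e) (fun=> t)).
- near=> e; have e0 : 0 < e by [].
  have te : 0 <= t / e by rewrite divr_ge0 // ltW.
  apply/andP; split; last by rewrite mulrC -ler_pdivlMr // truncn_le.
  rewrite lerBlDr.
  have -> : e * (Num.truncn (t / e))%:R + e = (Num.truncn (t / e)).+1%:R * e.
    by rewrite -natr1; ring.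
  rewrite -ler_pdivrMr //.
  exact/ltW/truncnS_gt.
- rewrite -[X in _ --> X]subr0; apply: cvgB; first exact: cvg_cst.
  exact/cvg_at_right_filter/cvg_id.
- exact: cvg_cst.
Unshelve. all: by end_near. Qed.

(** Each of the j factors is quadratic in n; giving it its own e^2 makes it a function of e n, which
    tends to t, and of e, which tends to 0. *)
Lemma cvg_scaled_jacobi_coef (a t : R) j : 0 < t ->
  (fun e : R => e ^+ (2 * j) * jacobi_coef a (Num.truncn (t / e)) j) @ 0^'+
  --> \prod_(i < j) (- t ^+ 2 / ((i%:R + 1) * (i%:R + a + 1))).
Proof.
move=> t0; elim: j => [|j IH].
  rewrite big_ord0; under eq_fun do rewrite muln0 expr0 mul1r jacobi_coef0.
  exact: cvg_cst.
rewrite big_ord_recr /=.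
have e0 : (fun e : R => e) @ 0^'+ --> (0 : R) by exact/cvg_at_right_filter/cvg_id.
have nt := cvg_scaled_truncn t0.
have -> : (fun e : R => e ^+ (2 * j.+1) * jacobi_coef a (Num.truncn (t / e)) j.+1) =
  (fun e : R => (e ^+ (2 * j) * jacobi_coef a (Num.truncn (t / e)) j) *
    (- (e * (Num.truncn (t / e))%:R - e * j%:R)
       * (e * (Num.truncn (t / e))%:R + e * (j%:R + a + 1))
     / ((j%:R + 1) * (j%:R + a + 1)))).
  apply/funext => e; rewrite jacobi_coefS mulnS exprD; ring.
have -> : - t ^+ 2 / ((j%:R + 1) * (j%:R + a + 1)) =
   - (t - 0 * j%:R) * (t + 0 * (j%:R + a + 1)) / ((j%:R + 1) * (j%:R + a + 1)) :> R.
  by rewrite expr2; ring.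
apply: cvgM => //; apply: cvgM; last exact: cvg_cst.
apply: cvgM; first apply: cvgN; first apply: cvgB => //.
- by apply: cvgM => //; exact: cvg_cst.
- by apply: cvgD => //; apply: cvgM => //; exact: cvg_cst.
Qed.

(** The j-th term is a convergent factor times e^(m - 2j), so only 2j = m survives. There mu 2 =
    -s2/4, and its sign cancels that of the limit coefficients. *)
Lemma cvg_jacobi_moment (a t : R) m : d%:R = 2 * a -> 0 < t ->
  (fun e : R => pairing (jacobi omega (Num.truncn (t / e))) (fun v => (e * l v) ^+ m)) @ 0^'+
  --> m`!%:R * ball_moment a (t ^+ 2 * \sum_(u <- lattice_box d K) omega u * l u ^+ 2) m.
Proof.
move=> aE t0; set s2 := \sum_(u <- _) _.
have mu2 : mu 2 = - s2 / 4.
  rewrite /mu; have -> : \sum_(u <- lattice_box d K) omega u * f 2 u = s2 / 2.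
    by rewrite mulr_suml; apply: eq_bigr => u _; rewrite /f (_ : 2`! = 2)%N // mulrA.
  by field.
have e0 : (fun e : R => e) @ 0^'+ --> (0 : R) by exact/cvg_at_right_filter/cvg_id.
have -> : (fun e : R => pairing (jacobi omega (Num.truncn (t / e))) (fun v => (e * l v) ^+ m)) =
  (fun e : R => m`!%:R * \sum_(j < (m./2).+1)
     (e ^+ (2 * j) * jacobi_coef a (Num.truncn (t / e)) j) * (e ^+ (m - 2 * j) * B j m)).
  apply/funext => e.
  transitivity (e ^+ m * pairing (jacobi omega (Num.truncn (t / e))) (fun v => l v ^+ m)).
    rewrite /pairing !(@fsum_box _ _ _ (Num.truncn (t / e) * K)).
    - by rewrite big_distrr; apply: eq_bigr => v _ /=; rewrite exprMn mulrCA.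
    - by move=> v /(jacobi_supp omega_supp) ->; rewrite mul0r.
    - by move=> v /(jacobi_supp omega_supp) ->; rewrite mul0r.
  rewrite (pairing_jacobi_pow _ _ aE) mulrCA; congr (_ * _).
  rewrite big_distrr; apply: eq_bigr => j _ /=.
  have jm : (2 * j <= m)%N by have := odd_double_half m; have := ltn_ord j; lia.
  by rewrite -{1}(subnKC jm) exprD; ring.
have lim j : (j <= m./2)%N ->
  (fun e : R => (e ^+ (2 * j) * jacobi_coef a (Num.truncn (t / e)) j) * (e ^+ (m - 2 * j) * B j m))
   @ 0^'+ --> (if (2 * j == m)%N then ball_moment a (t ^+ 2 * s2) m else 0).
  move=> jm; case: eqP => [jm2|jm2].
    have -> : (fun e : R => (e ^+ (2 * j) * jacobi_coef a (Num.truncn (t / e)) j)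
          * (e ^+ (m - 2 * j) * B j m)) =
        (fun e : R => (e ^+ (2 * j) * jacobi_coef a (Num.truncn (t / e)) j) * mu 2 ^+ j).
      by apply/funext => e; rewrite -jm2 subnn B_top mul1r.
    have -> : ball_moment a (t ^+ 2 * s2) m =
       (\prod_(i < j) (- t ^+ 2 / ((i%:R + 1) * (i%:R + a + 1)))) * mu 2 ^+ j.
      rewrite -jm2 /ball_moment mul2n odd_double doubleK.
      rewrite mu2; elim: (j) => [|i IHi]; first by rewrite !big_ord0 mul1r.
      by rewrite !big_ord_recr /= IHi (exprS (- s2 / 4)); ring.
    by apply: cvgM; [exact: cvg_scaled_jacobi_coef|exact: cvg_cst].
  have h : (0 < m - 2 * j)%N by have := odd_double_half m; lia.
  rewrite [X in _ --> X](_ : 0 =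
    (\prod_(i < j) (- t ^+ 2 / ((i%:R + 1) * (i%:R + a + 1)))) * (0 ^+ (m - 2 * j) * B j m)); last first.
    by rewrite expr0n gtn_eqF // mul0r mulr0.
  apply: cvgM; first exact: cvg_scaled_jacobi_coef.
  apply: cvgM; last exact: cvg_cst.
  exact: (@cvg_comp _ _ _ (fun e : R => e) (fun e : R => e ^+ (m - 2 * j)) _ _ _ e0
    (@exprn_continuous _ _ _)).
have -> : ball_moment a (t ^+ 2 * s2) m = \sum_(j < (m./2).+1)
   (if (2 * j == m)%N then ball_moment a (t ^+ 2 * s2) m else 0).
  have [om|em] := boolP (odd m).
    by rewrite /ball_moment om big1 // => j _; case: eqP.
  have hm : (2 * m./2 = m)%N by have := odd_double_half m; rewrite (negbTE em); lia.
  rewrite big_ord_recr /= hm eqxx big1 ?add0r //.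
  by move=> j _; have := ltn_ord j; case: eqP => //; lia.
apply: cvgM; first exact: cvg_cst.
apply: cvg_big => [|j _]; first exact: add_continuous.
by apply: lim; rewrite -ltnS.
Qed.

End Moments.

(** * Iterated integrals *)

Section RintegralT.
Variable R : realType.
Local Notation mu := (@lebesgue_measure R).

(** Tonelli is applied to the positive and negative parts separately, so the slices may fail to be
    integrable. *)
Lemma measurable_Rintegral_param dd (P : measurableType dd)
    (F : P * measurableTypeR R -> R) : measurable_fun setT F ->
  measurable_fun setT (fun p => Rintegral mu setT (fun x => F (p, x))).
Proof.
move=> mF; rewrite /Rintegral.
suff mI : measurable_fun setT (fun p => \int[mu]_x (F (p, x))%:E)%E by exact: measurableT_comp mI.
under eq_fun do rewrite integralE.
have mE : measurable_fun setT (EFin \o F) by exact/measurable_EFinP.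
apply: emeasurable_funB.
- have := @measurable_fun_fubini_tonelli_F _ _ P (measurableTypeR R) R mu _ (measurable_funepos mE) (fun=> funepos_ge0 _ _).
  apply: eq_measurable_fun => p _; apply: eq_integral => x _.
  by rewrite !funeposE.
- have := @measurable_fun_fubini_tonelli_F _ _ P (measurableTypeR R) R mu _ (measurable_funeneg mE) (fun=> funeneg_ge0 _ _).
  apply: eq_measurable_fun => p _; apply: eq_integral => x _.
  by rewrite !funenegE.
Qed.

(** Lebesgue measure is characterized by the lengths of half-open intervals, and l times its image
    under x -> l x + c has the same ones. *)
Lemma integral_affine_ge0 (l c : R) (f : R -> \bar R) : 0 < l ->
  measurable_fun [set: measurableTypeR R] f -> (forall x, 0 <= f x)%E ->
  (\int[mu]_x f x = l%:E * \int[mu]_x f (l * x + c)%R)%E.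
Proof.
move=> l0 mf f0.
pose T (x : measurableTypeR R) : measurableTypeR R := l * x + c.
have mT : measurable_fun setT T.
  by apply: measurable_funD => //; exact: measurable_funM.
have h A : measurable A -> mu A = mscale (NngNum (ltW l0)) (pushforward mu T) A.
  apply: lebesgue_measure_unique => _ [[a b] _ <-] /=.
  have TE : T @^-1` `]a, b]%classic = `](a - c) / l, (b - c) / l]%classic.
    apply/seteqP; split => x /=; rewrite !in_itv /= /T;
    by rewrite ltr_pdivrMr // ler_pdivlMr // ltrBlDr lerBrDr (mulrC x).
  rewrite -[RHS]/(l%:E * mu (T @^-1` `]a, b]%classic))%E TE !lebesgue_measure_itv /= !lte_fin ltr_pM2r ?invr_gt0 // ltrD2r.
  case: ifP => _; last by rewrite mule0.
  by rewrite -!EFinB -EFinM; congr EFin; field; rewrite gt_eqF.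
have s1 : (\int[mu]_x f x = \int[mscale (NngNum (ltW l0)) (pushforward mu T)]_x f x)%E.
  by move=> m; apply: eq_measure_integral => A mA _; exact: (h m).
rewrite (s1 mT) ge0_integral_mscale //=; congr (_ * _)%E.
by rewrite ge0_integral_pushforward.
Qed.

Lemma Rintegral_affine (l c : R) (f : R -> R) : 0 < l ->
  measurable_fun [set: measurableTypeR R] f ->
  mu.-integrable setT (EFin \o f) ->
  Rintegral mu setT f = l * Rintegral mu setT (fun x => f (l * x + c)).
Proof.
move=> l0 mf fint.
have mT : measurable_fun setT (fun x : measurableTypeR R => l * x + c : measurableTypeR R).
  by apply: measurable_funD => //; exact: measurable_funM.
have mEf : measurable_fun setT (EFin \o f) by exact/measurable_EFinP.
have fin (g : R -> \bar R) : measurable_fun [set: measurableTypeR R] g ->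
    (forall x, 0 <= g x)%E -> (\int[mu]_x g x)%E \is a fin_num ->
    (\int[mu]_x g (l * x + c)%R)%E \is a fin_num.
  move=> mg g0; rewrite (integral_affine_ge0 c l0 mg g0).
  have : (0 <= \int[mu]_x g (l * x + c)%R)%E by apply: integral_ge0 => x _; exact: g0.
  case: (\int[mu]_x g (l * x + c)%R)%E => [r| |] //=.
  by rewrite mulry gtr0_sg // mul1e.
have hp := fin _ (measurable_funepos mEf) (fun=> funepos_ge0 _ _) (integrable_pos_fin_num measurableT fint).
have hn := fin _ (measurable_funeneg mEf) (fun=> funeneg_ge0 _ _) (integrable_neg_fin_num measurableT fint).
set p := (\int[mu]_x _)%E in hp; set m := (\int[mu]_x _)%E in hn.
have -> : Rintegral mu setT (fun x => f (l * x + c)) = fine (p - m)%E.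
  rewrite /Rintegral integralE; congr (fine (_ - _)%E); apply: eq_integral => x _.
    by rewrite !funeposE.
  by rewrite !funenegE.
have -> : Rintegral mu setT f = fine (l%:E * (p - m))%E.
  rewrite /Rintegral integralE muleBr ?fin_num_adde_defr //; congr fine.
  by rewrite (integral_affine_ge0 c l0 (measurable_funepos mEf)) //
             (integral_affine_ge0 c l0 (measurable_funeneg mEf)).
by rewrite fineM // fin_numB hp hn.
Qed.

Lemma integrable_compact (f : R -> R) (M r : R) :
  measurable_fun [set: measurableTypeR R] f -> (forall x, `|f x| <= M) ->
  (forall x, r < `|x| -> f x = 0) -> mu.-integrable setT (EFin \o f).
Proof.
move=> mf fM f0.
have fE : (EFin \o f) = (EFin \o f) \_ `[-r, r]%classic.
  apply/funext => x; rewrite patchE; case: ifPn => // /negP xr /=.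
  rewrite f0 // ltNge; apply/negP => xr'; apply: xr.
  by rewrite inE /= in_itv /= -ler_norml.
rewrite fE; apply: (iffLR (integrable_mkcond _ _)) => //.
apply: measurable_bounded_integrable => //.
- have muI : (mu `[(-r)%R, r]%classic < +oo)%E.
    by rewrite lebesgue_measure_itv /=; case: ifP => _; rewrite ?ltry // -EFinD ltry.
  exact: muI.
- exact: measurable_funS mf.
- exists M; split; first exact: num_real.
  by move=> x Mx y _ /=; exact: le_trans (fM y) (ltW Mx).
Qed.

Lemma Rintegral_compact_bound (f : R -> R) (M r : R) : 0 <= r ->
  measurable_fun [set: measurableTypeR R] f -> (forall x, `|f x| <= M) ->
  (forall x, r < `|x| -> f x = 0) -> `|Rintegral mu setT f| <= M * (2 * r).
Proof.
move=> r0 mf fM f0.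
have fint := integrable_compact mf fM f0.
have fE : f = f \_ `[-r, r]%classic.
  apply/funext => x; rewrite patchE; case: ifPn => // /negP xr /=.
  rewrite f0 // ltNge; apply/negP => xr'; apply: xr.
  by rewrite inE /= in_itv /= -ler_norml.
have muI : mu `[-r, r]%classic = (2 * r)%:E.
  rewrite lebesgue_measure_itv /= lte_fin; case: ltP => h.
    by rewrite -EFinD; congr EFin; ring.
  by congr EFin; lra.
have muIoo : (mu `[(-r)%R, r]%classic < +oo)%E by rewrite muI ltry.
have fintI : mu.-integrable `[-r, r]%classic (EFin \o f) by exact: integrableS fint.
rewrite fE -Rintegral_mkcond.
apply: (le_trans (le_normr_Rintegral _ fintI)) => //.
rewrite -[leRHS]/(M * fine ((2 * r)%:E)) -muI -Rintegral_cst //.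
apply: le_Rintegral => //.
- exact: integrable_norm fintI.
- apply: measurable_bounded_integrable => //.
  exists `|M|; split; first exact: num_real.
  by move=> x Mx y _ /=; exact: ltW.
Qed.

End RintegralT.

(** Measurability is tested by substituting arbitrary measurable functions for the coordinates, so
    no sigma-algebra on row vectors is involved. The parameter in P absorbs the first coordinate
    when the dimension decreases. *)
Definition joint_measurable (R : realType) (n : nat) (dd : measure_display)
    (P : measurableType dd) (f : P -> 'rV[R]_n -> R) : Prop :=
  forall (dd' : measure_display) (Q : measurableType dd') (g : Q -> P)
    (e : 'I_n -> Q -> measurableTypeR R),
  measurable_fun setT g -> (forall i, measurable_fun setT (e i)) ->
  measurable_fun setT (fun q => f (g q) (\row_i e i q)).

Definition compact_bounded (R : realType) (n : nat) (M r : R)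
    (f : 'rV[R]_n -> R) : Prop :=
  (forall y, `|f y| <= M) /\ (forall (y : 'rV[R]_n) i, r < `|y 0 i| -> f y = 0).

Section IntegralRn.
Variable R : realType.
Local Notation mu := (@lebesgue_measure R).

Definition cons_rV (n : nat) (x : R) (y : 'rV[R]_n) : 'rV[R]_(1 + n) :=
  row_mx (const_mx x : 'rV[R]_1) y.

Lemma cons_rV0 n x (y : 'rV[R]_n) : cons_rV x y 0 ord0 = x.
Proof. by rewrite /cons_rV mxE; case: splitP => // j; rewrite mxE. Qed.

Lemma cons_rVS n x (y : 'rV[R]_n) i : cons_rV x y 0 (lift ord0 i) = y 0 i.
Proof.
rewrite /cons_rV mxE; case: splitP => j /=; first by rewrite ord1.
by rewrite /bump /= !add1n => -[/val_inj ->].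
Qed.

Lemma integral_RnS n (f : 'rV[R]_n.+1 -> R) :
  integral_Rn f = Rintegral mu setT (fun x => integral_Rn (fun y => f (cons_rV x y))).
Proof. by []. Qed.

Lemma joint_measurable_cons n dd (P : measurableType dd) (f : P -> 'rV[R]_n.+1 -> R) :
  joint_measurable f ->
  joint_measurable (fun (px : P * measurableTypeR R) y => f px.1 (cons_rV px.2 y)).
Proof.
move=> mf dd' Q g e mg me.
pose e' (i : 'I_n.+1) q : measurableTypeR R :=
  if unlift ord0 i is Some j then e j q else (g q).2.
have -> : (fun q => f (g q).1 (cons_rV (g q).2 (\row_i e i q))) =
    (fun q => f (g q).1 (\row_i e' i q)).
  apply/funext => q; congr f; apply/rowP => i; rewrite [RHS]mxE /e'.
  case: unliftP => [j ->|->]; first by rewrite cons_rVS mxE.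
  by rewrite cons_rV0.
apply: (mf _ Q (fun q => (g q).1)).
  exact: measurableT_comp measurable_fst mg.
move=> i; rewrite /e'; case: unliftP => [j _|_]; first exact: me.
exact: measurableT_comp measurable_snd mg.
Qed.

Lemma integral_Rn_measurable n dd (P : measurableType dd) (f : P -> 'rV[R]_n -> R) :
  joint_measurable f -> measurable_fun setT (fun p => integral_Rn (f p)).
Proof.
elim: n dd P f => [|n IH] dd P f mf.
  have -> : (fun p => integral_Rn (f p)) = (fun p => f p (\row_(i < 0) 0)).
    by apply/funext => p /=; congr f; apply/rowP => -[].
  by apply: (mf _ P id (fun=> cst 0)).
exact: (measurable_Rintegral_param (IH _ _ _ (joint_measurable_cons mf))).
Qed.

Lemma integral_Rn_measurable_slice n (f : 'rV[R]_n.+1 -> R) :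
  joint_measurable (fun _ : unit => f) ->
  measurable_fun [set: measurableTypeR R] (fun x => integral_Rn (fun y => f (cons_rV x y))).
Proof.
move=> mf; have mF := integral_Rn_measurable (joint_measurable_cons mf).
apply: (measurableT_comp mF (g := fun x : measurableTypeR R => (tt, x))).
exact: measurable_fun_pair.
Qed.

Lemma joint_measurable_slice n (f : 'rV[R]_n.+1 -> R) x :
  joint_measurable (fun _ : unit => f) ->
  joint_measurable (fun _ : unit => fun y => f (cons_rV x y)).
Proof.
move=> mf dd' Q g e mg me.
apply: (joint_measurable_cons mf (g := fun q => (g q, x))) => //.
exact: measurable_fun_pair.
Qed.

Lemma compact_bounded_slice n M r (f : 'rV[R]_n.+1 -> R) x :
  compact_bounded M r f -> compact_bounded M r (fun y => f (cons_rV x y)).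
Proof.
by move=> [fM f0]; split=> // y i ri; apply: (f0 _ (lift ord0 i)); rewrite cons_rVS.
Qed.

Lemma integral_Rn0 n (f : 'rV[R]_n -> R) : (forall y, f y = 0) -> integral_Rn f = 0.
Proof.
elim: n f => [|n IH] f f0; first exact: f0.
rewrite integral_RnS /Rintegral integral0_eq //= => x _.
by rewrite IH.
Qed.

Lemma integral_Rn_bound n M r (f : 'rV[R]_n -> R) : 0 <= r ->
  joint_measurable (fun _ : unit => f) -> compact_bounded M r f ->
  `|integral_Rn f| <= M * (2 * r) ^+ n.
Proof.
move=> r0; elim: n f => [|n IH] f mf cf; first by rewrite mulr1; exact: cf.1.
rewrite integral_RnS exprSr (mulrA M); apply: Rintegral_compact_bound => //.
- exact: integral_Rn_measurable_slice.
- by move=> x; apply: IH; [exact: joint_measurable_slice|exact: compact_bounded_slice].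
- move=> x rx; apply: integral_Rn0 => y; apply: (cf.2 _ ord0).
  by rewrite cons_rV0.
Qed.

Lemma integrable_slice n M r (f : 'rV[R]_n.+1 -> R) : 0 <= r ->
  joint_measurable (fun _ : unit => f) -> compact_bounded M r f ->
  mu.-integrable setT (EFin \o (fun x => integral_Rn (fun y => f (cons_rV x y)))).
Proof.
move=> r0 mf cf; apply: (@integrable_compact _ _ (M * (2 * r) ^+ n) r).
- exact: integral_Rn_measurable_slice.
- move=> x; apply: integral_Rn_bound => //.
    exact: joint_measurable_slice.
  exact: compact_bounded_slice.
- move=> x rx; apply: integral_Rn0 => y; apply: (cf.2 _ ord0).
  by rewrite cons_rV0.
Qed.

Lemma integral_Rn_lin n M r (f g : 'rV[R]_n -> R) (b c : R) : 0 <= r ->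
  joint_measurable (fun _ : unit => f) -> compact_bounded M r f ->
  joint_measurable (fun _ : unit => g) -> compact_bounded M r g ->
  integral_Rn (fun y => b * f y + c * g y) = b * integral_Rn f + c * integral_Rn g.
Proof.
move=> r0; elim: n f g => [//|n IH] f g mf cf mg cg.
rewrite !integral_RnS.
have -> : (fun x => integral_Rn (fun y => b * f (cons_rV x y) + c * g (cons_rV x y))) =
  (fun x => b * integral_Rn (fun y => f (cons_rV x y))
            + c * integral_Rn (fun y => g (cons_rV x y))).
  apply/funext => x; apply: IH; do ?exact: joint_measurable_slice;
  exact: compact_bounded_slice.
have fi := integrable_slice r0 mf cf; have gi := integrable_slice r0 mg cg.
have fb := integrableZl measurableT b fi; have gc := integrableZl measurableT c gi.
by rewrite (RintegralD measurableT fb gc) !RintegralZl.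
Qed.

End IntegralRn.

(** * The volume and the moments of balls and ellipsoids *)

Section SemicircleMoments.
Variable R : realType.
Implicit Types x : R.
Local Notation mu := (@lebesgue_measure R).

Lemma Rintegral_FTC (f F : R -> R) (a b : R) : a < b ->
  continuous f -> continuous F ->
  (forall x, a < x < b -> is_derive x 1 F (f x)) ->
  Rintegral mu `[a, b]%classic f = F b - F a.
Proof.
move=> ab cf cF dF; rewrite /Rintegral (@continuous_FTC2 _ f F) //.
- exact: continuous_subspaceT.
- split; last 2 first.
  + exact/cvg_at_right_filter/cF.
  + exact/cvg_at_left_filter/cF.
  by move=> x; rewrite in_itv /= => /dF [].
- by move=> x; rewrite in_itv /= => /dF h; rewrite derive1E derive_val.
Qed.

Lemma is_derive_expn (f : R -> R) n x (df : R) : is_derive x 1 f df ->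
  is_derive x 1 (fun y => f y ^+ n) (n%:R * f x ^+ n.-1 * df).
Proof. by move=> /(is_deriveX n); rewrite exprfctE. Qed.

Definition semicircle (x : R) : R := Num.sqrt (1 - x ^+ 2).

Lemma continuous_semicircle : continuous semicircle.
Proof.
move=> x; apply: (@continuous_comp _ _ _ (fun x : R => 1 - x ^+ 2) Num.sqrt).
  by apply: cvgB; [exact: cvg_cst|exact: exprn_continuous].
exact: sqrt_continuous.
Qed.

Definition semicircle_fun (i r : nat) (x : R) : R := x ^+ i * semicircle x ^+ r.

Lemma continuous_semicircle_fun i r : continuous (semicircle_fun i r).
Proof.
move=> x; apply: cvgM; first exact: exprn_continuous.
apply: (@continuous_comp _ _ _ semicircle (fun y => y ^+ r)).
  exact: continuous_semicircle.
exact: exprn_continuous.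
Qed.

Lemma semicircle_gt0 x : -1 < x < 1 -> 0 < semicircle x.
Proof. by move=> /andP[h1 h2]; rewrite sqrtr_gt0; nra. Qed.

Lemma sqr_semicircle x : -1 <= x <= 1 -> semicircle x ^+ 2 = 1 - x ^+ 2.
Proof. by move=> /andP[h1 h2]; rewrite sqr_sqrtr //; nra. Qed.

Lemma is_derive_semicircle x : -1 < x < 1 ->
  is_derive x 1 semicircle (- x / semicircle x).
Proof.
move=> x1; have s0 := semicircle_gt0 x1; have h : 0 < 1 - x ^+ 2 by rewrite -sqrtr_gt0.
have -> : - x / semicircle x = (2 * semicircle x)^-1 * (- (2 * x)).
  by field; rewrite gt_eqF.
have d1 : is_derive x 1 (fun x : R => 1 - x ^+ 2) (- (2 * x)).
  have := is_deriveB (is_derive_cst (1 : R) x 1) (is_derive_expn 2 (is_derive_id x 1)).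
  by rewrite expr1 mulr1 sub0r.
have := @is_derive1_comp _ Num.sqrt (fun x : R => 1 - x ^+ 2) x _ _ (is_derive1_sqrt h) d1.
by rewrite mulrC.
Qed.

Lemma is_derive_semicircle_fun k r x : -1 < x < 1 ->
  is_derive x 1 (semicircle_fun k r.+2)
   (k%:R * semicircle_fun k.-1 r.+2 x - r.+2%:R * semicircle_fun k.+1 r x).
Proof.
move=> x1; have ds := is_derive_semicircle x1.
have s0 := semicircle_gt0 x1.
have d2 : is_derive x 1 (fun y => semicircle y ^+ r.+2) (- r.+2%:R * x * semicircle x ^+ r).
  have -> : - r.+2%:R * x * semicircle x ^+ r =
      r.+2%:R * semicircle x ^+ r.+1 * (- x / semicircle x).
    by rewrite exprS; field; rewrite gt_eqF.
  exact: is_derive_expn.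
have d1 : is_derive x 1 (fun y : R => y ^+ k) (k%:R * x ^+ k.-1).
  by have := is_derive_expn k (is_derive_id x 1); rewrite mulr1.
have -> : k%:R * semicircle_fun k.-1 r.+2 x - r.+2%:R * semicircle_fun k.+1 r x =
    x ^+ k *: (- r.+2%:R * x * semicircle x ^+ r) + semicircle x ^+ r.+2 *: (k%:R * x ^+ k.-1).
  by rewrite /GRing.scale /= /semicircle_fun (exprS x k); ring.
exact: is_deriveM.
Qed.

(** The Beta integral of x^i (1 - x^2)^(r/2); the section of the unit ball at height x has radius
    [semicircle x]. *)
Definition semicircle_moment (i r : nat) : R :=
  Rintegral mu `[-1, 1]%classic (semicircle_fun i r).

Lemma integrable_continuous_itv (f : R -> R) (a b : R) : continuous f ->
  mu.-integrable `[a, b]%classic (EFin \o f).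
Proof.
move=> cf; apply: continuous_compact_integrable; first exact: segment_compact.
exact: continuous_subspaceT.
Qed.

(** The derivative of x^k (1 - x^2)^((r+2)/2) is integrated; this function vanishes at both ends. At
    k = 0 the factor [k%:R] cancels the term with the truncated exponent [k.-1]. *)
Let semicircle_parts k r :
  k%:R * semicircle_moment k.-1 r.+2 = r.+2%:R * semicircle_moment k.+1 r.
Proof.
have cf := continuous_semicircle_fun.
have m1 : measurable (`[(-1)%R, 1%R]%classic : set (measurableTypeR R)) by [].
pose f x := k%:R * semicircle_fun k.-1 r.+2 x - r.+2%:R * semicircle_fun k.+1 r x.
have cf' : continuous f.
  move=> x; apply: cvgB; apply: cvgM; try exact: cvg_cst; exact: cf.
have := @Rintegral_FTC f (semicircle_fun k r.+2) (-1) 1 ltac:(lra) cf' (cf _ _)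
  (fun x h => is_derive_semicircle_fun k r h).
have -> : semicircle_fun k r.+2 1 - semicircle_fun k r.+2 (-1) = 0.
  by rewrite /semicircle_fun /semicircle sqrrN !expr1n subrr sqrtr0 expr0n !mulr0 subrr.
have i1 := integrableZl m1 k%:R (integrable_continuous_itv (-1) 1 (cf k.-1 r.+2)).
have i2 := integrableZl m1 r.+2%:R (integrable_continuous_itv (-1) 1 (cf k.+1 r)).
rewrite /f (RintegralB m1 i1 i2) !RintegralZl //; try exact: integrable_continuous_itv.
by move/eqP; rewrite subr_eq0 => /eqP.
Qed.

Let semicircle_sqr i r :
  semicircle_moment i r.+2 = semicircle_moment i r - semicircle_moment i.+2 r.
Proof.
have cf := continuous_semicircle_fun.
have m1 : measurable (`[(-1)%R, 1%R]%classic : set (measurableTypeR R)) by [].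
have i1 := integrable_continuous_itv (-1) 1 (cf i r).
have i2 := integrable_continuous_itv (-1) 1 (cf i.+2 r).
rewrite /semicircle_moment -(RintegralB m1 i1 i2); apply: eq_Rintegral => x.
rewrite inE /= in_itv /= => /sqr_semicircle x1.
rewrite /semicircle_fun -[r.+2]addn2 -[i.+2]addn2 !exprD x1; ring.
Qed.

Lemma semicircle_momentSS i r :
  semicircle_moment i.+2 r * (i%:R + r%:R + 3) = (i%:R + 1) * semicircle_moment i r.
Proof.
have := semicircle_parts i.+1 r; rewrite /= semicircle_sqr.
rewrite -(natr1 i) -(natr1 r.+1) -(natr1 r); lra.
Qed.

Lemma semicircle_moment0SS r :
  semicircle_moment 0 r.+2 * (r%:R + 3) = (r%:R + 2) * semicircle_moment 0 r.
Proof.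
have := semicircle_momentSS 0 r; rewrite semicircle_sqr; lra.
Qed.

Lemma semicircle_moment_odd i r : odd i -> semicircle_moment i r = 0.
Proof.
elim/nat_ind2: i => // [_|i IH _ /=].
  have /esym/eqP := semicircle_parts 0 r; rewrite mul0r mulf_eq0 pnatr_eq0 /=.
  by move/eqP.
rewrite negbK => /IH i0; have /eqP := semicircle_momentSS i r.
rewrite i0 mulr0 mulf_eq0 => /orP[/eqP //|].
by rewrite gt_eqF // ltr_wpDl // addr_ge0.
Qed.

Lemma semicircle_moment00 : semicircle_moment 0 0 = 2.
Proof.
rewrite /semicircle_moment.
have d x : -1 < x < 1 -> is_derive x 1 (fun x => x) (semicircle_fun 0 0 x).
  by move=> _; rewrite /semicircle_fun !expr0 mulr1; exact: is_derive_id.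
have c2 : continuous (fun x => x) by move=> x; exact: cvg_id.
rewrite (Rintegral_FTC _ (@continuous_semicircle_fun 0 0) c2 d); first by ring.
lra.
Qed.

(** The antiderivative is (x s + asin x)/2 with s = sqrt(1 - x^2), where asin x is written 2 atan(x
    / (1 + s)) to be continuous up to the end points. *)
Lemma semicircle_moment01 : semicircle_moment 0 1 = pi / 2.
Proof.
pose u (x : R) := x / (1 + semicircle x).
pose F x := semicircle_fun 1 1 x / 2 + atan (u x).
have den x : 0 < 1 + semicircle x by rewrite ltr_pwDl ?sqrtr_ge0.
have cden : continuous (fun x => 1 + semicircle x).
  by move=> x; apply: cvgD; [exact: cvg_cst|exact: continuous_semicircle].
have cu : continuous u.
  move=> x; apply: cvgM; first exact: cvg_id.
  by apply: cvgV; [rewrite gt_eqF|exact: cden].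
have cF : continuous F.
  move=> x; apply: cvgD.
    by apply: cvgM; [exact: continuous_semicircle_fun|exact: cvg_cst].
  by apply: (@continuous_comp _ _ _ u atan); [exact: cu|exact: continuous_atan].
have dF x : -1 < x < 1 -> is_derive x 1 F (semicircle_fun 0 1 x).
  move=> x1; have s0 := semicircle_gt0 x1; have ds := is_derive_semicircle x1.
  have s2 : semicircle x ^+ 2 = 1 - x ^+ 2.
    by apply: sqr_semicircle; have /andP[/ltW -> /ltW ->] := x1.
  set s := semicircle x in s0 s2 *.
  have dd : is_derive x 1 (fun x => 1 + semicircle x) (- x / s).
    by rewrite -[- x / s]add0r; exact: is_deriveD.
  have dV : is_derive x 1 (fun x => (1 + semicircle x)^-1) (- (1 + s) ^- 2 *: (- x / s)).
    by apply: is_deriveV; rewrite gt_eqF.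
  have du : is_derive x 1 u (1 / (s * (1 + s))).
    have -> : 1 / (s * (1 + s)) = x *: (- (1 + s) ^- 2 *: (- x / s)) + (1 + s)^-1 *: 1.
      rewrite /GRing.scale /= mulr1.
      have -> : x * (- (1 + s) ^- 2 * (- x / s)) = (1 - s ^+ 2) / ((1 + s) ^+ 2 * s).
        by rewrite s2; field; rewrite !gt_eqF // addr_gt0.
      by field; rewrite !gt_eqF // addr_gt0.
    exact: is_deriveM.
  have da : is_derive x 1 (fun x => atan (u x)) (1 / (2 * s)).
    have := @is_derive1_comp _ atan u x _ _ (is_derive1_atan (u x)) du.
    suff -> : (1 + u x ^+ 2)^-1 * (1 / (s * (1 + s))) = 1 / (2 * s) by [].
    have -> : 1 + u x ^+ 2 = 2 / (1 + s).
      rewrite /u expr_div_n -/s.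
      have -> : x ^+ 2 = 1 - s ^+ 2 by rewrite s2; ring.
      by field; rewrite gt_eqF // addr_gt0.
    by field; rewrite !gt_eqF // addr_gt0.
  have dsf : is_derive x 1 (semicircle_fun 1 1) (x *: (- x / s) + s *: 1).
    have -> : semicircle_fun 1 1 = (fun x => x * semicircle x).
      by apply/funext => z; rewrite /semicircle_fun !expr1.
    exact: is_deriveM.
  have d1 : is_derive x 1 (fun x => semicircle_fun 1 1 x / 2)
      (semicircle_fun 1 1 x *: 0 + 2^-1 *: (x *: (- x / s) + s *: 1)).
    exact: is_deriveM.
  have -> : semicircle_fun 0 1 x = (semicircle_fun 1 1 x *: 0 + 2^-1 *: (x *: (- x / s) + s *: 1)) + 1 / (2 * s).
    rewrite /GRing.scale /= mulr0 mulr1 add0r {1}/semicircle_fun expr0 mul1r expr1 -/s.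
    have -> : x * (- x / s) = (s ^+ 2 - 1) / s by rewrite s2; field; rewrite gt_eqF.
    by field; rewrite gt_eqF.
  exact: is_deriveD.
rewrite /semicircle_moment (Rintegral_FTC _ (@continuous_semicircle_fun 0 1) cF dF); last lra.
rewrite /F /u /semicircle_fun /semicircle sqrrN !expr1n subrr sqrtr0 !expr1 !mulr0.
by rewrite addr0 !divr1 atanN atan1; field.
Qed.

End SemicircleMoments.

(** * The Gamma function at half-integers and the volume of the ball *)

Section GammaHalfInteger.
Variable R : realType.
Local Notation mu := (@lebesgue_measure R).
Implicit Types x : R.

Lemma cvg_integral_oy (g : R -> R) (b : nat -> R) :
  measurable_fun [set: measurableTypeR R] g -> (forall x, 0 <= g x) ->
  {homo b : m n / (m <= n)%N >-> m <= n} -> (forall x, exists n, x <= b n) ->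
  (fun n => \int[mu]_(x in `]0%R, b n]) (g x)%:E)%E @ \oo -->
  (\int[mu]_(x in `]0%R, +oo[) (g x)%:E)%E.
Proof.
move=> mg g0 b_homo b_unb.
have -> : `]0%R, +oo[%classic = \bigcup_n `]0%R, b n]%classic.
  apply/seteqP; split => x /=; rewrite in_itv /= ?andbT.
    by move=> x0; have [n xn] := b_unb x; exists n => //=; rewrite in_itv /= x0.
  by move=> [n _] /=; rewrite in_itv /= => /andP[].
apply: ge0_nondecreasing_set_cvg_integral => //.
- move=> m n mn; apply/subsetPset => x /=; rewrite !in_itv /= => /andP[-> h].
  exact: le_trans h (b_homo _ _ mn).
- by move=> i; apply/measurable_EFinP; exact: measurable_funS mg.
- by move=> i x _; rewrite lee_fin.
Qed.

Lemma integral_oc_fin (g : R -> R) (c : R) : continuous g ->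
  (\int[mu]_(x in `]0%R, c]) (g x)%:E = (Rintegral mu `[0%R, c]%classic g)%:E)%E.
Proof.
move=> cg; have gi := integrable_continuous_itv 0 c cg.
have gi' : mu.-integrable `]0, c]%classic (EFin \o g).
  by apply: integrableS gi => // x /=; rewrite !in_itv /= => /andP[/ltW -> ->].
by rewrite -Rintegral_itv_obnd_cbnd // /Rintegral fineK //; exact: integrable_fin_num.
Qed.

Lemma Rintegral_oy_lim (g : R -> R) (b : nat -> R) (L : R) :
  continuous g -> (forall x, 0 <= g x) ->
  {homo b : m n / (m <= n)%N >-> m <= n} -> (forall x, exists n, x <= b n) ->
  (fun n => Rintegral mu `[0, b n]%classic g) @ \oo --> L ->
  Rintegral mu `]0, +oo[%classic g = L.
Proof.
move=> cg g0 b_homo b_unb gL.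
have := cvg_integral_oy (continuous_measurable_fun cg) g0 b_homo b_unb.
under eq_fun do rewrite (integral_oc_fin _ cg).
move=> h; rewrite /Rintegral.
have h2 : (fun n => (Rintegral mu `[0%R, b n]%classic g)%:E) @ \oo --> L%:E.
  by apply/fine_cvgP; split; [exact: nearW|exact: gL].
by rewrite (cvg_unique (@ereal_hausdorff R) h h2).
Qed.

Let gm (m : nat) (t : R) : R := t ^+ m * expR (- t ^+ 2).
Let J (m n : nat) : R := Rintegral mu `[0, n%:R]%classic (gm m).

Let c_gauss : continuous (fun t : R => expR (- t ^+ 2)).
Proof. exact: continuous_gauss_fun. Qed.

Let cgm m : continuous (gm m).
Proof. by move=> t; apply: cvgM; [exact: exprn_continuous|exact: c_gauss]. Qed.

Let is_derive_gm m (t : R) :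
  is_derive t 1 (fun t => t ^+ m * expR (- t ^+ 2)) (m%:R * gm m.-1 t - 2 * gm m.+1 t).
Proof.
have d1 : is_derive t 1 (fun t : R => t ^+ m) (m%:R * t ^+ m.-1).
  by have := is_derive_expn m (is_derive_id t 1); rewrite mulr1.
have d2 : is_derive t 1 (fun t : R => - t ^+ 2) (- (2 * t)).
  by have := is_deriveN (is_derive_expn 2 (is_derive_id t 1)); rewrite mulr1 expr1.
have d3 : is_derive t 1 (fun t : R => expR (- t ^+ 2)) (expR (- t ^+ 2) * (- (2 * t))).
  exact: (@is_derive1_comp _ expR (fun t : R => - t ^+ 2) t _ _ (is_derive_expR _) d2).
have -> : m%:R * gm m.-1 t - 2 * gm m.+1 t =
  t ^+ m *: (expR (- t ^+ 2) * (- (2 * t))) + expR (- t ^+ 2) *: (m%:R * t ^+ m.-1).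
  by rewrite /gm /GRing.scale /= (exprS t m); ring.
exact: is_deriveM.
Qed.

Let J_parts m n : (0 < n)%N ->
  m%:R * J m.-1 n - 2 * J m.+1 n = gm m n%:R - gm m 0.
Proof.
move=> n0; have nR : 0 < n%:R :> R by rewrite ltr0n.
have m1 : measurable (`[0%R, n%:R]%classic : set (measurableTypeR R)) by [].
pose f t := m%:R * gm m.-1 t - 2 * gm m.+1 t.
have cf : continuous f.
  move=> t; apply: cvgB; apply: cvgM; try exact: cvg_cst; exact: cgm.
have <- := @Rintegral_FTC _ f (gm m) 0 n%:R nR cf (@cgm m) (fun t _ => is_derive_gm m t).
have i1 := integrableZl m1 m%:R (integrable_continuous_itv 0 n%:R (@cgm m.-1)).
have i2 := integrableZl m1 2 (integrable_continuous_itv 0 n%:R (@cgm m.+1)).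
by rewrite /f (RintegralB m1 i1 i2) !RintegralZl //; exact: integrable_continuous_itv.
Qed.

Let gm_lim m : (fun n : nat => gm m n%:R) @ \oo --> (0 : R).
Proof.
apply: (@squeeze_cvgr _ _ _ _ (fun=> 0) (fun n : nat => (2 * m.+1`!%:R) * (n.+1%:R)^-1)).
- near=> n; have n1 : (0 < n)%N by near: n; exists 1%N.
  have n0 : 1 <= n%:R :> R by rewrite ler1n.
  have f0 : 0 < m.+1`!%:R :> R by rewrite ltr0n fact_gt0.
  rewrite /gm mulr_ge0 ?expR_ge0 ?exprn_ge0 //= expRN.
  rewrite ler_pdivrMr ?expR_gt0 // mulrAC ler_pdivlMr ?ltr0n //.
  have h : n%:R ^+ m.+1 <= m.+1`!%:R * expR (n%:R ^+ 2) :> R.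
    have := expR_ge1Dxn m (sqr_ge0 (n%:R : R)); rewrite -(ler_pM2l f0).
    apply: le_trans; rewrite mulrDr mulrCA mulfV ?gt_eqF // !mulr1 -exprM.
    apply: (@le_trans _ _ (n%:R ^+ (2 * m.+1))); last by rewrite lerDr ltW.
    by rewrite ler_weXn2l //; lia.
  apply: (@le_trans _ _ (2 * n%:R ^+ m.+1)); last by rewrite -mulrA ler_pM2l.
  rewrite exprSr mulrCA ler_wpM2l ?exprn_ge0 //; rewrite -natr1; lra.
- exact: cvg_cst.
- rewrite -[X in _ --> X](mulr0 (2 * m.+1`!%:R)).
  by apply: cvgM; [exact: cvg_cst|exact: cvg_harmonic].
Unshelve. all: by end_near. Qed.

(** The integral of t^m exp(-t^2) over the half-line, through its recursion by parts; the value at 0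
    is the Gauss integral. *)
Definition half_gauss_moment : nat -> R := fix F m :=
  match m with
  | 0 => Num.sqrt pi / 2
  | 1 => 1 / 2
  | (k.+1 as m').+1 => (k%:R + 1) / 2 * F k
  end.

Let J_lim m : J m @ \oo --> half_gauss_moment m.
Proof.
elim/nat_ind2: m => [||m IH _].
- have := @ge0_cvgn_integral R mu _ (@gauss_fun_ge0 R) (@measurable_gauss_fun R).
  rewrite integral0y_gauss => h.
  have : (fun n => (J 0 n)%:E) @ \oo --> (Num.sqrt pi / 2 : R)%:E.
    apply: cvg_trans h; apply: near_eq_cvg; near=> n.
    rewrite /J /Rintegral fineK; last first.
      apply: integrable_fin_num => //; exact: integrable_continuous_itv.
    by apply: eq_integral => x _; rewrite /gm expr0 mul1r.
  by move/fine_cvgP => [_]; apply.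
- have -> : half_gauss_moment 1 = (gm 0 0 - 0) / 2.
    have -> : gm 0 0 = 1 by rewrite /gm expr0 expr0n /= oppr0 expR0 mul1r.
    by rewrite /= subr0.
  have : (fun n : nat => (gm 0 0 - gm 0 n%:R) / 2) @ \oo --> (gm 0 0 - 0) / 2.
    by apply: cvgM; [apply: cvgB; [exact: cvg_cst|exact: gm_lim]|exact: cvg_cst].
  apply: cvg_trans; apply: near_eq_cvg; near=> n.
  have n0 : (0 < n)%N by near: n; exists 1%N.
  by have := J_parts 0 n0; rewrite mul0r sub0r; lra.
have -> : half_gauss_moment m.+2 = ((m%:R + 1) * half_gauss_moment m - 0 + gm m.+1 0) / 2.
  have -> : gm m.+1 0 = 0 by rewrite /gm expr0n mul0r.
  by rewrite /= subr0 addr0; ring.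
have : (fun n : nat => ((m%:R + 1) * J m n - gm m.+1 n%:R + gm m.+1 0) / 2) @ \oo -->
    ((m%:R + 1) * half_gauss_moment m - 0 + gm m.+1 0) / 2.
  apply: cvgM; last exact: cvg_cst.
  apply: cvgD; last exact: cvg_cst.
  apply: cvgB; last exact: gm_lim.
  by apply: cvgM; [exact: cvg_cst|exact: IH].
apply: cvg_trans; apply: near_eq_cvg; near=> n.
have n0 : (0 < n)%N by near: n; exists 1%N.
by have := J_parts m.+1 n0; rewrite -natr1 /=; lra.
Unshelve. all: by end_near. Qed.

(** The substitution x = t^2 gives 2 t^(d+1) exp(-t^2); exhausting the half-line by [0, n^2] makes
    it an exhaustion by [0, n] in t. *)
Lemma Gamma_half (d : nat) :
  Gamma_fn (d%:R / 2 + 1 : R) = 2 * half_gauss_moment d.+1.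
Proof.
pose g x := Num.sqrt x ^+ d * expR (- x).
have cg : continuous g.
  move=> x; apply: cvgM.
    apply: (@continuous_comp _ _ _ (@Num.sqrt R) (fun y => y ^+ d)).
      exact: sqrt_continuous.
    exact: exprn_continuous.
  apply: (@continuous_comp _ _ _ (fun y : R => - y) expR).
    by apply: cvgN; exact: cvg_id.
  exact: continuous_expR.
have -> : Gamma_fn (d%:R / 2 + 1 : R) = Rintegral mu `]0, +oo[%classic g.
  apply: eq_Rintegral => x; rewrite inE /= in_itv /= andbT => x0.
  rewrite addrK /g; congr (_ * _).
  by rewrite mulrC powRrM powR12_sqrt ?ltW // powR_mulrn ?sqrtr_ge0.
apply: (@Rintegral_oy_lim _ (fun n => n%:R ^+ 2)) => //.
- by move=> x; rewrite mulr_ge0 ?expR_ge0 ?exprn_ge0 ?sqrtr_ge0.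
- by move=> m n mn; rewrite lerXn2r ?nnegrE ?ler_nat.
- move=> x; exists (Num.truncn `|x|).+1.
  have h : x <= (Num.truncn `|x|).+1%:R.
    exact: le_trans (ler_norm x) (ltW (truncnS_gt _)).
  apply: (le_trans h); rewrite expr2 ler_peMr ?ler1n //.
have -> : (fun n : nat => Rintegral mu `[0, n%:R ^+ 2]%classic g) = (fun n => 2 * J d.+1 n).
  apply/funext => n.
  have dsq x : is_derive x 1 (fun t : R => t ^+ 2) (2 * x).
    by have := is_derive_expn 2 (is_derive_id x 1); rewrite mulr1 expr1.
  have dsqE : derive1 (fun t : R => t ^+ 2) = (fun t => 2 * t).
    by apply/funext => x; rewrite derive1E; have [_ ->] := dsq x.
  have cdsq : continuous (fun t : R => 2 * t).
    by move=> t; apply: cvgM; [exact: cvg_cst|exact: cvg_id].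
  have csq : continuous (fun t : R => t ^+ 2) by exact: exprn_continuous.
  have := @integration_by_substitution_increasing R (fun t => t ^+ 2) g 0 n%:R (ler0n _ _).
  rewrite expr0n /= dsqE => h.
  rewrite /Rintegral h; last 6 first.
  - move=> x y; rewrite !in_itv /= => /andP[x0 _] /andP[y0 _] xy.
    by rewrite ltr_pXn2r // nnegrE.
  - by move=> x _; exact: cdsq.
  - by apply: cvgP; exact/cvg_at_right_filter/cdsq.
  - by apply: cvgP; exact/cvg_at_left_filter/cdsq.
  - split.
    + by move=> x _; have [] := dsq x.
    + exact/cvg_at_right_filter/csq.
    + exact/cvg_at_left_filter/csq.
  - exact: continuous_subspaceT.
  have -> : (\int[mu]_(x in `[0%R, n%:R]) (((g \o (fun t => t ^+ 2)) * (fun t => 2 * t)) x)%:E)%E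
     = (\int[mu]_(x in `[0%R, n%:R]) (2 * gm d.+1 x)%:E)%E.
    apply: eq_integral => x; rewrite inE /= in_itv /= => /andP[x0 _].
    congr EFin; transitivity (g (x ^+ 2) * (2 * x)); first by [].
    by rewrite /g sqrtr_sqr ger0_norm // /gm (exprS x d); ring.
  rewrite -/(Rintegral mu _ (fun x => 2 * gm d.+1 x)) RintegralZl //.
  exact: integrable_continuous_itv.
by apply: cvgM; [exact: cvg_cst|exact: J_lim].
Qed.

(** Slicing: the section of the unit ball of dimension i + 1 at height x is a ball of dimension i
    and radius sqrt(1 - x^2). *)
Definition ball_volume (n : nat) : R := \prod_(i < n) semicircle_moment R 0 i.

(** Wallis's relation: the left side does not depend on n. Two dimensions at a time, the volume is
    thus multiplied by 2 pi / (n + 2), matching the recursion of Gamma. *)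
Lemma semicircle_moment_mul n :
  semicircle_moment R 0 n * semicircle_moment R 0 n.+1 * (n%:R + 2) = 2 * pi.
Proof.
elim: n => [|n IH].
  by rewrite semicircle_moment00 semicircle_moment01; field.
rewrite -IH -(natr1 n).
transitivity (semicircle_moment R 0 n.+1 * (semicircle_moment R 0 n.+2 * (n%:R + 3))).
  by ring.
by rewrite semicircle_moment0SS; ring.
Qed.

Lemma ball_volume_Gamma (d : nat) :
  ball_volume d * Gamma_fn (d%:R / 2 + 1 : R) = pi `^ (d%:R / 2).
Proof.
have sp : 0 < Num.sqrt pi :> R by rewrite sqrtr_gt0 pi_gt0.
have -> : pi `^ (d%:R / 2) = Num.sqrt pi ^+ d :> R.
  by rewrite mulrC powRrM powR12_sqrt ?pi_ge0 // powR_mulrn // ltW.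
rewrite Gamma_half; elim/nat_ind2: d => [||n IH _].
- by rewrite /ball_volume big_ord0 /= expr0; field.
- by rewrite /ball_volume big_ord_recr big_ord0 /= semicircle_moment00 expr1; field.
have -> : ball_volume n.+2 =
    ball_volume n * semicircle_moment R 0 n * semicircle_moment R 0 n.+1.
  by rewrite /ball_volume !big_ord_recr.
have -> : half_gauss_moment n.+3 = (n%:R + 2) / 2 * half_gauss_moment n.+1.
  have -> : half_gauss_moment n.+3 = (n.+1%:R + 1) / 2 * half_gauss_moment n.+1 by [].
  by rewrite -(natr1 n); ring.
have -> : Num.sqrt pi ^+ n.+2 = pi * Num.sqrt pi ^+ n :> R.
  by rewrite -addn2 exprD sqr_sqrtr ?pi_ge0 // mulrC.
rewrite -IH; set H := half_gauss_moment n.+1.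
transitivity ((semicircle_moment R 0 n * semicircle_moment R 0 n.+1 * (n%:R + 2))
   * (ball_volume n * H)); first by field.
by rewrite semicircle_moment_mul; ring.
Qed.

End GammaHalfInteger.

(** * Bounded measurable functions of compact support and triangular changes of variables *)

Section NiceFunctions.
Variable R : realType.
Local Notation mu := (@lebesgue_measure R).

Definition nice (n : nat) (f : 'rV[R]_n -> R) : Prop :=
  joint_measurable (fun _ : unit => f) /\
  exists M r : R, 0 <= r /\ compact_bounded M r f.

Lemma compact_bounded_le n (f : 'rV[R]_n -> R) M r M' r' : M <= M' -> r <= r' ->
  compact_bounded M r f -> compact_bounded M' r' f.
Proof.
move=> MM rr [h1 h2]; split=> [y|y i ri]; first exact: le_trans (h1 y) MM.
by apply: (h2 _ i); exact: le_lt_trans rr ri.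
Qed.

Lemma nice_common n (f g : 'rV[R]_n -> R) : nice f -> nice g ->
  exists M r, [/\ 0 <= r, compact_bounded M r f & compact_bounded M r g].
Proof.
move=> [_ [M [r [r0 h]]]] [_ [M' [r' [r'0 h']]]].
exists (Num.max M M'), (Num.max r r'); split.
- by rewrite le_max r0.
- by apply: compact_bounded_le h; rewrite le_max lexx.
- by apply: compact_bounded_le h'; rewrite le_max lexx orbT.
Qed.

Lemma nice_lin n (f g : 'rV[R]_n -> R) b c : nice f -> nice g ->
  nice (fun y => b * f y + c * g y).
Proof.
move=> nf ng; have [M [r [r0 [f1 f2] [g1 g2]]]] := nice_common nf ng.
split.
  move=> dd Q h e mh me; apply: measurable_funD; apply: measurable_funM => //.
    exact: (nf.1 _ Q h e mh me).
  exact: (ng.1 _ Q h e mh me).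
exists (`|b| * M + `|c| * M), r; split=> //; split=> [y|y i ri].
  by rewrite (le_trans (ler_normD _ _)) // !normrM lerD // ler_wpM2l.
by rewrite (f2 y i) // (g2 y i) // !mulr0 addr0.
Qed.

Lemma nice0 n : nice (fun _ : 'rV[R]_n => 0).
Proof.
split; first by move=> dd Q h e mh me; exact: measurable_cst.
by exists 0, 0; split=> //; split=> // y; rewrite normr0.
Qed.

Lemma nice_integral_lin n (f g : 'rV[R]_n -> R) b c : nice f -> nice g ->
  integral_Rn (fun y => b * f y + c * g y) = b * integral_Rn f + c * integral_Rn g.
Proof.
move=> nf ng; have [M [r [r0 cf cg]]] := nice_common nf ng.
exact: integral_Rn_lin r0 nf.1 cf ng.1 cg.
Qed.

Lemma nice_sum n m (F : nat -> 'rV[R]_n -> R) (b : nat -> R) :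
  (forall i, (i < m)%N -> nice (F i)) -> nice (fun y => \sum_(i < m) b i * F i y).
Proof.
elim: m => [|m IH] nF.
  by under eq_fun do rewrite big_ord0; exact: nice0.
have -> : (fun y => \sum_(i < m.+1) b i * F i y) =
    (fun y => 1 * (\sum_(i < m) b i * F i y) + b m * F m y).
  by apply/funext => y; rewrite big_ord_recr mul1r.
by apply: nice_lin; [apply: IH => i im; apply: nF; exact: ltnW|exact: nF].
Qed.

Lemma nice_integral_sum n m (F : nat -> 'rV[R]_n -> R) (b : nat -> R) :
  (forall i, (i < m)%N -> nice (F i)) ->
  integral_Rn (fun y => \sum_(i < m) b i * F i y) = \sum_(i < m) b i * integral_Rn (F i).
Proof.
elim: m => [|m IH] nF.
  by rewrite big_ord0; apply: integral_Rn0 => y; rewrite big_ord0.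
have -> : (fun y => \sum_(i < m.+1) b i * F i y) =
    (fun y => 1 * (\sum_(i < m) b i * F i y) + b m * F m y).
  by apply/funext => y; rewrite big_ord_recr mul1r.
rewrite nice_integral_lin.
- by rewrite mul1r IH ?big_ord_recr // => i im; apply: nF; exact: ltnW.
- by apply: nice_sum => i im; apply: nF; exact: ltnW.
- exact: nF.
Qed.

Lemma nice_slice n (f : 'rV[R]_n.+1 -> R) x : nice f -> nice (fun y => f (cons_rV x y)).
Proof.
move=> [mf [M [r [r0 cf]]]]; split; first exact: joint_measurable_slice.
by exists M, r; split=> //; exact: compact_bounded_slice.
Qed.

(** For upper triangular L the first coordinate of z L involves only z_0, and the others see z_0 as
    a translation, here [c']. Each variable therefore undergoes a one-dimensional affine
    substitution, in the order of the iterated integral. *)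
Lemma integral_Rn_affine n (L : 'M[R]_n) (c : 'rV[R]_n) (f : 'rV[R]_n -> R) :
  (forall i j : 'I_n, (j < i)%N -> L i j = 0) -> (forall i, 0 < L i i) -> nice f ->
  integral_Rn f = (\prod_i L i i) * integral_Rn (fun z => f (c + z *m L)).
Proof.
elim: n L c f => [|n IH] L c f Ltri Lpos nf.
  by rewrite big_ord0 mul1r /=; congr f; apply/rowP => -[].
set l := L ord0 ord0; have l0 : 0 < l by exact: Lpos.
pose L' := \matrix_(i, j) L (lift ord0 i) (lift ord0 j).
pose c' (z0 : R) := \row_j (c 0 (lift ord0 j) + z0 * L ord0 (lift ord0 j)).
have L'tri (i j : 'I_n) : (j < i)%N -> L' i j = 0.
  by move=> ji; rewrite mxE Ltri // !lift0 ltnS.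
have L'pos i : 0 < L' i i by rewrite mxE.
pose P := \prod_i L' i i.
pose F x := integral_Rn (fun y => f (cons_rV x y)).
have [mf [M [r [r0 cf]]]] := nf.
have mF : measurable_fun [set: measurableTypeR R] F by exact: integral_Rn_measurable_slice.
have FM x : `|F x| <= M * (2 * r) ^+ n.
  apply: integral_Rn_bound => //; first exact: joint_measurable_slice.
  exact: compact_bounded_slice.
have F0 x : r < `|x| -> F x = 0.
  by move=> rx; apply: integral_Rn0 => y; apply: (cf.2 _ ord0); rewrite cons_rV0.
have Fi := integrable_compact mF FM F0.
pose G z0 := integral_Rn (fun z' => f (c + cons_rV z0 z' *m L)).
have FG z0 : F (l * z0 + c 0 ord0) = P * G z0.
  rewrite /F (IH L' (c' z0) _ L'tri L'pos); last exact: nice_slice.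
  congr (_ * _); congr integral_Rn; apply/funext => z'; congr f.
  apply/rowP => j; rewrite [RHS]mxE [in RHS]mxE big_ord_recl cons_rV0.
  case: (unliftP ord0 j) => [i ->|->].
    rewrite cons_rVS !mxE -addrA; congr (_ + (_ + _)).
    by apply: eq_bigr => k _; rewrite cons_rVS mxE.
  rewrite cons_rV0 big1 ?addr0; last by move=> k _; rewrite Ltri ?mulr0.
  by rewrite addrC mulrC.
have P0 : 0 < P by apply: prodr_gt0.
have GE z0 : G z0 = P^-1 * F (l * z0 + c 0 ord0) by rewrite FG mulKf ?gt_eqF.
rewrite integral_RnS (Rintegral_affine (c 0 ord0) l0 mF Fi) big_ord_recl -/l.
have -> : \prod_(i < n) L (lift ord0 i) (lift ord0 i) = P.
  by apply: eq_bigr => i _; rewrite mxE.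
rewrite integral_RnS -mulrA; congr (_ * _).
under eq_Rintegral do rewrite FG.
have mT : measurable_fun setT (fun x : measurableTypeR R => l * x + c 0 ord0 : measurableTypeR R).
  by apply: measurable_funD => //; exact: measurable_funM.
have mG : measurable_fun [set: measurableTypeR R] G.
  by rewrite (funext GE); apply: measurable_funM => //; exact: measurableT_comp mF mT.
rewrite RintegralZl //.
apply: (@integrable_compact _ _ (P^-1 * (M * (2 * r) ^+ n)) ((r + `|c 0 ord0|) / l)) => //.
- by move=> x; rewrite GE normrM gtr0_norm ?invr_gt0 // ler_pM2l ?invr_gt0.
- move=> x; rewrite ltr_pdivrMr // => rx; rewrite GE F0 ?mulr0 //.
  have := lerB_normD (l * x) (c 0 ord0); rewrite normrM (gtr0_norm l0); lra.
Qed.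

End NiceFunctions.

(** * Moments of linear forms on the ball, by slicing *)

Section BallMoments.
Variable R : realType.
Local Notation mu := (@lebesgue_measure R).
Local Notation T := (semicircle_moment R).

Let coef (n j : nat) : R := \prod_(i < j) ((2 * i%:R + 2) * (2 * i%:R + n%:R + 2))^-1.

Let coefS n j : coef n j.+1 = coef n j / ((2 * j%:R + 2) * (2 * j%:R + n%:R + 2)).
Proof. by rewrite /coef big_ord_recr. Qed.

Let ball_moment_even n s j : ball_moment (n%:R / 2) s (2 * j) = s ^+ j * coef n j.
Proof.
rewrite /ball_moment mul2n odd_double doubleK.
elim: j => [|j IH]; first by rewrite /coef !big_ord0 expr0 mul1r.
rewrite big_ord_recr /= IH coefS (exprS s j).
have j0 : 0 <= j%:R :> R by []; have n0 : 0 <= n%:R :> R by [].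
by field; nonzero.
Qed.

Let ball_moment_odd (b s : R) m : odd m -> ball_moment b s m = 0.
Proof. by rewrite /ball_moment => ->. Qed.

(** The Beta identity that restores binomial coefficients after a slice is integrated. It is proved
    by induction on p, raising the power of x, and for p = 0 by induction on j, raising the power of
    the radius. *)
Let beta_coef n p j : T (2 * p) (n + 2 * j) / ((2 * p)`!)%N%:R * coef n j =
  T 0 n * coef n.+1 (p + j) * 'C(p + j, j)%:R.
Proof.
have n0 : 0 <= n%:R :> R by [].
elim: p => [|p IH].
  rewrite muln0 fact0 divr1 add0n binn mulr1.
  elim: j => [|j IHj]; first by rewrite muln0 addn0 /coef !big_ord0.
  have j0 : 0 <= j%:R :> R by [].
  have h := semicircle_moment0SS R (n + 2 * j).
  have -> : (n + 2 * j.+1 = (n + 2 * j).+2)%N by lia.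
  have den : 0 < (n + 2 * j)%N%:R + 3 :> R by rewrite ltr_wpDl.
  have -> : T 0 (n + 2 * j).+2 = ((n + 2 * j)%N%:R + 2) * T 0 (n + 2 * j) / ((n + 2 * j)%N%:R + 3).
    by rewrite -h mulfK // gt_eqF.
  rewrite !coefS [RHS]mulrA -IHj natrD natrM -(natr1 n).
  by field; nonzero.
have h := semicircle_momentSS R (2 * p) (n + 2 * j).
have -> : (2 * p.+1 = (2 * p).+2)%N by lia.
have den : 0 < (2 * p)%N%:R + (n + 2 * j)%N%:R + 3 :> R by rewrite ltr_wpDl // addr_ge0.
have -> : T (2 * p).+2 (n + 2 * j) =
    ((2 * p)%N%:R + 1) * T (2 * p) (n + 2 * j) / ((2 * p)%N%:R + (n + 2 * j)%N%:R + 3).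
  by rewrite -h mulfK // gt_eqF.
have f0 : 0 < ((2 * p)`!)%N%:R :> R by rewrite ltr0n fact_gt0.
have p0 : 0 <= p%:R :> R by []; have j0 : 0 <= j%:R :> R by [].
have binE : 'C(p.+1 + j, j)%:R = 'C(p + j, j)%:R * ((p%:R + j%:R + 1) / (p%:R + 1)) :> R.
  have := mul_bin_diag (p + j)%N.+1 j; have := mul_bin_down (p + j)%N.+1 j.
  rewrite addSn /= => /(congr1 (fun k => k%:R : R)).
  rewrite subSn ?leq_addl // addnK !natrM -(natr1 p) -(natr1 (p + j)%N) natrD => h1 _.
  have p1 : p%:R + 1 != 0 :> R by nonzero.
  by apply: (mulfI p1); rewrite -h1; field.
rewrite addSn coefS binE !factS !(natrM _ (2 * p).+2) !(natrM _ (2 * p).+1).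
rewrite -(natr1 (2 * p).+1) -(natr1 (2 * p)) (natrD _ n) !(natrM _ 2) (natrD _ p) -(natr1 n).
transitivity (T (2 * p) (n + 2 * j) / ((2 * p)`!)%N%:R * coef n j *
   ((2 * p%:R + 2) * (2 * p%:R + n%:R + 2 * j%:R + 3))^-1).
  by field; nonzero.
by rewrite IH; field; nonzero.
Qed.

(** The test on x is essential for r = 0: the square root of a negative number is 0 by convention,
    and 0^0 = 1. *)
Definition slice_fun (rho : R) (p r : nat) (x : R) : R :=
  if x ^+ 2 <= rho then x ^+ p * Num.sqrt (rho - x ^+ 2) ^+ r else 0.

Lemma measurable_slice_fun rho p r :
  measurable_fun [set: measurableTypeR R] (slice_fun rho p r).
Proof.
apply: measurable_fun_ifT => //.
- by apply: measurable_fun_ler => //; exact: measurable_funX.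
- apply: measurable_funM; first exact: measurable_funX.
  apply: measurable_funX; apply: continuous_measurable_fun => x.
  apply: (@continuous_comp _ _ _ (fun x : R => rho - x ^+ 2) Num.sqrt).
    by apply: cvgB; [exact: cvg_cst|exact: exprn_continuous].
  exact: sqrt_continuous.
Qed.

Let slice_fun_bound rho p r x : 0 <= rho ->
  `|slice_fun rho p r x| <= Num.sqrt rho ^+ (p + r).
Proof.
move=> rho0; rewrite /slice_fun; case: ifP => h; last first.
  by rewrite normr0 exprn_ge0 ?sqrtr_ge0.
rewrite normrM !normrX exprD ler_pM ?exprn_ge0 //.
  by rewrite lerXn2r ?nnegrE ?sqrtr_ge0 // -sqrtr_sqr ler_sqrt.
rewrite lerXn2r ?nnegrE ?sqrtr_ge0 // ger0_norm ?sqrtr_ge0 // ler_sqrt //.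
by rewrite lerBlDr lerDl sqr_ge0.
Qed.

Let slice_fun_out rho p r x : 0 <= rho -> Num.sqrt rho < `|x| -> slice_fun rho p r x = 0.
Proof.
move=> rho0; rewrite /slice_fun -sqrtr_sqr ltNge; case: ifP => // h /negP[].
by rewrite ler_sqrt.
Qed.

Lemma integrable_slice_fun rho p r : 0 <= rho ->
  mu.-integrable setT (EFin \o slice_fun rho p r).
Proof.
move=> rho0; apply: (@integrable_compact _ _ (Num.sqrt rho ^+ (p + r)) (Num.sqrt rho)).
- exact: measurable_slice_fun.
- by move=> x; exact: slice_fun_bound.
- by move=> x; exact: slice_fun_out.
Qed.

Lemma Rintegral_slice_fun rho p r : 0 <= rho ->
  Rintegral mu setT (slice_fun rho p r) = Num.sqrt rho ^+ (p + r).+1 * T p r.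
Proof.
rewrite le_eqVlt => /predU1P[<-|rho0].
  rewrite sqrtr0 expr0n mul0r.
  have -> : slice_fun 0 p r = (slice_fun 0 p r) \_ [set 0].
    apply/funext => x; rewrite patchE; case: ifPn => // /negP h.
    rewrite /slice_fun; case: ifP => // x0; exfalso; apply: h; rewrite inE /=.
    by apply/eqP; rewrite -sqrf_eq0 eq_le x0 sqr_ge0.
  by rewrite -Rintegral_mkcond Rintegral_set1.
have s0 : 0 < Num.sqrt rho by rewrite sqrtr_gt0.
have mf := measurable_slice_fun rho p r.
have fi := integrable_slice_fun p r (ltW rho0).
rewrite (Rintegral_affine 0 s0 mf fi) exprS -mulrA; congr (_ * _).
have E x : slice_fun rho p r (Num.sqrt rho * x + 0) =
    Num.sqrt rho ^+ (p + r) * slice_fun 1 p r x.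
  have sq : (Num.sqrt rho * x) ^+ 2 = rho * x ^+ 2 by rewrite exprMn sqr_sqrtr // ltW.
  rewrite /slice_fun addr0 sq.
  have -> : (rho * x ^+ 2 <= rho) = (x ^+ 2 <= 1) by rewrite -[leRHS]mulr1 ler_pM2l.
  case: ifP => h; last by rewrite mulr0.
  have -> : rho - rho * x ^+ 2 = rho * (1 - x ^+ 2) by ring.
  by rewrite sqrtrM ?ltW // !exprMn exprD; ring.
have i1 := integrable_slice_fun p r ler01.
under eq_Rintegral do rewrite E.
rewrite RintegralZl //; congr (_ * _).
rewrite /semicircle_moment [RHS]Rintegral_mkcond; apply: eq_Rintegral => x _.
rewrite /slice_fun patchE /semicircle_fun /semicircle.
have -> : (x \in `[(-1), 1]%classic) = (x ^+ 2 <= 1).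
  apply/idP/idP; rewrite inE /= in_itv /=; first by move=> /andP[h1 h2]; nra.
  by move=> h; apply/andP; split; nra.
by [].
Qed.

Definition sq_norm (n : nat) (z : 'rV[R]_n) : R := \sum_i z 0 i ^+ 2.
Definition dot (n : nat) (h z : 'rV[R]_n) : R := \sum_i h 0 i * z 0 i.

Definition ball_fun (n : nat) (h : 'rV[R]_n) (rho : R) (k : nat) (z : 'rV[R]_n) : R :=
  dot h z ^+ k / k`!%:R * (if sq_norm z <= rho then 1 else 0).

Lemma sq_norm_ge0 n (z : 'rV[R]_n) : 0 <= sq_norm z.
Proof. by apply: sumr_ge0 => i _; exact: sqr_ge0. Qed.

Lemma sq_norm_coord n (z : 'rV[R]_n) i : z 0 i ^+ 2 <= sq_norm z.
Proof.
by rewrite /sq_norm (bigD1 i) //= lerDl sumr_ge0 // => j _; exact: sqr_ge0.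
Qed.

Lemma nice_ball_fun n (h : 'rV[R]_n) rho k : nice (ball_fun h rho k).
Proof.
split.
  move=> dd Q g e mg me; rewrite /ball_fun /dot /sq_norm.
  apply: measurable_funM.
    apply: measurable_funM => //; apply: measurable_funX.
    apply: measurable_sum => i; apply: measurable_funM => //.
    by under eq_fun do rewrite mxE; exact: me.
  apply: measurable_fun_ifT => //; apply: measurable_fun_ler => //.
  apply: measurable_sum => i; apply: measurable_funX.
  by under eq_fun do rewrite mxE; exact: me.
have [rho0|rho0] := ltP rho 0.
  have out (y : 'rV[R]_n) : (sq_norm y <= rho) = false.
    by apply/negbTE; rewrite -ltNge (lt_le_trans rho0 (sq_norm_ge0 y)).
  by exists 0, 0; split=> //; split=> [y|y i _]; rewrite /ball_fun out mulr0 ?normr0.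
have coord (y : 'rV[R]_n) i : sq_norm y <= rho -> `|y 0 i| <= Num.sqrt rho.
  move=> yr; rewrite -sqrtr_sqr ler_sqrt //.
  exact: le_trans (sq_norm_coord y i) yr.
exists ((\sum_i `|h 0 i| * Num.sqrt rho) ^+ k / k`!%:R), (Num.sqrt rho).
split; first exact: sqrtr_ge0.
split=> [y|y i].
  rewrite /ball_fun normrM; case: ifP => yr; last first.
    by rewrite normr0 mulr0 mulr_ge0 ?invr_ge0 // exprn_ge0 // sumr_ge0.
  rewrite normr1 mulr1 normrM normrX normfV (ger0_norm (ler0n _ _)).
  rewrite ler_wpM2r ?invr_ge0 // lerXn2r ?nnegrE ?sumr_ge0 //.
  apply: (le_trans (ler_norm_sum _ _ _)); apply: ler_sum => i _.
  by rewrite normrM ler_wpM2l // coord.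
rewrite /ball_fun; case: ifP => [yr|_]; last by rewrite mulr0.
by rewrite ltNge coord.
Qed.

(** At height x the form is h0 x plus a form on a ball of squared radius rho - x^2. Expanding in
    divided powers and integrating over x leaves the even indices only, which [beta_coef] and the
    binomial theorem recombine into a power of h0^2 + |h'|^2. *)
Lemma integral_ball_fun n (h : 'rV[R]_n) rho k : 0 <= rho ->
  integral_Rn (ball_fun h rho k) =
  ball_volume R n * Num.sqrt rho ^+ n * ball_moment (n%:R / 2) (rho * sq_norm h) k.
Proof.
elim: n h rho k => [|n IH] h rho k rho0.
  rewrite /ball_volume big_ord0 expr0 !mul1r /= /ball_fun /dot /sq_norm !big_ord0 rho0.
  rewrite mulr0 mulr1; case: k => [|k]; first by rewrite /ball_moment big_ord0 expr0 divr1.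
  rewrite expr0n mul0r /ball_moment; case: ifP => // ok.
  have : (0 < (k.+1)./2)%N by move: ok; case: k.
  by case: (k.+1)./2 => // m _; rewrite big_ord_recl !mul0r.
pose h' : 'rV[R]_n := \row_i h 0 (lift ord0 i).
set h0 := h 0 ord0.
have dotE x y : dot h (cons_rV x y) = h0 * x + dot h' y.
  rewrite /dot big_ord_recl cons_rV0; congr (_ + _).
  by apply: eq_bigr => i _; rewrite cons_rVS mxE.
have sqE x (y : 'rV[R]_n) : sq_norm (cons_rV x y) = x ^+ 2 + sq_norm y.
  rewrite /sq_norm big_ord_recl cons_rV0; congr (_ + _).
  by apply: eq_bigr => i _; rewrite cons_rVS.
have sqh : sq_norm h = h0 ^+ 2 + sq_norm h'.
  rewrite /sq_norm big_ord_recl; congr (_ + _).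
  by apply: eq_bigr => i _; rewrite mxE.
have slice x : (fun y => ball_fun h rho k (cons_rV x y)) =
    (fun y => \sum_(i < k.+1) ((h0 * x) ^+ (k - i) / (k - i)`!%:R)
        * ball_fun h' (rho - x ^+ 2) i y).
  apply/funext => y; rewrite /ball_fun dotE sqE -lerBrDl exprDn.
  rewrite -mulrA big_distrl; apply: eq_bigr => i _ /=.
  have ik : (i <= k)%N by rewrite -ltnS.
  have := congr1 (fun k => k%:R : R) (bin_fact ik); rewrite !natrM => <-.
  have i0 : i`!%:R != 0 :> R by rewrite pnatr_eq0 -lt0n fact_gt0.
  have j0 : (k - i)`!%:R != 0 :> R by rewrite pnatr_eq0 -lt0n fact_gt0.
  have b0 : 'C(k, i)%:R != 0 :> R by rewrite pnatr_eq0 -lt0n bin_gt0.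
  rewrite -[_ *+ 'C(k, i)]mulr_natr.
  move: ((h0 * x) ^+ (k - i)) (dot h' y ^+ i) (if _ then _ else _) => u w ind.
  by field; rewrite i0 j0 b0.
pose c i : R := h0 ^+ (k - i) / (k - i)`!%:R * (ball_volume R n
    * ball_moment (n%:R / 2) (sq_norm h') i).
have inner x : integral_Rn (fun y => ball_fun h rho k (cons_rV x y)) =
    \sum_(i < k.+1) c i * slice_fun rho (k - i) (n + i) x.
  rewrite slice (@nice_integral_sum _ _ k.+1 (ball_fun h' (rho - x ^+ 2))
    (fun i => (h0 * x) ^+ (k - i) / (k - i)`!%:R)); last by move=> i _; exact: nice_ball_fun.
  apply: eq_bigr => i _; rewrite /slice_fun; case: ifP => hx; last first.
    rewrite mulr0 (_ : integral_Rn _ = 0) ?mulr0 //; apply: integral_Rn0 => y.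
    rewrite /ball_fun leNgt (lt_le_trans _ (sq_norm_ge0 y)) ?mulr0 //.
    by rewrite subr_lt0 ltNge hx.
  rewrite IH ?subr_ge0 // /c exprMn.
  have -> : ball_moment (n%:R / 2) ((rho - x ^+ 2) * sq_norm h') i =
      Num.sqrt (rho - x ^+ 2) ^+ i * ball_moment (n%:R / 2) (sq_norm h') i.
    rewrite /ball_moment; case: ifP => oi; first by rewrite mulr0.
    have iE : (nat_of_ord i = 2 * i./2)%N by have := odd_double_half i; rewrite oi; lia.
    have -> : Num.sqrt (rho - x ^+ 2) ^+ i = (rho - x ^+ 2) ^+ i./2.
      by rewrite {1}iE exprM sqr_sqrtr ?subr_ge0.
    elim: (i./2) => [|m IHm]; first by rewrite !big_ord0 mul1r.
    by rewrite !big_ord_recr /= IHm (exprS (rho - x ^+ 2) m); ring.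
  by rewrite exprD; ring.
rewrite integral_RnS (funext inner).
have int_sum m : mu.-integrable setT (EFin \o (fun x => \sum_(i < m) c i * slice_fun rho (k - i) (n + i) x))
   /\ Rintegral mu setT (fun x => \sum_(i < m) c i * slice_fun rho (k - i) (n + i) x) =
     \sum_(i < m) c i * Rintegral mu setT (slice_fun rho (k - i) (n + i)).
  elim: m => [|m [IHi IHe]].
    rewrite big_ord0; under eq_fun do rewrite big_ord0.
    split; first by apply: integrable0.
    by rewrite /Rintegral integral0.
  have -> : (fun x => \sum_(i < m.+1) c i * slice_fun rho (k - i) (n + i) x) =
     (fun x => \sum_(i < m) c i * slice_fun rho (k - i) (n + i) x
        + c m * slice_fun rho (k - m) (n + m) x).
    by apply/funext => x; rewrite big_ord_recr.
  have si := integrable_slice_fun (k - m) (n + m) rho0.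
  have ci := integrableZl measurableT (c m) si.
  split; first exact: (integrableD measurableT IHi ci).
  by rewrite (RintegralD measurableT IHi ci) IHe big_ord_recr RintegralZl.
rewrite (int_sum k.+1).2.
transitivity (\sum_(i < k.+1) (ball_volume R n * Num.sqrt rho ^+ (n + k).+1) *
   (h0 ^+ (k - i) / (k - i)`!%:R * ball_moment (n%:R / 2) (sq_norm h') i * T (k - i) (n + i))).
  apply: eq_bigr => i _; rewrite Rintegral_slice_fun // /c.
  have -> : (k - i + (n + i) = n + k)%N by have := ltn_ord i; lia.
  by ring.
have -> : ball_volume R n.+1 = ball_volume R n * T 0 n.
  by rewrite /ball_volume big_ord_recr.
rewrite -mulr_sumr -!mulrA; congr (_ * _).
have [ok|ek] := boolP (odd k).
  rewrite big1 ?mulr0; last first.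
    move=> i _; have [oi|ei] := boolP (odd i); first by rewrite ball_moment_odd // mulr0 mul0r.
    rewrite semicircle_moment_odd ?mulr0 // oddB; first by rewrite ok (negbTE ei).
    by rewrite -ltnS.
  by rewrite ball_moment_odd // !mulr0.
have -> : k = (2 * k./2)%N by have := odd_double_half k; rewrite (negbTE ek); lia.
set K := k./2.
have even_sum (F : nat -> R) m : (forall i, odd i -> F i = 0) ->
    \sum_(i < (2 * m).+1) F i = \sum_(j < m.+1) F (2 * j)%N.
  move=> F0; elim: m => [|m IHm]; first by rewrite !big_ord1.
  have -> : ((2 * m.+1).+1 = (2 * m).+3)%N by lia.
  rewrite 2!big_ord_recr [RHS]big_ord_recr /= IHm F0 ?addr0; last first.
    by rewrite /= mul2n odd_double.
  by congr (_ + F _); lia.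
under eq_bigr do rewrite -!mulrA.
rewrite (even_sum (fun i => h0 ^+ (2 * K - i) * ((2 * K - i)`!%:R^-1 *
   (ball_moment (n%:R / 2) (sq_norm h') i * T (2 * K - i) (n + i))))); last first.
  by move=> i oi; rewrite ball_moment_odd // mul0r !mulr0.
rewrite ball_moment_even sqh exprMn exprDn.
transitivity (Num.sqrt rho ^+ (n + 2 * K).+1 * (T 0 n * coef n.+1 K *
   \sum_(i < K.+1) (h0 ^+ 2) ^+ (K - i) * sq_norm h' ^+ i *+ 'C(K, i))).
  congr (_ * _); rewrite big_distrr; apply: eq_bigr => j _ /=.
  have jK : (j <= K)%N by rewrite -ltnS.
  have -> : (2 * K - 2 * j = 2 * (K - j))%N by lia.
  have := beta_coef n (K - j) j; rewrite subnK // => hb.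
  rewrite ball_moment_even (exprM h0) -[_ *+ 'C(K, j)]mulr_natr.
  move: hb; move: ((h0 ^+ 2) ^+ (K - j)) (sq_norm h' ^+ j) ((2 * (K - j))`!%:R^-1) => u w f.
  move: (T (2 * (K - j)) (n + 2 * j)) (coef n j) => x y hb.
  transitivity (u * w * (x * f * y)); first by ring.
  by rewrite hb; ring.
have -> : (n + 2 * K).+1 = (n.+1 + 2 * K)%N by rewrite addSn.
by rewrite exprD exprM sqr_sqrtr //; ring.
Qed.

End BallMoments.

(** * Cholesky factorization and moments of ellipsoids *)

Section Ellipsoid.
Variable R : realType.

Definition posdef (n : nat) (Q : 'M[R]_n) : Prop :=
  Q^T = Q /\ forall x : 'rV[R]_n, x != 0 -> 0 < (x *m Q *m x^T) 0 0.

(** Induction on the size: the first row of L is that of Q divided by the square root of the corner,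
    and the rest factors the Schur complement. *)
Lemma cholesky (n : nat) (Q : 'M[R]_n) : posdef Q ->
  exists L : 'M[R]_n, [/\ Q = L^T *m L, forall i j : 'I_n, (j < i)%N -> L i j = 0
    & forall i, 0 < L i i].
Proof.
elim: n Q => [|n IH] Q [Qsym Qpos].
  by exists 0; split=> [|[]|[]] //; apply/matrixP => -[].
pose Qb : 'M[R]_(1 + n) := Q.
pose A := ulsubmx Qb; pose r := ursubmx Qb; pose Q' := drsubmx Qb.
have QE : Qb = block_mx A r r^T Q'.
  rewrite -[LHS]submxK; congr block_mx.
  by rewrite /r trmx_ursub (_ : Qb^T = Qb).
have Q'sym : Q'^T = Q' by rewrite /Q' trmx_drsub (_ : Qb^T = Qb).
have form (s : 'rV[R]_1) (x : 'rV[R]_n) : row_mx s x *m Qb *m (row_mx s x)^T =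
    s *m A *m s^T + s *m r *m x^T + x *m r^T *m s^T + x *m Q' *m x^T.
  rewrite QE mul_row_block tr_row_mx mul_row_col !mulmxDl !addrA.
  by rewrite -!addrA; congr (_ + _); rewrite addrCA.
set a := A 0 0; have AE : A = a%:M by exact: mx11_scalar.
have a0 : 0 < a.
  have : row_mx (1%:M : 'rV[R]_1) (0 : 'rV[R]_n) != 0.
    apply/eqP => /matrixP /(_ 0 (lshift n ord0)) /eqP.
    by rewrite row_mxEl !mxE eqxx oner_eq0.
  move=> /(Qpos _); rewrite (form 1%:M 0) !mul0mx !addr0 trmx0 mulmx0 addr0.
  by rewrite trmx1 mulmx1 mul1mx.
set l := Num.sqrt a; have l0 : 0 < l by rewrite sqrtr_gt0.
have l2 : l * l = a by rewrite -expr2 sqr_sqrtr ?ltW.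
pose m := l^-1 *: r.
have Spos : posdef (Q' - m^T *m m).
  split.
    by rewrite linearB /= trmx_mul trmxK Q'sym.
  (* This s minimizes the form of Q over the first coordinate, and the minimum is the form of the
     Schur complement at x. *)
  move=> x x0; pose s : 'rV[R]_1 := - (l^-1 *: (x *m m^T)).
  have : row_mx s x != 0.
    apply: contra x0 => /eqP h; apply/eqP/rowP => j.
    by have := congr1 (fun v : 'rV[R]_(1 + n) => v 0 (rshift 1 j)) h; rewrite row_mxEr !mxE.
  move=> /(Qpos _); rewrite -[X in _ < fun_of_matrix X _ _]/(row_mx s x *m Qb *m (row_mx s x)^T).
  rewrite form; set t := (x *m m^T) 0 0.
  have sE : s = (- (l^-1 * t))%:M.
    by rewrite /s (mx11_scalar (x *m m^T)) -/t scale_scalar_mx -raddfN.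
  have xr : x *m r^T = (l * t)%:M.
    have -> : r = l *: m by rewrite /m scalerA mulfV ?gt_eqF // scale1r.
    by rewrite linearZ /= -scalemxAr (mx11_scalar (x *m m^T)) -/t scale_scalar_mx.
  have rx : r *m x^T = (l * t)%:M by rewrite -[LHS]trmxK trmx_mul trmxK xr tr_scalar_mx.
  have mm : x *m (m^T *m m) *m x^T = (t * t)%:M.
    rewrite mulmxA -mulmxA (mx11_scalar (x *m m^T)) -/t.
    have -> : m *m x^T = t%:M.
      by rewrite -[LHS]trmxK trmx_mul trmxK (mx11_scalar (x *m m^T)) -/t tr_scalar_mx.
    by rewrite -scalar_mxM.
  rewrite mulmxBr mulmxBl mm -[s *m r *m x^T]mulmxA rx xr sE AE tr_scalar_mx -!scalar_mxM.
  rewrite !mxE /= !mulr1n -l2.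
  have -> : - (l^-1 * t) * (l * l) * - (l^-1 * t) + - (l^-1 * t) * (l * t)
      + l * t * - (l^-1 * t) = - (t * t) by field; rewrite gt_eqF.
  by rewrite addrC.
have [L' [L'E L'tri L'pos]] := IH _ Spos.
pose L : 'M[R]_(1 + n) := block_mx l%:M m 0 L'.
exists L; split.
- suff main : Qb = L^T *m L by exact: main.
  rewrite QE /L tr_block_mx mulmx_block !trmx0 !mul0mx !mulmx0 !addr0 !tr_scalar_mx.
  rewrite -scalar_mxM l2 -AE mul_scalar_mx mul_mx_scalar -L'E addrC subrK.
  have lm : l *: m = r by rewrite /m scalerA mulfV ?gt_eqF // scale1r.
  have lmT : l *: m^T = r^T by rewrite -[in RHS]lm [RHS]linearZ.
  by rewrite lm lmT.
- move=> i j; rewrite /L !mxE; case: splitP => i'; rewrite ?(ord1 i') => ->.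
    by rewrite ltn0.
  rewrite mxE; case: splitP => j' ->; first by rewrite mxE.
  by rewrite ltn_add2l; exact: L'tri.
- move=> i; rewrite /L mxE; case: splitP => i' iE; rewrite mxE; case: splitP => i'' iE2.
  + by rewrite !ord1 mxE eqxx mulr1n.
  + by have := ltn_ord i'; move: iE2; rewrite iE; lia.
  + by have := ltn_ord i''; move: iE2; rewrite iE; lia.
  + have -> : i'' = i'; last exact: L'pos.
    by apply: val_inj; move: iE2; rewrite iE => /eqP; rewrite eqn_add2l => /eqP.
Qed.

Definition ellipsoid_ind (n : nat) (Q : 'M[R]_n) (rho : R) (y : 'rV[R]_n) : R :=
  if (y *m invmx Q *m y^T) 0 0 <= rho then 1 else 0.

Section Fixed.
Variables (n : nat) (Q : 'M[R]_n).
Hypothesis Qpos : posdef Q.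

(** From Q = L^T L follows L Q^-1 L^T = 1, so y = z L carries the ball onto the ellipsoid, while the
    linear form h becomes h L^T. *)
Lemma posdef_change : exists L : 'M[R]_n,
  [/\ forall i j : 'I_n, (j < i)%N -> L i j = 0, forall i, 0 < L i i,
      Num.sqrt (\det Q) = \prod_i L i i, 0 < \prod_i L i i &
      [/\ L \in unitmx,
      forall rho z, ellipsoid_ind Q rho (z *m L) = if sq_norm z <= rho then 1 else 0 &
      forall h, sq_norm (h *m L^T) = (h *m Q *m h^T) 0 0]].
Proof.
have [L [QE Ltri Lpos]] := cholesky Qpos.
have P0 : 0 < \prod_i L i i by apply: prodr_gt0.
have detL : \det L = \prod_i L i i.
  rewrite -det_tr det_trig; first by apply: eq_bigr => i _; rewrite mxE.
  by apply/is_trig_mxP => i j ij; rewrite mxE Ltri.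
have Lu : L \in unitmx by rewrite unitmxE detL unitfE gt_eqF.
have sqE (z : 'rV[R]_n) : (z *m z^T) 0 0 = sq_norm z.
  by rewrite mxE; apply: eq_bigr => i _; rewrite mxE expr2.
exists L; split=> //.
  by rewrite QE det_mulmx det_tr -expr2 sqrtr_sqr detL gtr0_norm.
split=> // [rho z|h].
  have QI : L *m invmx Q *m L^T = 1%:M.
    have Qu : Q \in unitmx by rewrite QE unitmx_mul unitmx_tr Lu.
    have LTu : L^T \in unitmx by rewrite unitmx_tr.
    have : L^T *m (L *m invmx Q *m L^T) = L^T *m 1%:M.
      by rewrite !mulmxA -QE mulmxV // mul1mx mulmx1.
    by move=> /(congr1 (mulmx (invmx L^T))); rewrite !mulKmx.
  have -> : ellipsoid_ind Q rho (z *m L) =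
      if (z *m (L *m invmx Q *m L^T) *m z^T) 0 0 <= rho then 1 else 0.
    by rewrite /ellipsoid_ind trmx_mul !mulmxA.
  by rewrite QI mulmx1 sqE.
by rewrite -sqE trmx_mul trmxK QE !mulmxA.
Qed.

Lemma ellipsoid_bounded rho : exists2 r, 0 <= r &
  forall y : 'rV[R]_n, ellipsoid_ind Q rho y != 0 -> forall i, `|y 0 i| <= r.
Proof.
have [L [_ _ _ _ [Lu indE _]]] := posdef_change.
exists (\sum_j \sum_i Num.sqrt rho * `|L i j|).
  by apply: sumr_ge0 => j _; apply: sumr_ge0 => i _; rewrite mulr_ge0 ?sqrtr_ge0.
move=> y; have yE : y = (y *m invmx L) *m L by rewrite mulmxKV.
rewrite yE indE; set z := y *m invmx L; case: ifP; rewrite ?eqxx // => zr _ j.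
rewrite (bigD1 j) //= ler_wpDr //.
  by apply: sumr_ge0 => j' _; apply: sumr_ge0 => i _; rewrite mulr_ge0 ?sqrtr_ge0.
rewrite mxE; apply: (le_trans (ler_norm_sum _ _ _)); apply: ler_sum => i _.
rewrite normrM ler_wpM2r // -sqrtr_sqr ler_sqrt.
  exact: le_trans (sq_norm_coord z i) zr.
exact: le_trans (sq_norm_ge0 z) zr.
Qed.

Lemma nice_ellipsoid (psi : 'rV[R]_n -> R) rho :
  joint_measurable (fun _ : unit => psi) ->
  (forall r, exists M, forall y : 'rV[R]_n, (forall i, `|y 0 i| <= r) -> `|psi y| <= M) ->
  nice (fun y => psi y * ellipsoid_ind Q rho y).
Proof.
move=> mpsi bpsi; split.
  move=> dd S g e mg me; apply: measurable_funM; first exact: (mpsi _ S g e mg me).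
  apply: measurable_fun_ifT => //; apply: measurable_fun_ler => //.
  under eq_fun do rewrite mxE.
  apply: measurable_sum => i.
  under eq_fun do rewrite !mxE.
  apply: measurable_funM; last exact: me.
  apply: measurable_sum => j; under eq_fun do rewrite mxE.
  exact: (measurable_funM (me j) (measurable_cst _)).
have [r r0 Er] := ellipsoid_bounded rho.
have [M Mpsi] := bpsi r.
exists (Num.max M 0), r; split=> //; split=> [y|y i ri].
  have [->|y0] := eqVneq (ellipsoid_ind Q rho y) 0.
    by rewrite mulr0 normr0 le_max lexx orbT.
  rewrite normrM le_max; apply/orP; left.
  have -> : ellipsoid_ind Q rho y = 1.
    by move: y0; rewrite /ellipsoid_ind; case: ifP; rewrite ?eqxx.
  by rewrite normr1 mulr1 Mpsi //; exact: Er.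
have [->|y0] := eqVneq (ellipsoid_ind Q rho y) 0; first by rewrite mulr0.
by move: ri; rewrite ltNge Er.
Qed.

Lemma measurable_dot_pow (h : 'rV[R]_n) k :
  joint_measurable (fun _ : unit => fun y => dot h y ^+ k).
Proof.
move=> dd S g e mg me; apply: measurable_funX; apply: measurable_sum => i.
by apply: measurable_funM => //; under eq_fun do rewrite mxE; exact: me.
Qed.

Lemma dot_bound (h y : 'rV[R]_n) r : (forall i, `|y 0 i| <= r) ->
  `|dot h y| <= \sum_i `|h 0 i| * r.
Proof.
move=> yr; apply: (le_trans (ler_norm_sum _ _ _)); apply: ler_sum => i _.
by rewrite normrM ler_wpM2l.
Qed.

Lemma dot_pow_bound (h : 'rV[R]_n) k r : exists M, forall y : 'rV[R]_n,
  (forall i, `|y 0 i| <= r) -> `|dot h y ^+ k| <= M.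
Proof.
exists (`|\sum_i `|h 0 i| * r| ^+ k) => y yr.
rewrite normrX lerXn2r ?nnegrE //.
exact: le_trans (dot_bound h yr) (ler_norm _).
Qed.

Lemma ellipsoid_moment (h : 'rV[R]_n) k rho : 0 <= rho ->
  integral_Rn (fun y => dot h y ^+ k * ellipsoid_ind Q rho y) =
  Num.sqrt (\det Q) * ball_volume R n * Num.sqrt rho ^+ n *
    (k`!%:R * ball_moment (n%:R / 2) (rho * (h *m Q *m h^T) 0 0) k).
Proof.
move=> rho0; have [L [Ltri Lpos detE _ [_ indE sqE]]] := posdef_change.
have nf := nice_ellipsoid rho (measurable_dot_pow h k) (dot_pow_bound h k).
rewrite (integral_Rn_affine 0 Ltri Lpos nf) detE -sqE.
have dotE z : dot h (0 + z *m L) = dot (h *m L^T) z.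
  rewrite add0r.
  have dE (u v : 'rV[R]_n) : dot u v = (u *m v^T) 0 0.
    by rewrite mxE; apply: eq_bigr => i _; rewrite mxE.
  by rewrite !dE trmx_mul mulmxA.
have f0 : k`!%:R != 0 :> R by rewrite pnatr_eq0 -lt0n fact_gt0.
have -> : (fun z => dot h (0 + z *m L) ^+ k * ellipsoid_ind Q rho (0 + z *m L)) =
   (fun z => k`!%:R * ball_fun (h *m L^T) rho k z + 0 * ball_fun (h *m L^T) rho k z).
  apply/funext => z; rewrite dotE add0r indE /ball_fun mul0r addr0.
  by rewrite [in RHS]mulrA [_ * (_ / _)]mulrC divfK.
rewrite nice_integral_lin; try exact: nice_ball_fun.
by rewrite integral_ball_fun // mul0r addr0; ring.
Qed.

End Fixed.
End Ellipsoid.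

(** * Density of the powers of linear forms *)

Section Approximation.
Variable R : realType.

(** Only x is confined to K: the point x' will be k / N for an arbitrary counter k, possibly outside
    the cube. *)
Lemma continuous_unif_compact (T : pseudoMetricType R) (G : T -> R) (K : set T) (e : R) :
  continuous G -> compact K -> 0 < e ->
  exists2 dl, 0 < dl & forall x x', K x -> ball x dl x' -> `|G x - G x'| <= e.
Proof.
move=> cG /compact_near_coveringP cK e0.
pose P (dl : R) (x : T) := forall x', ball x dl x' -> `|G x - G x'| <= e.
have [dl /= dl0 Hdl] : \forall dl \near (0 : R)^'+, K `<=` P dl.
  apply: cK => x Kx.
  have e2 : 0 < e / 2 by rewrite divr_gt0.
  have /cvgrPdist_lt/(_ _ e2)/nbhs_ballP[rho /= rho0 Hrho] := cG x.
  have r2 : 0 < rho / 2 by rewrite divr_gt0.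
  exists (ball x (rho / 2), [set dl | dl <= rho / 2]).
    by split; [exact: nbhsx_ballx|exact: nbhs_right_le].
  move=> [x1 dl] [/= b1 dl1] x2 b2.
  have bx1 : ball x rho x1 by apply: le_ball b1; rewrite ler_piMr ?ltW // invf_lt1 ?ltr1n.
  have bx2 : ball x rho x2.
    by rewrite (splitr rho); apply: ball_triangle b1 _; exact: le_ball b2.
  have h1 := Hrho _ bx1; have h2 := Hrho _ bx2.
  rewrite (splitr e) -(subrK (G x) (G x1)) -addrA; apply: (le_trans (ler_normD _ _)).
  by rewrite lerD // ?ltW // distrC.
exists (dl / 2); first by rewrite divr_gt0.
move=> x x' Kx; apply: Hdl Kx _ => //=; last by rewrite divr_gt0.
by rewrite sub0r normrN gtr0_norm ?divr_gt0 // ltr_pdivrMr // ltr_pMr // ltr1n.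
Qed.

(** The tail of the series at z is dominated term by term by the tail at B, so the m found at B
    serves for all z. *)
Lemma expR_approx (B e : R) : 0 < e -> exists m, forall z, `|z| <= B ->
  `|expR z - \sum_(k < m) z ^+ k / k`!%:R| <= e.
Proof.
move=> e0.
have cv (z : R) : series (exp_coeff z) @ \oo --> expR z by exact: is_cvg_series_exp_coeff.
have /cvgrPdist_le/(_ _ e0)[m _ Hm] := cv B.
exists m => z zB; have B0 : 0 <= B := le_trans (normr_ge0 z) zB.
have /= hm := Hm m (leqnn m).
have -> : \sum_(k < m) z ^+ k / k`!%:R = series (exp_coeff z) m.
  by rewrite /series /= big_mkord.
apply: le_trans hm; apply: (@le_trans _ _ (expR B - series (exp_coeff B) m)); last exact: ler_norm.
have cn : (fun n => `|series (exp_coeff z) n - series (exp_coeff z) m|) @ \oo -->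
    `|expR z - series (exp_coeff z) m|.
  by apply: cvg_norm; apply: cvgB; [exact: cv|exact: cvg_cst].
have cB : (fun n => series (exp_coeff B) n - series (exp_coeff B) m) @ \oo -->
    expR B - series (exp_coeff B) m.
  by apply: cvgB; [exact: cv|exact: cvg_cst].
apply: (ler_cvg_to cn cB); near=> n.
have mn : (m <= n)%N by near: n; exact: nbhs_infty_ge.
rewrite !sub_series_geq //; apply: (le_trans (ler_norm_sum _ _ _)).
apply: ler_sum => k _; rewrite /exp_coeff /= normrM normrX normfV (ger0_norm (ler0n _ _)).
by rewrite ler_wpM2r ?invr_ge0 // lerXn2r ?nnegrE.
Unshelve. all: by end_near. Qed.

Definition exp_sum n (l : seq (R * 'rV[R]_n)) (y : 'rV[R]_n) : R :=
  \sum_(q <- l) q.1 * expR (dot q.2 y).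

Definition power_sum n (l : seq (R * 'rV[R]_n * nat)) (y : 'rV[R]_n) : R :=
  \sum_(q <- l) q.1.1 * dot q.1.2 y ^+ q.2.

Lemma exp_sum_power_sum n (l : seq (R * 'rV[R]_n)) (r e : R) : 0 < e ->
  exists l', forall y : 'rV[R]_n, (forall i, `|y 0 i| <= r) ->
    `|exp_sum l y - power_sum l' y| <= e.
Proof.
elim: l e => [|[c h] l IH] e e0.
  by exists [::] => y _; rewrite /exp_sum /power_sum !big_nil subrr normr0 ltW.
have e2 : 0 < e / 2 by rewrite divr_gt0.
have [l' Hl'] := IH _ e2.
have c0 : 0 < `|c| + 1 by rewrite ltr_wpDl.
have [m Hm] := expR_approx (\sum_i `|h 0 i| * r) (divr_gt0 e2 c0).
exists ([seq (c / k`!%:R, h, k) | k <- iota 0 m] ++ l') => y yr.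
rewrite /exp_sum /power_sum big_cons big_cat /= -/(exp_sum l y) -/(power_sum l' y).
have -> : \sum_(q <- [seq (c / k`!%:R, h, k) | k <- iota 0 m]) q.1.1 * dot q.1.2 y ^+ q.2 =
    c * \sum_(k < m) dot h y ^+ k / k`!%:R.
  rewrite big_map -[m in iota _ m]subn0 -/(index_iota 0 m) big_mkord big_distrr.
  by apply: eq_bigr => k _ /=; rewrite mulrAC mulrA.
rewrite opprD addrACA -mulrBr (splitr e); apply: (le_trans (ler_normD _ _)).
rewrite lerD ?Hl' // normrM.
apply: (@le_trans _ _ ((`|c| + 1) * (e / 2 / (`|c| + 1)))); last first.
  by rewrite mulrC divfK // gt_eqF.
by rewrite ler_pM // ?lerDl // Hm // dot_bound.
Qed.

(** * Bernstein operators as expectations of random counters *)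

Section Walk.
Variable I : eqType.
Implicit Types (X : I -> R) (s : seq I) (F : (I -> nat) -> R) (k : I -> nat).

Definition incr (i : I) k : I -> nat := fun j => (k j + (j == i))%N.

(* The expectation of F after independent steps, the step i in s raising the
   i-th counter with probability X i; for s listing each index N times this is
   the Bernstein operator of degree N. *)
Fixpoint walk_mean X s F k : R :=
  if s is i :: s' then
    X i * walk_mean X s' F (incr i k) + (1 - X i) * walk_mean X s' F k
  else F k.

Lemma walk_mean_le X s F F' k : (forall i, 0 <= X i <= 1) -> (forall k, F k <= F' k) ->
  walk_mean X s F k <= walk_mean X s F' k.
Proof.
move=> X01 FF'; elim: s k => //= i s IH k; have /andP[x0 x1] := X01 i.
by rewrite lerD // ler_wpM2l // subr_ge0.
Qed.

Lemma walk_mean_lin X s F F' (a b : R) k :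
  walk_mean X s (fun k => a * F k + b * F' k) k =
  a * walk_mean X s F k + b * walk_mean X s F' k.
Proof. by elim: s k => //= i s IH k; rewrite !IH; ring. Qed.

Lemma walk_mean_cst X s (a : R) k : walk_mean X s (fun=> a) k = a.
Proof. by elim: s k => //= i s IH k; rewrite !IH; ring. Qed.

Lemma walk_mean_sum X s (J : finType) (G : J -> (I -> nat) -> R) k :
  walk_mean X s (fun k => \sum_j G j k) k = \sum_j walk_mean X s (G j) k.
Proof.
elim: s k => //= i s IH k; rewrite !IH !big_distrr -big_split.
by apply: eq_bigr.
Qed.

(** Squared bias plus variance: the j-th counter gains a binomial variable with [count_mem j s]
    trials of probability X j. *)
Lemma walk_mean_sqr X s (m : R) j k :
  walk_mean X s (fun k => ((k j)%:R - m) ^+ 2) k =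
  ((k j)%:R + (count_mem j s)%:R * X j - m) ^+ 2 + (count_mem j s)%:R * X j * (1 - X j).
Proof.
elim: s k => [|i s IH] k /=; first by ring.
rewrite !IH /incr (eq_sym j); case: (eqVneq i j) => [->|_] /=; last by rewrite addn0 add0n; ring.
by rewrite !natrD; ring.
Qed.

End Walk.

(** Multiplying by X_i = exp(y_i - r) only shifts the exponents by the i-th coordinate, so a
    polynomial in the X_i is an exponential sum in y. *)
Lemma walk_mean_exp n (s : seq 'I_n) F r k : exists l, forall y : 'rV[R]_n,
  walk_mean (fun i => expR (y 0 i - r)) s F k = exp_sum l y.
Proof.
elim: s k => [|i s IH] k /=.
  exists [:: (F k, 0)] => y; rewrite /exp_sum big_seq1 /dot big1 ?expR0 ?mulr1 //.
  by move=> i _; rewrite mxE mul0r.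
have [l1 H1] := IH (incr i k); have [l2 H2] := IH k.
pose sh (c : R) (q : R * 'rV[R]_n) := (c * expR (- r) * q.1, q.2 + delta_mx 0 i).
have shE c l y : exp_sum (map (sh c) l) y = c * (expR (y 0 i - r) * exp_sum l y).
  rewrite /exp_sum big_map !big_distrr; apply: eq_bigr => q _ /=.
  have -> : dot (q.2 + delta_mx 0 i) y = dot q.2 y + y 0 i.
    rewrite /dot (eq_bigr (fun j => q.2 0 j * y 0 j + (if j == i then y 0 j else 0))).
      by rewrite big_split -big_mkcond big_pred1_eq.
    move=> j _; rewrite !mxE eqxx mulrDl /=.
    by case: (j == i); rewrite ?mul0r ?mul1r.
  by rewrite !expRD; ring.
exists (map (sh 1) l1 ++ (l2 ++ map (sh (-1)) l2)) => y.
have catE l l' : exp_sum (l ++ l') y = exp_sum l y + exp_sum l' y by rewrite /exp_sum big_cat.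
by rewrite !catE !shE H1 H2; ring.
Qed.

Lemma continuous_power_sum n (phi : 'rV[R]_n -> R) (M r e : R) : continuous phi ->
  (forall y, `|phi y| <= M) -> 0 < r -> 0 < e ->
  exists l, forall y : 'rV[R]_n, (forall i, `|y 0 i| <= r) -> `|phi y - power_sum l y| <= e.
Proof.
move=> cphi bphi r0 e0; have M0 : 0 <= M := le_trans (normr_ge0 _) (bphi 0).
pose a := expR (- (2 * r)); have a0 : 0 < a := expR_gt0 _.
(* The inverse of y -> exp(y - r), frozen below exp(-2r), the value at y = -r; this makes G
   continuous on the whole space. *)
pose logr (x : R) := ln (Num.max x a) + r.
have clog : continuous logr.
  move=> x; apply: cvgD; last exact: cvg_cst.
  apply: (@continuous_comp _ _ _ (fun x => Num.max x a) (@ln R)).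
    by apply: continuous_max; [exact: cvg_id|exact: cvg_cst].
  by apply: continuous_ln; rewrite lt_max a0 orbT.
pose G (X : 'rV[R]_n) := phi (\row_i logr (X 0 i)).
have cG : continuous G.
  move=> X; apply: (@continuous_comp _ _ _ (fun X : 'rV[R]_n => \row_i logr (X 0 i)) phi);
    last exact: cphi.
  have FX : Filter (nbhs X) by exact: nbhs_filter.
  apply: (iffRL (@cvg_ballP _ _ _ (nbhs X) FX _ _)) => eps eps0.
  have : \forall X' \near X, forall i, (fun X' : 'rV[R]_n => `|logr (X 0 i) - logr (X' 0 i)| < eps) X'.
    apply: (@filter_forall _ _ _ (nbhs X) FX) => i; have cl := clog (X 0 i).
    have ci : {for X, continuous (logr \o (fun X' : 'rV[R]_n => X' 0 i))}.
      by apply: continuous_comp; [exact: coord_continuous|exact: cl].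
    by have /cvgrPdist_lt/(_ _ eps0) := ci.
  by apply: filterS => X' h; split=> // i j; rewrite !mxE; exact: h.
have bG X : `|G X| <= M by exact: bphi.
pose K := [set X : 'rV[R]_n | forall i, `[0, 1]%classic (X 0 i)].
have cK : compact K by apply: (@rV_compact R n (fun=> `[0, 1]%classic)) => i; exact: segment_compact.
have e4 : 0 < e / 4 by rewrite divr_gt0.
have [dl dl0 Hdl] := continuous_unif_compact cG cK e4.
have dl2 : 0 < dl ^+ 2 by rewrite exprn_gt0.
(* Each of the n counters has variance at most N, so the mean of V k / N^2 is at most n / N, and
   this N brings its multiple by 2M / dl^2 below e/4. *)
pose N := (Num.truncn (2 * M / dl ^+ 2 * n%:R / (e / 4))).+1.
have N0 : 0 < N%:R :> R by rewrite ltr0n.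
have HN : 2 * M / dl ^+ 2 * n%:R / N%:R <= e / 4.
  by rewrite ler_pdivrMr // [leRHS]mulrC -ler_pdivrMr // ltW // /N truncnS_gt.
pose s : seq 'I_n := flatten (nseq N (enum 'I_n)).
have count_s j : count_mem j s = N.
  rewrite count_flatten map_nseq sumn_nseq count_uniq_mem ?enum_uniq // mem_enum.
  by rewrite mul1n.
pose F (k : 'I_n -> nat) := G (\row_i ((k i)%:R / N%:R)).
have [l1 Hl1] := walk_mean_exp s F r (fun=> 0).
have e2 : 0 < e / 2 by rewrite divr_gt0.
have [l Hl] := exp_sum_power_sum l1 r e2.
exists l => y yr.
rewrite -(subrK (exp_sum l1 y) (phi y)) -addrA (splitr e).
apply: (le_trans (ler_normD _ _)); rewrite lerD ?Hl // -Hl1.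
pose X i := expR (y 0 i - r).
have X01 i : 0 <= X i <= 1.
  rewrite expR_ge0 -expR0 ler_expR subr_le0.
  by have := yr i; rewrite ler_norml => /andP[].
pose Xr : 'rV[R]_n := \row_i X i.
have GX : G Xr = phi y.
  rewrite /G; congr phi; apply/rowP => i; rewrite !mxE /logr max_l.
    by rewrite expRK subrK.
  rewrite ler_expR; have := yr i; rewrite ler_norml => /andP[h _]; lra.
have KX : K Xr.
  by move=> i; rewrite /= mxE in_itv /=; exact: X01.
pose C := 2 * M / dl ^+ 2 / N%:R ^+ 2.
pose V (k : 'I_n -> nat) := \sum_j ((k j)%:R - N%:R * X j) ^+ 2.
have C0 : 0 <= C by rewrite !divr_ge0 ?mulr_ge0 ?exprn_ge0 // ltW.
(* Chebyshev's argument: either k / N is within dl of X, or one term of V k is at least (dl N)^2 and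
   C V k exceeds the trivial bound 2M. *)
have FV k : `|F k - G Xr| <= e / 4 + C * V k.
  have V0 : 0 <= V k by apply: sumr_ge0 => j _; exact: sqr_ge0.
  case: (pselect (forall j, `|X j - (k j)%:R / N%:R| < dl)) => [close|/existsNP[j /negP]].
    apply: ler_wpDr; first exact: mulr_ge0.
    rewrite distrC; apply: Hdl => //; split=> // i j.
    by rewrite !mxE; exact: close.
  rewrite -leNgt => far; apply: ler_wpDl; first exact: ltW.
  have -> : `|F k - G Xr| <= C * V k = (`|F k - G Xr| <= 2 * M / dl ^+ 2 * (V k / N%:R ^+ 2)).
    by rewrite /C; congr (_ <= _); ring.
  apply: (@le_trans _ _ (2 * M)).
    by apply: (le_trans (ler_normB _ _)); rewrite mulr_natl mulr2n; apply: lerD; exact: bG.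
  rewrite -[leLHS](@divfK _ (dl ^+ 2)) ?gt_eqF //.
  apply: ler_wpM2l; first by rewrite !divr_ge0 ?mulr_ge0 // ltW.
  rewrite ler_pdivlMr ?exprn_gt0 // /V (bigD1 j) //=; apply: ler_wpDr.
    by apply: sumr_ge0 => i _; exact: sqr_ge0.
  have -> : (k j)%:R - N%:R * X j = - ((X j - (k j)%:R / N%:R) * N%:R).
    by field; rewrite gt_eqF.
  rewrite sqrrN exprMn ler_wpM2r ?sqr_ge0 // -[leRHS]real_normK ?num_real //.
  by rewrite lerXn2r ?nnegrE // ltW.
have meanV : walk_mean X s (fun k => e / 4 * 1 + C * V k) (fun=> 0) <= e / 2.
  rewrite (walk_mean_lin X s (fun=> 1) V) walk_mean_cst mulr1 walk_mean_sum.
  rewrite (_ : e / 2 = e / 4 + e / 4) ?lerD2l; last by field.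
  apply: le_trans HN.
  have -> : 2 * M / dl ^+ 2 * n%:R / N%:R = C * (n%:R * N%:R) by rewrite /C; field; nonzero.
  rewrite ler_wpM2l //.
  apply: (@le_trans _ _ (\sum_(j < n) N%:R)); last first.
    by rewrite sumr_const card_ord mulr_natl.
  apply: ler_sum => j _; rewrite walk_mean_sqr count_s add0r subrr expr0n add0r.
  have /andP[x0 x1] := X01 j.
  rewrite -mulrA; apply: ler_piMr => //; rewrite mulr_ile1 ?subr_ge0 //.
  by rewrite lerBlDr lerDl.
have mle F1 F2 : (forall k, F1 k <= F2 k) -> walk_mean X s F1 (fun=> 0) <= walk_mean X s F2 (fun=> 0).
  by move=> h; exact: walk_mean_le.
rewrite -GX distrC ler_norml; apply/andP; split.
- have := mle (fun k => 1 * G Xr + (-1) * (e / 4 * 1 + C * V k)) F.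
  rewrite walk_mean_lin walk_mean_cst => h; rewrite lerBrDl.
  apply: (le_trans _ (h _)) => [|k].
    by rewrite mul1r mulN1r lerD2l lerN2.
  by have := FV k; rewrite ler_norml => /andP[h1 _]; lra.
- have := mle F (fun k => 1 * G Xr + 1 * (e / 4 * 1 + C * V k)).
  rewrite walk_mean_lin walk_mean_cst => h; rewrite lerBlDl.
  apply: (le_trans (h _)) => [k|].
    by have := FV k; rewrite ler_norml => /andP[_ h1]; lra.
  by rewrite !mul1r lerD2l.
Qed.

Lemma measurable_power_sum n (l : seq (R * 'rV[R]_n * nat)) :
  joint_measurable (fun _ : unit => power_sum l).
Proof.
elim: l => [|q l IH] dd S g e mg me; rewrite /power_sum.
  by under eq_fun do rewrite big_nil; exact: measurable_cst.
under eq_fun do rewrite big_cons.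
apply: measurable_funD; last exact: (IH _ S g e mg me).
apply: measurable_funM => //; exact: (@measurable_dot_pow _ _ q.1.2 q.2 _ S g e mg me).
Qed.

(** The m-th power sum is within 1/(m+1) of phi on the cube of half-side m + 1, and each point lies
    in all large cubes, so phi is a pointwise limit of jointly measurable functions. *)
Lemma continuous_joint_measurable n (phi : 'rV[R]_n -> R) (M : R) : continuous phi ->
  (forall y, `|phi y| <= M) -> joint_measurable (fun _ : unit => phi).
Proof.
move=> cphi bphi dd S g e mg me.
have /choice[l Hl] (m : nat) : exists l, forall y : 'rV[R]_n,
    (forall i, `|y 0 i| <= m.+1%:R) -> `|phi y - power_sum l y| <= m.+1%:R^-1.
  by apply: (continuous_power_sum cphi bphi); rewrite ?invr_gt0 ltr0n.
apply: (@measurable_fun_cvg _ S R setT (fun m q => power_sum (l m) (\row_i e i q))).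
  by move=> m; exact: (@measurable_power_sum n (l m) _ S g e mg me).
move=> q _; apply/cvgrPdist_le => eps eps0; near=> m.
apply: (le_trans (Hl m _ _)).
  move=> i; apply: (@le_trans _ _ m%:R); last by rewrite ler_nat.
  apply: (@le_trans _ _ (\sum_j `|e j q|)); last by near: m; exact: nbhs_infty_ger.
  by rewrite mxE (bigD1 i) //= lerDl sumr_ge0.
by apply: ltW; near: m; exact: (near_infty_natSinv_lt (PosNum eps0)).
Unshelve. all: by end_near. Qed.

End Approximation.

(** * Convergence *)

Section Assembly.
Variables (R : realType) (d K : nat) (omega : 'rV[int]_d -> R).
Hypotheses (d_gt0 : (0 < d)%N)
  (omega_supp : forall v, v \notin lattice_box d K -> omega v = 0)
  (omega_ge0 : forall v, 0 <= omega v)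
  (omega_sum : \sum_(v <- lattice_box d K) omega v = 1)
  (omega_sym : forall v, omega (- v) = omega v)
  (cov_rank : \rank (cov_matrix omega) = d).

Local Notation Q := (cov_matrix omega).

Lemma cov_matrixE :
  Q = \sum_(v <- lattice_box d K) omega v *: ((toR R v)^T *m toR R v).
Proof. by apply: fsum_box => v vK; rewrite omega_supp // scale0r. Qed.

Let dotE (u v : 'rV[R]_d) : (u *m v^T) 0 0 = dot u v.
Proof. by rewrite mxE; apply: eq_bigr => i _; rewrite mxE. Qed.

Lemma mul_cov_matrix (h : 'rV[R]_d) :
  h *m Q = \sum_(v <- lattice_box d K) (omega v * dot h (toR R v)) *: toR R v.
Proof.
rewrite cov_matrixE mulmx_sumr; apply: eq_bigr => v _.
by rewrite -scalemxAr mulmxA [h *m _]mx11_scalar dotE mul_scalar_mx scalerA.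
Qed.

Lemma cov_quadratic (h : 'rV[R]_d) :
  (h *m Q *m h^T) 0 0 = \sum_(v <- lattice_box d K) omega v * dot h (toR R v) ^+ 2.
Proof.
rewrite mul_cov_matrix mulmx_suml summxE; apply: eq_bigr => v _.
rewrite -scalemxAl mxE dotE -mulrA; congr (_ * _).
by rewrite expr2; congr (_ * _); apply: eq_bigr => i _; rewrite mulrC.
Qed.

(** If x Q x^T = 0, all terms omega(v) (x.v)^2 vanish, hence also x Q = sum of omega(v) (x.v) v, and
    full rank gives x = 0. *)
Lemma posdef_cov_matrix : posdef Q.
Proof.
split.
  rewrite cov_matrixE raddf_sum; apply: eq_bigr => v _ /=.
  by rewrite linearZ /= trmx_mul trmxK.
move=> x x0; rewrite cov_quadratic.
have ge0 v : 0 <= omega v * dot x (toR R v) ^+ 2 by rewrite mulr_ge0 ?sqr_ge0.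
rewrite lt0r sumr_ge0 ?andbT => [|v _]; last exact: ge0.
apply: contra x0 => /eqP S0.
have Qfree : row_free Q by rewrite -row_leq_rank cov_rank.
rewrite -(mulmx_free_eq0 x Qfree) mul_cov_matrix.
apply/eqP; rewrite big_seq big1 // => v vK.
have /eqP : omega v * dot x (toR R v) ^+ 2 = 0.
  by move/eqP: S0; rewrite psumr_eq0 // => /allP /(_ v vK) /eqP.
rewrite mulf_eq0 sqrf_eq0 => /orP[] /eqP ->; by rewrite ?mul0r ?mulr0 scale0r.
Qed.

(** The rows of Q lie in the span of the support, so full rank provides d independent vectors there;
    c is the least of their weights, capped at 1. *)
Lemma support_basis : exists (V : 'M[int]_d) (c : R),
  [/\ \det V != 0, 0 < c & forall i, c <= omega (row i V)].
Proof.
pose S := [seq v <- lattice_box d K | omega v != 0].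
pose A : 'M[R]_(size S, d) := \matrix_i toR R (nth 0 S i).
have QA : (Q <= A)%MS.
  rewrite cov_matrixE; apply: summx_sub => v _.
  have [->|v0] := eqVneq (omega v) 0; first by rewrite scale0r sub0mx.
  rewrite scalemx_sub // mulmx_sub //.
  have vS : v \in S.
    by rewrite mem_filter v0; apply: contraNT v0 => /omega_supp ->.
  have iS : (index v S < size S)%N by rewrite index_mem.
  have -> : toR R v = row (Ordinal iS) A by rewrite rowK /= nth_index.
  exact: row_sub.
have Afull : row_full A by rewrite -col_leq_rank -[d in (d <= _)%N]cov_rank mxrankS.
pose f := fullrankfun Afull.
pose V : 'M[int]_d := \matrix_i nth 0 S (f i).
have VA : map_mx intr V = rowsub f A.
  by apply/matrixP => i j; rewrite !mxE.
have rowV i : 0 < omega (row i V).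
  rewrite rowK lt0r omega_ge0 andbT.
  have : nth 0 S (f i) \in S by exact: mem_nth.
  by rewrite mem_filter => /andP[].
exists V, (\big[Num.min/1]_i omega (row i V)); split.
- have := fullrowsub_unit Afull; rewrite -/f -VA unitmxE det_map_mx unitfE.
  by rewrite intr_eq0.
- by apply/bigmin_gtP; split.
- by move=> i; exact: bigmin_le_cond.
Qed.

Definition ellipsoid_const (t : R) : R :=
  Gamma_fn (dR R d / 2 + 1) / (pi `^ (dR R d / 2) * Num.sqrt (\det Q)) / t ^+ d.

Lemma u_limE t y : u_lim Q t y = ellipsoid_const t * ellipsoid_ind Q (t ^+ 2) y.
Proof. by []. Qed.

Lemma det_cov_gt0 : 0 < Num.sqrt (\det Q).
Proof. by have [L [_ _ -> ]] := posdef_change posdef_cov_matrix. Qed.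

(** The volume sqrt(det Q) t^d of the ellipsoid relative to the ball, and the volume of the ball,
    cancel with the constant; what remains is the limit found in [cvg_jacobi_moment]. *)
Lemma ellipsoid_const_moment t h k : 0 < t ->
  ellipsoid_const t * integral_Rn (fun y => dot h y ^+ k * ellipsoid_ind Q (t ^+ 2) y) =
  k`!%:R * ball_moment (d%:R / 2)
    (t ^+ 2 * \sum_(v <- lattice_box d K) omega v * dot h (toR R v) ^+ 2) k.
Proof.
move=> t0; rewrite (ellipsoid_moment posdef_cov_matrix) ?sqr_ge0 // sqrtr_sqr gtr0_norm //.
rewrite cov_quadratic /ellipsoid_const -(ball_volume_Gamma R d) /dR.
have D0 := det_cov_gt0; have td : 0 < t ^+ d by rewrite exprn_gt0.
have piP : 0 < ball_volume R d * Gamma_fn (d%:R / 2 + 1).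
  by rewrite ball_volume_Gamma powR_gt0 // pi_gt0.
have G0 : Gamma_fn (d%:R / 2 + 1 : R) != 0.
  by apply: contraTneq piP => ->; rewrite mulr0 ltxx.
have B0 : ball_volume R d != 0.
  by apply: contraTneq piP => ->; rewrite mul0r ltxx.
move: (ball_moment _ _ _) (ball_volume R d) (Gamma_fn _) (Num.sqrt _) (t ^+ d) (k`!%:R)
  D0 td G0 B0 => b V G s u f s0 u0 G0 V0.
by field; rewrite V0 G0 !gt_eqF.
Qed.

Definition empirical (t : R) (phi : 'rV[R]_d -> R) (e : R) : R :=
  pairing (jacobi omega (Num.truncn (t / e))) (fun v => phi (e *: toR R v)).

Definition limit_law (t : R) (phi : 'rV[R]_d -> R) : R :=
  ellipsoid_const t * integral_Rn (fun y => phi y * ellipsoid_ind Q (t ^+ 2) y).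

Lemma empiricalE t phi e : empirical t phi e =
  \sum_(v <- lattice_box d (Num.truncn (t / e) * K))
    jacobi omega (Num.truncn (t / e)) v * phi (e *: toR R v).
Proof. by apply: fsum_box => v vK; rewrite (jacobi_supp omega_supp vK) mul0r. Qed.

Lemma empirical_lin t (phi psi : 'rV[R]_d -> R) (b c e : R) :
  empirical t (fun y => b * phi y + c * psi y) e =
  b * empirical t phi e + c * empirical t psi e.
Proof.
rewrite !empiricalE !big_distrr -big_split; apply: eq_bigr => v _ /=.
by ring.
Qed.

Lemma limit_law_lin t (phi psi : 'rV[R]_d -> R) (b c : R) :
  nice (fun y => phi y * ellipsoid_ind Q (t ^+ 2) y) ->
  nice (fun y => psi y * ellipsoid_ind Q (t ^+ 2) y) ->
  limit_law t (fun y => b * phi y + c * psi y) =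
  b * limit_law t phi + c * limit_law t psi.
Proof.
move=> n1 n2; rewrite /limit_law.
under [X in integral_Rn X]eq_fun do rewrite mulrDl -2!mulrA.
by rewrite nice_integral_lin //; ring.
Qed.

Let power_sum_cons (q : R * 'rV[R]_d * nat) l :
  power_sum (q :: l) = (fun y => q.1.1 * dot q.1.2 y ^+ q.2 + 1 * power_sum l y).
Proof. by apply/funext => y; rewrite /power_sum big_cons mul1r. Qed.

Lemma power_sum_bounded (l : seq (R * 'rV[R]_d * nat)) r :
  exists M, forall y : 'rV[R]_d, (forall i, `|y 0 i| <= r) -> `|power_sum l y| <= M.
Proof.
elim: l => [|q l [M HM]].
  by exists 0 => y _; rewrite /power_sum big_nil normr0.
have [N HN] := dot_pow_bound q.1.2 q.2 r.
exists (`|q.1.1| * N + M) => y yr; rewrite power_sum_cons mul1r.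
apply: (le_trans (ler_normD _ _)); rewrite lerD ?HM // normrM.
by rewrite ler_wpM2l // HN.
Qed.

Lemma nice_power_sum l rho : nice (fun y => power_sum l y * ellipsoid_ind Q rho y).
Proof.
apply: (nice_ellipsoid posdef_cov_matrix); first exact: measurable_power_sum.
exact: power_sum_bounded.
Qed.

Lemma toRD (v w : 'rV[int]_d) : toR R (v + w) = toR R v + toR R w.
Proof. by apply/matrixP => i j; rewrite !mxE rmorphD. Qed.

Lemma dotDr (h y z : 'rV[R]_d) : dot h (y + z) = dot h y + dot h z.
Proof. by rewrite /dot -big_split; apply: eq_bigr => i _; rewrite !mxE mulrDr. Qed.

Lemma cvg_empirical_power_sum t l : 0 < t ->
  empirical t (power_sum l) @ 0^'+ --> limit_law t (power_sum l).
Proof.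
move=> t0; elim: l => [|q l IH].
  have p0 : power_sum [::] = (fun _ : 'rV[R]_d => 0 * 0 + 0 * 0).
    by apply/funext => y; rewrite /power_sum big_nil !mul0r addr0.
  have -> : limit_law t (power_sum [::]) = 0.
    by rewrite /limit_law integral_Rn0 ?mulr0 // => y; rewrite p0 !mul0r addr0 mul0r.
  rewrite (_ : empirical t _ = fun=> 0); first exact: cvg_cst.
  by apply/funext => e; rewrite p0 empirical_lin !mul0r addr0.
have nq := nice_ellipsoid posdef_cov_matrix (t ^+ 2)
  (measurable_dot_pow q.1.2 q.2) (dot_pow_bound q.1.2 q.2).
rewrite power_sum_cons (limit_law_lin _ _ nq (nice_power_sum l _)).
rewrite (_ : empirical t _ = fun e => q.1.1 * empirical t (fun y => dot q.1.2 y ^+ q.2) e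
   + 1 * empirical t (power_sum l) e); last by apply/funext => e; rewrite empirical_lin.
apply: cvgD; apply: cvgMr => //.
rewrite /limit_law ellipsoid_const_moment //.
have lD v w : dot q.1.2 (toR R (v + w)) = dot q.1.2 (toR R v) + dot q.1.2 (toR R w).
  by rewrite toRD dotDr.
have aE : d%:R = 2 * (d%:R / 2) :> R by field.
have := cvg_jacobi_moment d_gt0 omega_supp omega_sum omega_sym lD (m := q.2) aE t0.
rewrite (_ : empirical t _ = fun e => pairing (jacobi omega (Num.truncn (t / e)))
  (fun v => (e * dot q.1.2 (toR R v)) ^+ q.2)) //.
apply/funext => e; congr (pairing _ _); apply/funext => v; congr (_ ^+ _).
by rewrite /dot big_distrr; apply: eq_bigr => i _; rewrite !mxE mulrCA.
Qed.

Lemma cvg_empirical t phi M : 0 < t -> continuous phi -> (forall y, `|phi y| <= M) ->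
  empirical t phi @ 0^'+ --> limit_law t phi.
Proof.
move=> t0 cphi bphi.
have [V [c [V_det c_gt0 V_omega]]] := support_basis.
have [C HC] := jacobi_total_variation d_gt0 omega_supp omega_ge0 omega_sum omega_sym
  V_det c_gt0 V_omega.
have C0 : 0 <= C by apply: le_trans (HC 0%N); apply: sumr_ge0.
have mphi := continuous_joint_measurable cphi bphi.
have nphi := nice_ellipsoid posdef_cov_matrix (t ^+ 2) mphi (fun r => ex_intro _ M (fun y _ => bphi y)).
have [r1 r10 Er] := ellipsoid_bounded posdef_cov_matrix (t ^+ 2).
(* The cube of half-side r contains the ellipsoid and every rescaled support, since e [truncn](t/e)
   K <= t K. *)
pose r := r1 + t * K%:R + 1.
have tK : 0 <= t * K%:R by rewrite mulr_ge0 // ltW.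
have r0 : 0 < r by rewrite ltr_wpDl // addr_ge0.
apply/cvgrPdist_le => eps eps0.
(* Replacing phi by a power sum within e' on this cube costs e' times the total variation C on the
   lattice side, and e' times the constant of the density times the volume of the cube on the other;
   e' D = eps/2 covers both. *)
pose D := C + `|ellipsoid_const t| * (2 * r) ^+ d + 1.
have E0 : 0 <= `|ellipsoid_const t| * (2 * r) ^+ d.
  by rewrite mulr_ge0 // exprn_ge0 // mulr_ge0 // ltW.
have D0 : 0 < D by rewrite ltr_wpDl // addr_ge0.
have eps2 : 0 < eps / 2 by rewrite divr_gt0.
pose e' := eps / 2 / D.
have e'0 : 0 < e' by rewrite divr_gt0.
have [l Hl] := continuous_power_sum cphi bphi r0 e'0.
have /cvgrPdist_le/(_ _ eps2) := @cvg_empirical_power_sum t l t0.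
apply: filter_app; near=> e => hl.
have e0 : 0 < e by near: e; exact: nbhs_right_gt.
have disc : `|empirical t phi e - empirical t (power_sum l) e| <= e' * C.
  have -> : empirical t phi e - empirical t (power_sum l) e =
      empirical t (fun y => 1 * phi y + (-1) * power_sum l y) e.
    by rewrite empirical_lin mul1r mulN1r.
  rewrite empiricalE; apply: (le_trans (ler_norm_sum _ _ _)).
  apply: (@le_trans _ _ (e' * \sum_(v <- lattice_box d (Num.truncn (t / e) * K))
     `|jacobi omega (Num.truncn (t / e)) v|)); last by rewrite ler_wpM2l ?HC // ltW.
  rewrite big_distrr !big_seq; apply: ler_sum => v vK /=.
  rewrite normrM mulrC ler_wpM2r // mul1r mulN1r; apply: Hl => i.
  rewrite !mxE normrM gtr0_norm //.
  apply: (@le_trans _ _ (t * K%:R)); last by rewrite /r; lra.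
  move: vK; rewrite mem_lattice_box => /forallP /(_ i) vi.
  have {}vi : `|(v 0 i)%:~R| <= (Num.truncn (t / e) * K)%:R :> R.
    by rewrite -intr_norm -abszE ler_nat.
  apply: (@le_trans _ _ (e * (Num.truncn (t / e) * K)%:R)); first by rewrite ler_wpM2l // ltW.
  rewrite natrM mulrA ler_wpM2r // mulrC -ler_pdivlMr //.
  by rewrite truncn_le // divr_ge0 // ltW.
have cont : `|limit_law t phi - limit_law t (power_sum l)| <=
    e' * (`|ellipsoid_const t| * (2 * r) ^+ d).
  have -> : limit_law t phi - limit_law t (power_sum l) =
      limit_law t (fun y => 1 * phi y + (-1) * power_sum l y).
    by rewrite (limit_law_lin _ _ nphi (nice_power_sum l _)) mul1r mulN1r.
  have nd := nice_lin 1 (-1) nphi (nice_power_sum l (t ^+ 2)).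
  rewrite /limit_law normrM mulrCA ler_wpM2l //.
  have EE : (fun y => (1 * phi y + (-1) * power_sum l y) * ellipsoid_ind Q (t ^+ 2) y) =
    (fun y => 1 * (phi y * ellipsoid_ind Q (t ^+ 2) y)
      + (-1) * (power_sum l y * ellipsoid_ind Q (t ^+ 2) y)).
    by apply/funext => y; ring.
  apply: (@integral_Rn_bound _ _ _ r); rewrite ?(ltW r0) //.
    by rewrite EE; exact: nd.1.
  have out (y : 'rV[R]_d) i : r < `|y 0 i| -> ellipsoid_ind Q (t ^+ 2) y = 0.
    move=> ri; apply: contraTeq ri => /Er/(_ i) yi; rewrite -leNgt.
    by rewrite /r; lra.
  split=> y; last by move=> i /out ->; rewrite mulr0.
  have [y0|y0] := eqVneq (ellipsoid_ind Q (t ^+ 2) y) 0.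
    by rewrite y0 mulr0 normr0 ltW.
  have -> : ellipsoid_ind Q (t ^+ 2) y = 1.
    by move: y0; rewrite /ellipsoid_ind; case: ifP; rewrite ?eqxx.
  rewrite mulr1 mul1r mulN1r; apply: Hl => i.
  by have := Er _ y0 i; rewrite /r; lra.
have bound : e' * C + e' * (`|ellipsoid_const t| * (2 * r) ^+ d) <= eps / 2.
  rewrite -mulrDr -[leRHS](@divfK _ D) ?gt_eqF //; apply: ler_wpM2l; first exact: ltW.
  by rewrite /D lerDl.
move: hl disc cont; rewrite !ler_norml => /andP[a1 a2] /andP[b1 b2] /andP[c1 c2].
by apply/andP; split; lra.
Unshelve. all: by end_near. Qed.

End Assembly.

Unset Implicit Arguments.

Theorem theorem3 (R : realType) (d : nat) (omega : 'rV[int]_d -> R) :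
  (0 < d)%N ->
  (forall v, 0 <= omega v) ->
  finite_set [set v | omega v != 0] ->
  \sum_(v \in [set: 'rV[int]_d]) omega v = 1 ->
  \sum_(v \in [set: 'rV[int]_d]) omega v *: toR R v = 0 ->
  (forall v, omega (- v) = omega v) ->
  rw_aperiodic omega ->
  \rank (cov_matrix omega) = d ->
  forall t : R, 0 < t ->
  forall phi : 'rV[R]_d -> R,
    continuous phi -> (exists M : R, forall y, `|phi y| <= M) ->
    (fun eps : R =>
       \sum_(v \in [set: 'rV[int]_d])
          jacobi omega (Num.truncn (t / eps)) v * phi (eps *: toR R v))
      @ 0^'+ -->
    integral_Rn (fun y : 'rV[R]_d => phi y * u_lim (cov_matrix omega) t y).
Proof.
move=> d_gt0 omega_ge0 omega_fin omega_sum1 _ omega_sym _ cov_rank t t0 phi cphi [M bphi].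
have [K HK] := finite_in_box omega_fin.
have omega_supp v : v \notin lattice_box d K -> omega v = 0.
  by move=> vK; apply/eqP; apply: contraNT vK => /HK.
have omega_sum : \sum_(v <- lattice_box d K) omega v = 1 by rewrite -(fsum_box omega_supp).
have pos := posdef_cov_matrix omega_supp omega_ge0 cov_rank.
have := cvg_empirical d_gt0 omega_supp omega_ge0 omega_sum omega_sym cov_rank t0 cphi bphi.
rewrite /limit_law (_ : integral_Rn (fun y => phi y * u_lim _ t y) =
  ellipsoid_const omega t * integral_Rn (fun y => phi y * ellipsoid_ind (cov_matrix omega) (t ^+ 2) y)) //.
have n1 := nice_ellipsoid pos (t ^+ 2) (continuous_joint_measurable cphi bphi)
  (fun r => ex_intro _ M (fun y _ => bphi y)).
(* A term with coefficient 0 is added so that extracting the constant becomes an instance of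
   [nice_integral_lin]. *)
rewrite -[RHS]addr0 -[X in _ + X](mul0r (integral_Rn (fun y => phi y * ellipsoid_ind (cov_matrix omega) (t ^+ 2) y))).
rewrite -nice_integral_lin //; congr integral_Rn; apply/funext => y.
by rewrite u_limE mul0r addr0 mulrCA.
Qed.
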